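(* Let $(S_n)_{n\ge1}$ and $(\psi_n)_{n\ge1}$ be sequences of real-valued random variables on a probability space $(\mathcal M,\mu)$, and set $\xi_n\equiv1$. Let $r'$ be a positive integer and $r\ge1$ a real number. Assume each $\psi_n$ is a probability density with respect to $\mu$ and let $\mathbb P_n$ be the probability measure on $\mathcal M$ with density $\psi_n$ with respect to $\mu$. Suppose Assumptions $(\alpha)[r']$, $(\beta)$ and $(\delta)[r]$ hold. Then there exist polynomials $P_k$ such that $$\mathbb P_n\left(\frac{S_n}{\sqrt n}\le x\right)=\mathfrak N(x)+\mathfrak n(x)\sum_{k=1}^{\min(r',\lfloor r\rfloor)}\frac{P_k(x)}{n^{k/2}}+o\big(n^{-\min(r,r')/2}\big),$$ uniformly in $x\in\mathbb R$.
   Context: All assumptions below are taken with $\xi_n\equiv 1$ and $\mathbb X=\mathbb R$, $\mathbb X^*=\mathbb R$. $\mathcal{SP}$ is the set of real sequences $(a_n)$ with $a_n=o(n^{-p})$ for every $p>0$; $\mathcal{LP}$ is the set of real sequences $(b_n)$ with $b_n=o(n^{p})$ for every $p>0$. Assumption $(\alpha)[m]$ ($m$ a nonnegative integer): there exist $\delta>0$ and $n_0\ge1$ such that $s\mapsto\mathbb E_\mu(\psi_ne^{isS_n}\xi_n)$ is $C^{m+2}$ on $[-\delta,\delta]$, and there exist $(b_n)\in\mathcal{LP}$, $(a_n)\in\mathcal{SP}$, a $C^{m+2}$ complex-valued function $s\mapsto\lambda(is)$ on $[-\delta,\delta]$ with $\lambda(is)=1-\frac{\sigma^2s^2}{2}+o(s^2)$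 for some $\sigma^2>0$, and constants $B_0,\dots,B_{m+2}$, such that for all $n\ge n_0$, $|s|<\delta$ and $j=0,\dots,m+2$: $|H_n^{(j)}(0)-B_j|=O(a_n)$ and $|\lambda(is)^nH_n^{(j)}(s)|\le b_ne^{-\sigma^2s^2/8}+a_n$, where $H_n(s):=\lambda(is)^{-n}\mathbb E_\mu(\psi_ne^{isS_n}\xi_n)$. Assumption $(\beta)$: for every compact $K\subset\mathbb X^*\setminus\{0\}$ there is $(a_n)\in\mathcal{SP}$ with $\sup_{s\in K}|\mathbb E_\mu(\psi_ne^{isS_n}\xi_n)|\le a_n$. Assumption $(\delta)[r]$ ($r$ real): $\mathbb X=\mathbb R$ and for every $B>0$ there exists $K>0$ such that $\int_{K<|s|<Bn^{(r-1)/2}}\frac{|\mathbb E_\mu(\psi_ne^{isS_n})|}{|s|}\,ds=o(n^{-r/2})$. $\mathfrak N$ and $\mathfrak n$ are the distribution function and density of the centered Gaussian law with variance $\sigma^2$ from $(\alpha)[r']$. *)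

(* Defs.v *)
From HB Require Import structures.
From mathcomp Require Import all_boot all_order all_algebra.
From mathcomp Require Import all_classical all_reals all_analysis.
From mathcomp Require Import complex.
Set Implicit Arguments.
Unset Strict Implicit.
Unset Printing Implicit Defensive.
Import Order.TTheory GRing.Theory Num.Theory.
Import numFieldNormedType.Exports.
Local Open Scope classical_set_scope.
Local Open Scope ring_scope.
Local Open Scope complex_scope.

Definition SP {R : realType} (a : nat -> R) : Prop :=
  forall p : R, 0 < p -> (fun n : nat => a n * (n%:R `^ p)) @ \oo --> (0 : R).

Definition LP {R : realType} (b : nat -> R) : Prop :=
  forall p : R, 0 < p -> (fun n : nat => b n / (n%:R `^ p)) @ \oo --> (0 : R).

Definition charf {R : realType} {d : measure_display} {T : measurableType d}
  (mu : probability T R) (S psi : nat -> T -> R) (n : nat) (s : R) : R[i] :=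
  (Rintegral mu setT (fun w => psi n w * cos (s * S n w)))
  +i* (Rintegral mu setT (fun w => psi n w * sin (s * S n w))).

Definition cderiv {R : realType} (f : R -> R[i]) : R -> R[i] :=
  fun s => (derive1 (fun t => complex.Re (f t)) s) +i* (derive1 (fun t => complex.Im (f t)) s).

Definition cderivn {R : realType} (j : nat) (f : R -> R[i]) : R -> R[i] :=
  iter j (@cderiv R) f.

Definition Ck_on {R : realType} (k : nat) (f : R -> R[i]) (D : set R) : Prop :=
  (forall j, (j < k)%N -> forall s, D s ->
     derivable (fun t => complex.Re (cderivn j f t)) s 1 /\
     derivable (fun t => complex.Im (cderivn j f t)) s 1) /\
  (forall s, D s ->
     {for s, continuous (fun t => complex.Re (cderivn k f t))} /\
     {for s, continuous (fun t => complex.Im (cderivn k f t))}).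

(** Assumption (alpha)[m] with xi_n = 1 and variance parameter sigma2.
    lam s stands for lambda(i s). *)
Definition assumption_alpha {R : realType} {d : measure_display}
  {T : measurableType d} (mu : probability T R) (S psi : nat -> T -> R)
  (m : nat) (sigma2 : R) : Prop :=
  0 < sigma2 /\
  exists delta : R, 0 < delta /\
  exists n0 : nat, (1 <= n0)%N /\
  (forall n, (n0 <= n)%N -> Ck_on m.+2 (charf mu S psi n) [set s | `|s| < delta]) /\
  exists (b a : nat -> R) (lam : R -> R[i]) (B : nat -> R[i]),
    LP b /\ SP a /\
    Ck_on m.+2 lam [set s | `|s| < delta] /\
    (forall s, `|s| < delta -> lam s != 0) /\
    (forall eps : R, 0 < eps -> exists eta : R, 0 < eta /\
       forall s : R, `|s| < eta ->
         Normc.normc (lam s - (1 - sigma2 * s ^+ 2 / 2)%:C) <= eps * s ^+ 2) /\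
    let H n := fun s => (lam s ^+ n)^-1 * charf mu S psi n s in
    (forall j, (j <= m.+2)%N -> exists C : R,
       \forall n \near \oo, Normc.normc (cderivn j (H n) 0 - B j) <= C * a n) /\
    (forall n, (n0 <= n)%N -> forall s, `|s| < delta ->
       forall j, (j <= m.+2)%N ->
         Normc.normc (lam s ^+ n * cderivn j (H n) s)
           <= b n * expR (- (sigma2 * s ^+ 2) / 8) + a n).

Definition assumption_beta {R : realType} {d : measure_display}
  {T : measurableType d} (mu : probability T R) (S psi : nat -> T -> R) : Prop :=
  forall K : set R, compact K -> K `<=` ~` [set 0] ->
    exists a : nat -> R, SP a /\
      forall n, (1 <= n)%N -> forall s, K s -> Normc.normc (charf mu S psi n s) <= a n.

Definition assumption_delta {R : realType} {d : measure_display}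
  {T : measurableType d} (mu : probability T R) (S psi : nat -> T -> R)
  (r : R) : Prop :=
  forall B : R, 0 < B -> exists K : R, 0 < K /\
    forall eps : R, 0 < eps -> \forall n \near \oo,
      (\int[@lebesgue_measure R]_(s in [set s : R | (K < `|s| < B * (n%:R `^ ((r - 1) / 2)))%R])
          (Normc.normc (charf mu S psi n s) / `|s|)%:E
        <= (eps * (n%:R `^ (- (r / 2))))%:E)%E.

Definition Pn_cdf {R : realType} {d : measure_display} {T : measurableType d}
  (mu : probability T R) (S psi : nat -> T -> R) (n : nat) (x : R) : R :=
  Rintegral mu [set w | S n w / Num.sqrt n%:R <= x] (psi n).

Definition gauss_cdf {R : realType} (sigma2 x : R) : R :=
  fine (normal_prob 0 (Num.sqrt sigma2) [set t : R | t <= x]).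
Definition gauss_pdf {R : realType} (sigma2 x : R) : R :=
  normal_pdf 0 (Num.sqrt sigma2) x.

(* Main.v *)
(* Esseen's smoothing inequality, applied with the Fejer kernel, bounds the distance between the
   two distribution functions by a multiple of 1/T plus the integral over ]0, T] of
   |phi_n(t) - gamma_n(t)| / t, where phi_n is the characteristic function of S_n / sqrt n under
   P_n, gamma_n is the Fourier transform of the expansion, and T is a large multiple of n^(r/2).
   The range t > K sqrt n is (delta), a compact range of t / sqrt n away from 0 is (beta).

   Near zero, write E(psi_n e^(i s S_n)) = lam(s)^n H_n(s) and replace H_n by its Taylor polynomial
   at 0, whose coefficients are those B_j / j! up to a superpolynomially small error.  In Cauchy's
   form of the remainder the top derivative of H_n is evaluated at th s and multiplied by
   (1 - th)^(m+1), while |lam(s)|^n <= |lam(th s)|^n exp(- n V s^2 (1 - th) / 4).  The bound (alpha)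
   at th s and the exponential factor together turn |s|^(m+2) (1 - th)^(m+1) into
   |s| n^(-(m+1)/2), up to a factor growing slower than any power of n; this is integrable against
   ds / |s|.  Finally lam(s) = exp(- V s^2 / 2) (1 + s^3 q(s) + o(s^(m+2))) with q a polynomial, and
   with s = t / sqrt n the binomial expansion of (1 + s^3 q(s))^n is a polynomial in n^(-1/2) and t
   up to negligible terms.  Inverting the Fourier transform termwise yields the P_k as combinations
   of Hermite polynomials. *)

Require Import Defs.
From HB Require Import structures.
From mathcomp Require Import all_boot all_order all_algebra.
From mathcomp Require Import all_classical all_reals all_analysis.
From mathcomp Require Import measurable_realfun complex ring lra.
Import Order.TTheory GRing.Theory Num.Theory.
Import numFieldNormedType.Exports.
Local Open Scope classical_set_scope.
Local Open Scope ring_scope.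
Set Implicit Arguments.
Unset Strict Implicit.
Unset Printing Implicit Defensive.

(** The weight 1 / t is singular at 0, so every error near zero must carry a factor t. It does,
    because [B 0 = 1] is forced exactly by [f n 0 = 1] and because all higher orders of the
    expansion vanish at t = 0. The smoothing step asks for no moment of S_n: it uses increments C x
    - C y of the smoothed difference, whose kernel (sin (t x) - sin (t y)) / t stays bounded, and
    lets y tend to -oo.

    The B_j are complex while the P_k must be real. Since f_n(- s) is the conjugate of f_n(s),
    averaging the approximation at t with the conjugate of the one at - t leaves real coefficients
    of (i t)^j at no cost in the error.

    Part of the Taylor error, of the form n^(-1/2) t, has no Gaussian decay. After division by t and
    integration over t < dl sqrt n it leaves a constant, made small by its prefactor.

    The order of choices matters. The Lipschitz constant of the expansion is uniform in n; with eps
    it fixes T / n^(r/2), and (delta) then supplies K. The width dl of the zone near zero depends on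
    eps, and (beta) comes last, on the compact [dl, K + 1]. *)

Local Notation nc := Normc.normc.
Local Notation Re z := (@complex.Re (Real.sort _) z).
Local Notation Im z := (@complex.Im (Real.sort _) z).

(** * Derivatives, integrability and the Fejer kernel *)

Section pointwise_derivatives.
Context {R : realType}.
Implicit Types (f g : R -> R) (x a b k : R).

Lemma pder_cst k x : is_derive x 1 (fun=> k) (0 : R).
Proof. exact: is_derive_cst. Qed.

Lemma pder_id x : is_derive x 1 (fun t : R => t) (1 : R).
Proof. exact: is_derive_id. Qed.

Lemma pder_add f g x a b : is_derive x 1 f a -> is_derive x 1 g b ->
  is_derive x 1 (fun t => f t + g t) (a + b).
Proof. exact: is_deriveD. Qed.

Lemma pder_sub f g x a b : is_derive x 1 f a -> is_derive x 1 g b ->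
  is_derive x 1 (fun t => f t - g t) (a - b).
Proof. exact: is_deriveB. Qed.

Lemma pder_opp f x a : is_derive x 1 f a -> is_derive x 1 (fun t => - f t) (- a).
Proof. exact: is_deriveN. Qed.

Lemma pder_mul f g x a b : is_derive x 1 f a -> is_derive x 1 g b ->
  is_derive x 1 (fun t => f t * g t) (f x * b + g x * a).
Proof. exact: is_deriveM. Qed.

Lemma pder_expn f x a n : is_derive x 1 f a ->
  is_derive x 1 (fun t => f t ^+ n) (n%:R * f x ^+ n.-1 * a).
Proof.
move=> fa; elim: n => [|n IH]; first by rewrite !mul0r; exact: is_derive_cst.
under eq_fun do rewrite exprS.
apply: (is_derive_eq (pder_mul fa IH)); case: n {IH} => [|n] /=; last by rewrite (exprS _ n) -[n.+2%:R]natr1; ring.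
by rewrite expr0; ring.
Qed.

Lemma pder_comp f g x a b : is_derive (g x) 1 f a -> is_derive x 1 g b ->
  is_derive x 1 (fun t => f (g t)) (a * b).
Proof. by move=> ? ?; exact: is_derive1_comp. Qed.

Lemma pder_cos f x a : is_derive x 1 f a ->
  is_derive x 1 (fun t => cos (f t)) (- sin (f x) * a).
Proof. exact: pder_comp. Qed.

Lemma pder_sin f x a : is_derive x 1 f a ->
  is_derive x 1 (fun t => sin (f t)) (cos (f x) * a).
Proof. exact: pder_comp. Qed.

Lemma pder_expR f x a : is_derive x 1 f a ->
  is_derive x 1 (fun t => expR (f t)) (expR (f x) * a).
Proof. exact: pder_comp. Qed.

Lemma pder_horner (p : {poly R}) f x a : is_derive x 1 f a ->
  is_derive x 1 (fun t => p.[f t]) (p^`().[f x] * a).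
Proof. exact: pder_comp. Qed.

Lemma pder_inv f x a : f x != 0 -> is_derive x 1 f a ->
  is_derive x 1 (fun t => (f t)^-1) (- (f x) ^- 2 * a).
Proof.
by move=> fx0 dfx; apply: (is_derive_eq (is_deriveV fx0 dfx)).
Qed.

Lemma is_derive_continuous_at f x a : is_derive x 1 f a -> {for x, continuous f}.
Proof. by move=> [df _]; apply: differentiable_continuous; exact/derivable1_diffP. Qed.

End pointwise_derivatives.

(* [notypeclasses refine] keeps the library instances from producing derivatives
   written with scalings, which [ring] and [field] do not understand. *)
Ltac derive_step := first
  [ eassumption | exact: pder_cst | exact: pder_id
  | notypeclasses refine (pder_expn _ _)
  | notypeclasses refine (pder_cos _) | notypeclasses refine (pder_sin _)
  | notypeclasses refine (pder_expR _) | notypeclasses refine (pder_horner _ _)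
  | notypeclasses refine (pder_mul _ _) | notypeclasses refine (pder_sub _ _)
  | notypeclasses refine (pder_add _ _) | notypeclasses refine (pder_opp _) ].
Ltac derive_tac := notypeclasses refine (is_derive_eq _ _); [repeat derive_step|rewrite /=].
Ltac continuous_tac :=
  let x := fresh "x" in move=> x; notypeclasses refine (is_derive_continuous_at _); repeat derive_step.

Section FTC.
Context {R : realType}.
Notation leb := (@lebesgue_measure R).
Implicit Types (f F : R -> R) (a b : R).

Lemma continuous_integrable_itv f a b (c d : bool) : continuous f ->
  leb.-integrable [set` Interval (BSide c a) (BSide d b)] (EFin \o f).
Proof.
move=> cf; apply: (@integrableS _ _ _ leb `[a, b]) => //.
  by move=> x /=; rewrite !in_itv/= => /andP[]; case: c; case: d => /= ? ?; apply/andP; split => //; exact: ltW.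
by apply: continuous_compact_integrable; [exact: segment_compact|exact: continuous_subspaceT].
Qed.

Lemma Rintegral_FTC2 f F a b : a <= b -> continuous f ->
  (forall x : R, is_derive x 1 F (f x)) ->
  \int[leb]_(t in `]a, b]) f t = F b - F a.
Proof.
move=> ab cf dF.
rewrite Rintegral_itv_obnd_cbnd; last exact: continuous_integrable_itv.
move: ab; rewrite le_eqVlt => /predU1P[<-|ab].
  by rewrite set_itv1 Rintegral_set1 subrr.
have cF : continuous F by move=> x; exact: is_derive_continuous_at (dF x).
rewrite /Rintegral (@continuous_FTC2 _ f F)//=.
- exact: continuous_subspaceT.
- split=> [x _| |]; last 2 first.
  + exact/cvg_at_right_filter/cF.
  + exact/cvg_at_left_filter/cF.
  by have [] := dF x.
- by move=> x _; rewrite derive1E; case: (dF x).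
Qed.

End FTC.

Lemma abs_sinB_le (R : realType) (x y : R) : `|sin x - sin y| <= `|x - y|.
Proof.
wlog yx : x y / y <= x.
  by move=> H; have [/H//|/ltW/H] := leP y x; rewrite distrC (distrC y).
have [c _ ->] := @MVT_segment R sin cos y x yx
  (fun y _ => is_derive_sin y) (continuous_subspaceT (@continuous_sin R)).
by rewrite normrM ler_piMl// cos_max.
Qed.

Lemma abs_sin_le (R : realType) (x : R) : `|sin x| <= `|x|.
Proof. by have := abs_sinB_le x 0; rewrite sin0 !subr0. Qed.

Lemma onem_cosE (R : realType) (x : R) : 1 - cos x = 2 * sin (x / 2) ^+ 2.
Proof.
have -> : cos x = cos ((x / 2) *+ 2) by congr cos; rewrite -mulr_natr; field.
by rewrite cos_mulr2n cos2sin2 -mulr_natr; ring.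
Qed.

Lemma onem_cos_ge0 (R : realType) (x : R) : 0 <= 1 - cos x.
Proof. by rewrite subr_ge0 cos_le1. Qed.

Lemma onem_cos_le (R : realType) (x : R) : 1 - cos x <= x ^+ 2 / 2.
Proof.
rewrite onem_cosE.
have := abs_sin_le (x / 2); rewrite -ler_sqr ?nnegrE// !real_normK ?num_real//.
rewrite exprMn; lra.
Qed.

(** The mean value theorem gives sin (x / 2) = (x / 2) cos c with 0 <= c <= 1 / 2, hence cos c >= 3
    / 4 and cos c ^ 2 >= 1 / 2. Inserted in 1 - cos x = 2 sin (x / 2) ^ 2, this yields the constant
    1 / 4. *)
Lemma onem_cos_ge (R : realType) (x : R) : `|x| <= 1 -> x ^+ 2 / 4 <= 1 - cos x.
Proof.
wlog x0 : x / 0 <= x.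
  move=> H; have [/H//|x0] := leP 0 x.
  by rewrite -normrN -sqrrN -cosN => /H; apply; rewrite oppr_ge0 ltW.
rewrite ger0_norm// => x1.
have [c /itvP ci] := @MVT_segment R sin cos 0 (x / 2) (divr_ge0 x0 (ler0n _ 2))
  (fun y _ => is_derive_sin y) (continuous_subspaceT (@continuous_sin R)).
rewrite sin0 !subr0 onem_cosE => ->.
have c0 : 0 <= c by rewrite ci.
have c1 : c <= 2^-1 by rewrite (@le_trans _ _ (x / 2)) ?ci//; lra.
have c2 : 3 / 4 <= cos c.
  have := onem_cos_le c; have : c ^+ 2 <= 2^-1 ^+ 2 by rewrite ler_sqr ?nnegrE.
  rewrite exprVn; lra.
have h : 2^-1 <= cos c ^+ 2.
  apply: (@le_trans _ _ ((3 / 4) ^+ 2)); first by lra.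
  by rewrite ler_sqr ?nnegrE//; lra.
have : 0 <= x ^+ 2 * (cos c ^+ 2 - 2^-1) by rewrite mulr_ge0 ?sqr_ge0 ?subr_ge0.
rewrite exprMn (_ : (x / 2) ^+ 2 = x ^+ 2 / 4); last by field.
lra.
Qed.

(** Inversion is not continuous at 0, so 1 / f is rewritten as f times the real power -1 of f ^ 2:
    the base is nonnegative, and at a zero of f both sides are 0. *)
Lemma measurable_funV d (T : measurableType d) (R : realType) (f : T -> R) :
  measurable_fun setT f -> measurable_fun setT (fun x => (f x)^-1).
Proof.
move=> mf; rewrite (_ : (fun x => _) = (fun x => f x * (f x ^+ 2) `^ (-1))).
  apply: measurable_funM => //; apply: (measurableT_comp (@measurable_powR R (-1)) (measurable_funX 2 mf)).
apply/funext => x; rewrite powR_inv1 ?sqr_ge0//.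
by have [->|fx0] := eqVneq (f x) 0; [rewrite invr0 mul0r|field].
Qed.

Section real_integrable.
Context d (T : measurableType d) (R : realType) (mu : {measure set T -> \bar R}).
Variables (D : set T) (mD : measurable D).
Implicit Types f g : T -> R.

Lemma integrable_le f g : measurable_fun D f -> (forall x, D x -> `|f x| <= g x) ->
  mu.-integrable D (EFin \o g) -> mu.-integrable D (EFin \o f).
Proof.
move=> mf fg; apply: le_integrable => //; first exact/measurable_EFinP.
by move=> x Dx; rewrite /= lee_fin (le_trans (fg x Dx))// ler_norm.
Qed.

Lemma integrable_Zl k f : mu.-integrable D (EFin \o f) ->
  mu.-integrable D (EFin \o (fun x => k * f x)).
Proof. by move=> /(integrableZl mD k); apply: eq_integrable. Qed.

Lemma integrable_sub f g : mu.-integrable D (EFin \o f) ->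
  mu.-integrable D (EFin \o g) -> mu.-integrable D (EFin \o (fun x => f x - g x)).
Proof. by move=> fi /(integrableB mD fi); apply: eq_integrable. Qed.

End real_integrable.

Lemma Rintegral_subset_ge0 d (T : measurableType d) (R : realType)
    (mu : {measure set T -> \bar R}) (A : set T) (f : T -> R) :
  measurable A -> mu.-integrable setT (EFin \o f) -> (forall x, 0 <= f x) ->
  \int[mu]_(x in A) f x <= \int[mu]_x f x.
Proof.
move=> mA fi f0; have fA : mu.-integrable A (EFin \o f) by exact: integrableS fi.
rewrite fine_le ?integrable_fin_num//.
apply: ge0_subset_integral => //; first exact: measurable_int fi.
by move=> x _; rewrite lee_fin.
Qed.

Section fejer.
Context {R : realType}.
Notation leb := (@lebesgue_measure R).
Implicit Types T y : R.

(** The Fejer kernel without normalization (its total mass is pi): the cosine transform of the tent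
    1 - t / T on ]0, T]. The value T / 2 at 0 is the continuous extension. *)
Definition fejer T y : R :=
  if y == 0 then T / 2 else (1 - cos (T * y)) / (T * y ^+ 2).

Lemma fejer_ge0 T y : 0 < T -> 0 <= fejer T y.
Proof.
move=> T0; rewrite /fejer; case: ifPn => [_|y0]; first by rewrite divr_ge0// ltW.
by rewrite divr_ge0 ?onem_cos_ge0// mulr_ge0 ?sqr_ge0// ltW.
Qed.

Lemma measurable_fejer T : measurable_fun setT (fejer T).
Proof.
apply: measurable_fun_if => //.
  exact: measurable_fun_eqr.
apply: measurable_funTS; apply: measurable_funM.
  apply: measurable_funB => //.
  by apply: continuous_measurable_fun; continuous_tac.
by apply: measurable_funV; apply: continuous_measurable_fun; continuous_tac.
Qed.

Lemma fejer_le T y : 0 < T -> fejer T y <= T / 2.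
Proof.
move=> T0; rewrite /fejer; case: ifPn => // y0.
rewrite ler_pdivrMr; last by rewrite mulr_gt0// exprn_even_gt0.
by have := onem_cos_le (T * y); rewrite exprMn; lra.
Qed.

Lemma fejer_le_tail T y : 0 < T -> y != 0 -> fejer T y <= 2 / T * (y ^+ 2)^-1.
Proof.
move=> T0 y0; rewrite /fejer (negbTE y0) -mulrA -invfM ler_wpM2r//.
  by rewrite invr_ge0 mulr_ge0 ?sqr_ge0// ltW.
by have := cos_geN1 (T * y); lra.
Qed.

Lemma fejer_center T y : 0 < T -> `|y| <= T^-1 -> T / 4 <= fejer T y.
Proof.
move=> T0 yT; rewrite /fejer; case: ifPn => y0.
  by rewrite ler_wpM2l ?(ltW T0)// lef_pV2 ?posrE// ler_nat.
rewrite ler_pdivlMr; last by rewrite mulr_gt0// exprn_even_gt0.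
have : `|T * y| <= 1.
  by rewrite normrM (gtr0_norm T0) -ler_pdivlMl// mulr1.
by move=> /onem_cos_ge; rewrite exprMn; lra.
Qed.

Lemma continuous_fejer_integrand T y :
  continuous (fun t : R => (1 - t / T) * cos (t * y)).
Proof. by continuous_tac. Qed.

Lemma fejerE T y : 0 < T ->
  fejer T y = \int[leb]_(t in `]0, T]) ((1 - t / T) * cos (t * y)).
Proof.
move=> T0; have Tn0 : T != 0 by rewrite gt_eqF.
have cf := @continuous_fejer_integrand T y.
rewrite /fejer; case: ifPn => [/eqP y0|y0].
  have dF (x : R) : is_derive x 1 (fun t : R => t - t ^+ 2 / 2 / T) ((1 - x / T) * cos (x * y)).
    by derive_tac; rewrite y0 !mulr0 cos0; field.
  by rewrite (Rintegral_FTC2 (ltW T0) cf dF); field.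
have dF (x : R) : is_derive x 1
    (fun t : R => (1 - t / T) * sin (t * y) / y - cos (t * y) / (T * y ^+ 2))
    ((1 - x / T) * cos (x * y)).
  by derive_tac; field; rewrite Tn0 y0.
rewrite (Rintegral_FTC2 (ltW T0) cf dF) !mul0r sin0 cos0 divff// subrr.
by field; rewrite Tn0 y0.
Qed.

Lemma integrable_invsqr (a : R) : 0 < a ->
  (\int[leb]_(x in `[a, +oo[) ((x ^+ 2)^-1)%:E = (a^-1)%:E)%E.
Proof.
move=> a0.
have pos x : a <= x -> x != 0 by move=> ax; rewrite gt_eqF// (lt_le_trans a0).
have dF (x : R) : a <= x -> is_derive x 1 (fun y : R => - y^-1) (x ^+ 2)^-1.
  move=> /pos x0; apply: (is_derive_eq (pder_opp (pder_inv x0 (pder_id x)))).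
  by rewrite mulr1 opprK.
have dG (x : R) : x != 0 ->
    is_derive x 1 (fun y : R => (y ^+ 2)^-1) (- (x ^+ 2) ^- 2 * (2%:R * x ^+ 1 * 1)).
  by move=> x0; apply: pder_inv; [rewrite expf_neq0|exact: pder_expn (pder_id x)].
rewrite (@ge0_continuous_FTC2y _ _ (fun y => - y^-1) _ 0) ?add0e -?EFinN ?opprK//.
- by move=> x _; rewrite invr_ge0 sqr_ge0.
- apply/continuous_within_itvcyP; split.
  + move=> x; rewrite in_itv/= andbT => ax.
    exact: (is_derive_continuous_at (dG x (pos _ (ltW ax)))).
  + apply: cvg_at_right_filter.
    exact: (is_derive_continuous_at (dG a (pos _ (lexx a)))).
- rewrite -oppr0; apply: cvgN; apply/(@gtr0_cvgV0 _ _ _ _ id); last exact: cvg_id.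
  exact: nbhs_pinfty_gt.
- by move=> x ax; case: (dF x (ltW ax)).
- apply: cvg_at_right_filter.
  exact: (is_derive_continuous_at (dF a (lexx a))).
- move=> x; rewrite in_itv/= andbT => ax.
  by rewrite derive1E; case: (dF x (ltW ax)).
Qed.

Lemma measurable_norm_gt (a : R) : measurable [set x : R | a < `|x|].
Proof.
rewrite (_ : [set _ | _] = `]-oo, - a[ `|` `]a, +oo[); first exact: measurableU.
apply/seteqP; split => x /=; rewrite !in_itv/= andbT lter_normr ltrNr.
  by case/orP; [right|left].
by case=> ->; rewrite ?orbT.
Qed.

Lemma measurable_invsqr (D : set R) : measurable_fun D (fun x : R => (x ^+ 2)^-1).
Proof. by apply: measurable_funTS; apply: measurable_funV; exact: measurable_funX. Qed.

(** Away from 0 the kernel is at most 2 / (T y ^ 2), whose integral over one half line beyond a is 2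
    / (T a); evenness doubles it. *)
Lemma fejer_tail_ge0 T (a : R) : 0 < T -> 0 < a ->
  (\int[leb]_(x in [set x | (a < `|x|)%R]) (fejer T x)%:E <= (4 / T / a)%:E)%E.
Proof.
move=> T0 a0; have mset := measurable_norm_gt a.
rewrite integral_mkcond; set f := _ \_ _.
have fE x : f x = if a < `|x| then (fejer T x)%:E else 0%E.
  by rewrite /f patchE; case: ifPn => [/set_mem ->//|/negP]; rewrite inE/= => /negP/negbTE ->.
have f0 x : (0 <= f x)%E by rewrite fE; case: ifPn => // _; rewrite lee_fin fejer_ge0.
have mf : measurable_fun setT f.
  apply/(measurable_restrictT _ mset).
  apply/measurable_EFinP.
  by apply: measurable_funTS; exact: measurable_fejer.
have half : (\int[leb]_(x in `[0%R, +oo[) f x <= (2 / T / a)%:E)%E.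
  have -> : `[0%R, +oo[%classic = `[0%R, a[ `|` `[a, +oo[.
    by rewrite -itv_bndbnd_setU// bnd_simp// ltW.
  rewrite ge0_integral_setU//; last 2 first.
    exact: measurable_funTS.
    apply/disj_setPS => x [/=]; rewrite !in_itv/= => /andP[_ xa] /andP[ax _].
    by move: xa; rewrite ltNge ax.
  rewrite integral0_eq ?add0e; last first.
    move=> x /=; rewrite in_itv/= => /andP[x0 xa].
    by rewrite fE ger0_norm// ltNge (ltW xa).
  rewrite [leRHS]EFinM -(integrable_invsqr a0) -ge0_integralZl//; last 3 first.
    by apply/measurable_EFinP; exact: measurable_invsqr.
    by move=> x _; rewrite lee_fin invr_ge0 sqr_ge0.
    by rewrite lee_fin divr_ge0// ltW.
  apply: ge0_le_integral => //.
    exact: measurable_funTS.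
    by apply/measurable_EFinP/measurable_funM => //; exact: measurable_invsqr.
  move=> x /=; rewrite in_itv/= andbT => ax.
  have x0 : 0 < x by rewrite (lt_le_trans a0).
  rewrite fE -EFinM; case: ifPn => _; rewrite lee_fin; first by rewrite fejer_le_tail// gt_eqF.
  by rewrite mulr_ge0 ?divr_ge0 ?invr_ge0 ?sqr_ge0 ?(ltW T0).
have feven x : f (- x) = f x.
  by rewrite !fE normrN /fejer oppr_eq0 mulrN cosN sqrrN.
have -> : [set: R] = `]-oo, 0%R] `|` `]0%R, +oo[ by rewrite -itv_bndbnd_setU// set_itvNyy.
rewrite ge0_integral_setU//; last 2 first.
  exact: measurable_funTS.
  apply/disj_setPS => x [/=]; rewrite !in_itv/= => xa /andP[ax _].
  by move: xa; rewrite leNgt ax.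
rewrite integral_itv_obnd_cbnd; last exact: measurable_funTS.
have -> : (4 / T / a)%:E = ((2 / T / a)%:E + (2 / T / a)%:E)%E.
  by rewrite -EFinD; congr EFin; field; rewrite !gt_eqF.
apply: leeD => //.
rewrite (le_trans _ half)// ge0_integration_by_substitution0//.
by under [leRHS]eq_integral do rewrite feven.
Qed.

Lemma integrable_fejer T : 0 < T -> leb.-integrable setT (EFin \o fejer T).
Proof.
move=> T0; have mf := @measurable_fejer T.
apply/integrableP; split; first exact/measurable_EFinP.
have -> : [set: R] = [set x | 1 < `|x|] `|` `[-1, 1].
  apply/esym/seteqP; split => // x _ /=; rewrite in_itv/= -ler_norml.
  by case: (ltP 1 `|x|); [left|right].
under eq_integral do rewrite /= ger0_norm ?fejer_ge0//.
have mg : measurable_fun setT (EFin \o fejer T) by exact/measurable_EFinP.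
rewrite ge0_integral_setU//=; last 4 first.
- exact: measurable_norm_gt.
- exact: measurable_funTS.
- by move=> x _; rewrite lee_fin fejer_ge0.
- by apply/disj_setPS => x [/= x1]; rewrite in_itv/= -ler_norml leNgt x1.
apply: lte_add_pinfty; first exact: le_lt_trans (fejer_tail_ge0 T0 ltr01) (ltry _).
apply: (@le_lt_trans _ _ (\int[leb]_(x in `[(-1)%R, 1%R]) (T / 2)%:E)%E).
  apply: ge0_le_integral => //.
  - by move=> x _; rewrite lee_fin fejer_ge0.
  - exact: measurable_funTS.
  - by move=> x _; rewrite lee_fin fejer_le.
rewrite integral_cst//= lebesgue_measure_itv/= lte_fin.
by case: ifPn => _; rewrite ?mule0 ?ltry// -EFinB -EFinM ltry.
Qed.

Lemma fejer_tail T (a : R) : 0 < T -> 0 < a ->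
  \int[leb]_(x in [set x | a < `|x|]) fejer T x <= 4 / T / a.
Proof.
move=> T0 a0; rewrite -lee_fin fineK; first exact: fejer_tail_ge0.
apply: integrable_fin_num; first exact: measurable_norm_gt.
by apply: integrableS (integrable_fejer T0) => //; exact: measurable_norm_gt.
Qed.

(** The central window |y| <= 1 / T has length 2 / T and the kernel is at least T / 4 there, which
    already accounts for one half. *)
Lemma fejer_mass T : 0 < T -> 2^-1 <= \int[leb]_x fejer T x.
Proof.
move=> T0; have TV : - T^-1 < T^-1 by rewrite gtrN ?invr_gt0.
have -> : 2^-1 = \int[leb]_(x in `[- T^-1, T^-1]) (T / 4).
  rewrite Rintegral_cst//= lebesgue_measure_itv/= lte_fin TV/=.
  by field; rewrite gt_eqF.
apply: (@le_trans _ _ (\int[leb]_(x in `[- T^-1, T^-1]) fejer T x)).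
  apply: le_Rintegral => //.
  - exact/continuous_integrable_itv/cst_continuous.
  - exact: integrableS (integrable_fejer T0).
  - by move=> x /=; rewrite in_itv/= -ler_norml; exact: fejer_center.
by apply: Rintegral_subset_ge0 => //; [exact: integrable_fejer|move=> x; exact: fejer_ge0].
Qed.

End fejer.

(** * Smoothing inequality *)

Section smoothing.
Context {R : realType}.
Notation leb := (@lebesgue_measure R).
Variables (T M : R) (D : R -> R).
Hypotheses (T0 : 0 < T) (mD : measurable_fun setT D) (DM : forall x, `|D x| <= M).

Lemma integrable_fejerM (g : R -> R) : measurable_fun setT g ->
  (forall x, `|g x| <= M) -> leb.-integrable setT (EFin \o (fun v => fejer T v * g v)).
Proof.
move=> mg gM; refine (@integrable_le _ _ _ leb _ measurableT _ (fun v => M * fejer T v) _ _ _).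
- by apply: measurable_funM => //; exact: measurable_fejer.
- move=> v _ /=; rewrite !normrM mulrC (ger0_norm (fejer_ge0 v T0)).
  by rewrite ler_wpM2r ?fejer_ge0.
- exact/integrable_Zl/integrable_fejer.
Qed.

Let mDshift (x : R) : measurable_fun setT (fun v : R => D (x - v)).
Proof. by apply: (measurableT_comp mD); exact: measurable_funB. Qed.

Let C (x : R) := \int[leb]_v (fejer T v * D (x - v)).

Let iC (x : R) : leb.-integrable setT (EFin \o (fun v : R => fejer T v * D (x - v))).
Proof. exact: integrable_fejerM. Qed.

Lemma fejer_conv_cvgNy : D x @[x --> -oo] --> 0 ->
  C (- n%:R) @[n --> \oo] --> 0.
Proof.
move=> D0; rewrite -(_ : \int[leb]_(v in setT) (cst 0 v) = 0); last first.
  by rewrite /Rintegral integral0.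
apply: fine_cvg; rewrite fineK ?integral0//.
have -> : (0%E : \bar R) = (\int[leb]_v (cst 0%E v))%E by rewrite integral0.
apply: (@dominated_cvg _ _ _ leb _ measurableT
  (fun n v => (fejer T v * D (- n%:R - v))%:E) _
  (EFin \o (fun v => M * fejer T v))) => //=.
- by move=> n; apply: (measurable_int leb); exact: iC.
- move=> v _; apply: cvg_EFin; first exact: nearW.
  rewrite -(mulr0 (fejer T v)); apply: cvgM; first exact: cvg_cst.
  apply: (cvg_comp _ _ _ D0).
  apply/cvgrNyPle => A; near=> n.
  rewrite lerBlDr lerNl opprD; near: n.
  exact: nbhs_infty_ger.
- exact/integrable_Zl/integrable_fejer.
- move=> n v _; rewrite lee_fin !normrM mulrC (ger0_norm (fejer_ge0 v T0)).
  by rewrite ler_wpM2r ?fejer_ge0.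
Unshelve. all: by end_near. Qed.

(** Letting y run to -oo along the negative integers, where [C] tends to 0 by dominated convergence,
    turns a bound on increments of [C] into a bound on [C]. It is for increments that a Fourier
    representation is available. *)
Lemma fejer_conv_le w : D x @[x --> -oo] --> 0 ->
  (forall x y : R, y <= x -> `|C x - C y| <= w) -> forall x, `|C x| <= w.
Proof.
move=> /fejer_conv_cvgNy C0 Cw x; apply/ler_addgt0Pr => e e0.
move/cvgrPdist_le : C0 => /(_ _ e0) C0.
near \oo => n.
have -> : C x = (C x - C (- n%:R)) + C (- n%:R) by rewrite subrK.
rewrite (le_trans (ler_normD _ _))// lerD//.
  apply: Cw; rewrite lerNl; near: n; exact: nbhs_infty_ger.
by near: n; apply: filterS C0 => n; rewrite sub0r normrN.
Unshelve. all: by end_near. Qed.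

(* If [D] is larger than [h] in absolute value and of constant sign on a window
   of radius [a], the mass of the kernel in the window dominates its tail. *)
Lemma fejer_conv_window (s x h m a : R) : `|s| = 1 -> 0 < a -> 0 <= h ->
  (forall y, `|D y| <= m) -> (forall v, `|v| <= a -> h <= s * D (x - v)) ->
  h * 2^-1 - (h + m) * (4 / T / a) <= s * C x.
Proof.
move=> s1 a0 h0 Dm Dh.
have m0 : 0 <= m by rewrite (le_trans _ (Dm 0)).
pose K1 v := h * fejer T v.
pose K2 v := (h + m) * (fejer T \_ [set v | a < `|v|]) v.
have mtail := @measurable_norm_gt R a.
have iK1 : leb.-integrable setT (EFin \o K1).
  exact/integrable_Zl/integrable_fejer.
have iT : leb.-integrable setT (EFin \o (fejer T \_ [set v | a < `|v|])).
  rewrite -restrict_EFin; apply/integrable_restrict => //.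
  by rewrite setTI; apply: integrableS (integrable_fejer T0).
have iK2 : leb.-integrable setT (EFin \o K2).
  exact: integrable_Zl.
apply: (@le_trans _ _ (\int[leb]_v (K1 v - K2 v))).
  rewrite RintegralB//= /K1 /K2 !RintegralZl//; last exact: integrable_fejer.
  rewrite -Rintegral_mkcond lerB//.
    by rewrite ler_wpM2l// fejer_mass.
  by rewrite ler_wpM2l ?addr_ge0// fejer_tail.
rewrite -RintegralZl//; apply: le_Rintegral => //.
- exact: integrable_sub.
- exact/integrable_Zl/iC.
move=> v _; rewrite /K1 /K2 patchE mulrCA.
have K0 := fejer_ge0 v T0.
case: ifPn => [_|/negP].
  have : - m <= s * D (x - v).
    by rewrite lerNl -mulNr (le_trans (ler_norm _))// normrM normrN s1 mul1r Dm.
  move=> ?; rewrite (_ : _ * _ - _ * _ = fejer T v * - m); last by ring.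
  by rewrite ler_wpM2l.
rewrite inE/= => /negP; rewrite -leNgt -[point]/(0 : R) mulr0 subr0 => /Dh ?.
by rewrite mulrC ler_wpM2l.
Qed.

(** [D] may jump upwards but can fall only at rate L. Near a point where |D| almost reaches its
    supremum m, it therefore stays above m / 2 with constant sign on a window of width proportional
    to m / L. If m exceeded the claimed bound, the kernel mass in that window would push |C| above
    w. *)
Lemma esseen_smoothing (L w : R) : 0 < L -> D x @[x --> -oo] --> 0 ->
  (forall x y : R, x <= y -> D x - L * (y - x) <= D y) ->
  (forall x y : R, y <= x -> `|C x - C y| <= w) ->
  forall x, `|D x| <= 8 * w + 400 * (L / T).
Proof.
move=> L0 D0 DL Cw x0; rewrite leNgt; apply/negP => hx0.
have {Cw}Cw := fejer_conv_le D0 Cw.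
have w0 : 0 <= w by rewrite (le_trans _ (Cw 0)).
pose E := [set `|D x| | x in setT].
have hE : has_sup E.
  split; first by exists (`|D 0|); exists 0.
  by exists M => _ [y _ <-]; exact: DM.
pose m := sup E.
have Dm y : `|D y| <= m by apply: ub_le_sup; [case: hE|exists y].
have LT0 : 0 < L / T by rewrite divr_gt0.
have m_gt : 8 * w + 400 * (L / T) < m by exact: lt_le_trans (Dm x0).
have m0 : 0 < m by lra.
(* The supremum need not be attained; a point where |D| exceeds 3 m / 4 is enough. *)
have [_ [x1 _ <-] hx1] := sup_adherent (divr_gt0 m0 (ltr0n R 4)) hE.
rewrite -/m in hx1.
(* Across a window of length 2 a the function loses at most 2 L a = m / 4, which leaves m / 2. The
   window lies to the right of [x1] when [D x1] is positive and to the left otherwise, hence the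
   centre x1 + s a. *)
pose a := m / (8 * L).
have a0 : 0 < a by rewrite divr_gt0// mulr_gt0.
pose s := Num.sg (D x1).
have D1 : D x1 != 0 by rewrite -normr_gt0; lra.
have s1 : `|s| = 1 by rewrite normr_sg D1.
have La : L * a = m / 8 by rewrite /a; field; rewrite gt_eqF.
have := @fejer_conv_window s (x1 + s * a) (m / 2) m a s1 a0 (divr_ge0 (ltW m0) (ler0n _ 2)) Dm.
have sD v : `|v| <= a -> m / 2 <= s * D (x1 + s * a - v).
  rewrite ler_norml => /andP[va1 va2]; rewrite /s.
  have [Dgt0|Dlt0|/eqP] := ltrgtP (D x1) 0; last by rewrite (negbTE D1).
  - rewrite ltr0_sg// !mulN1r; rewrite ltr0_norm// in hx1.
    have := DL (x1 - a - v) x1; rewrite (_ : x1 - (x1 - a - v) = a + v); last by ring.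
    have : L * (a + v) <= L * (a + a) by rewrite ler_wpM2l ?lerD2l// ltW.
    rewrite mulrDr La => ? /(_ _); lra.
  - rewrite gtr0_sg// !mul1r; rewrite gtr0_norm// in hx1.
    have := DL x1 (x1 + a - v); rewrite (_ : x1 + a - v - x1 = a - v); last by ring.
    have : L * (a - v) <= L * (a + a) by rewrite ler_wpM2l ?lerD2l ?(ltW L0)//; lra.
    rewrite mulrDr La => ? /(_ _); lra.
move=> /(_ sD); apply/negP; rewrite -ltNge.
have sC : s * C (x1 + s * a) <= w.
  by rewrite (le_trans (ler_norm _))// normrM s1 mul1r Cw.
apply: (le_lt_trans sC).
(* Here m > 400 L / T enters. The window estimate becomes m / 4 - (3 m / 2) (8 / 100) = 0.13 m,
   which exceeds m / 8 and hence w, contradicting |C| <= w. *)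
have ta : 4 / T / a <= 8 / 100.
  rewrite (_ : 4 / T / a = 32 * (L / T) / m); last by rewrite /a; field; rewrite !gt_eqF.
  by rewrite ler_pdivrMr//; lra.
have : (m / 2 + m) * (4 / T / a) <= (m / 2 + m) * (8 / 100).
  by rewrite ler_wpM2l// addr_ge0 ?divr_ge0// ltW.
lra.
Qed.
End smoothing.

(** * Fejer averages of distribution functions *)

Section real_fubini.
Context d1 d2 (T1 : measurableType d1) (T2 : measurableType d2) (R : realType).
Variables (m1 : {sigma_finite_measure set T1 -> \bar R})
  (m2 : {sigma_finite_measure set T2 -> \bar R}).
Variables (a : T1 -> R) (b : T2 -> R) (c : T1 * T2 -> R) (M : R).
Hypotheses (ia : m1.-integrable setT (EFin \o a)) (ib : m2.-integrable setT (EFin \o b))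
  (mc : measurable_fun setT c) (cM : forall z, `|c z| <= M).

Let ma : measurable_fun setT a.
Proof. by apply/measurable_EFinP; exact: measurable_int ia. Qed.

Let mb : measurable_fun setT b.
Proof. by apply/measurable_EFinP; exact: measurable_int ib. Qed.

Let f z := a z.1 * b z.2 * c z.

Let mf : measurable_fun setT f.
Proof.
by apply: measurable_funM => //; apply: measurable_funM;
  [exact: (measurableT_comp ma)|exact: (measurableT_comp mb)].
Qed.

Let ibc x : m2.-integrable setT (EFin \o (fun y => b y * c (x, y))).
Proof.
refine (@integrable_le _ _ _ m2 _ measurableT _ (fun y => M * `|b y|) _ _ _).
- by apply: measurable_funM => //; apply: (measurableT_comp mc); exact: measurable_pair1.
- by move=> y _; rewrite normrM mulrC ler_wpM2r.
- exact/integrable_Zl/integrable_norm.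
Qed.

Let iac y : m1.-integrable setT (EFin \o (fun x => a x * c (x, y))).
Proof.
refine (@integrable_le _ _ _ m1 _ measurableT _ (fun x => M * `|a x|) _ _ _).
- by apply: measurable_funM => //; apply: (measurableT_comp mc); exact: measurable_pair2.
- by move=> x _; rewrite normrM mulrC ler_wpM2r.
- exact/integrable_Zl/integrable_norm.
Qed.

Let iMb : m2.-integrable setT (EFin \o (fun y => M * `|b y|)).
Proof. exact/integrable_Zl/integrable_norm. Qed.

Let if12 : (m1 \x m2)%E.-integrable setT (EFin \o f).
Proof.
apply/integrable12ltyP; first exact/measurable_EFinP.
have M0 : 0 <= M by rewrite (le_trans _ (cM point)).
apply: (@le_lt_trans _ _ (\int[m1]_x (`|a x| * (\int[m2]_y (M * `|b y|)))%:E)%E).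
  apply: ge0_le_integral => //.
  - by move=> x _; apply: integral_ge0.
  - apply: (@measurable_fun_fubini_tonelli_F _ _ _ _ _ m2 (fun z => `|(f z)%:E|%E)) => //.
    by apply: measurableT_comp => //; exact/measurable_EFinP.
  - by apply/measurable_EFinP; apply: measurable_funM => //; exact: measurableT_comp.
  - move=> x _; rewrite EFinM fineK; last exact: integrable_fin_num.
    rewrite -integralZl//; apply: ge0_le_integral => //.
    + apply/measurable_EFinP; apply: measurableT_comp => //.
      by have := measurableT_comp mf (measurable_pair1 x).
    + under eq_fun do rewrite -EFinM.
      by apply/measurable_EFinP; do 2 apply: measurable_funM => //; exact: measurableT_comp.
    + move=> y _; rewrite /f/= -EFinM lee_fin !normrM -mulrA ler_wpM2l// mulrC.
      by rewrite ler_wpM2r.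
apply: integrable_lty => //.
rewrite (_ : (fun x => _) = EFin \o (fun x => \int[m2]_y (M * `|b y|) * `|a x|)).
  exact/integrable_Zl/integrable_norm.
by apply/funext => x; rewrite /= mulrC.
Qed.

(** Every exchange of integrals below has this shape: two integrable factors in separate variables
    and a bounded coupling [c]. The product is dominated by M |a| |b|, hence integrable on the
    product space. *)
Lemma Rfubini : \int[m1]_x (a x * \int[m2]_y (b y * c (x, y))) =
  \int[m2]_y (b y * \int[m1]_x (a x * c (x, y))).
Proof.
rewrite /Rintegral; congr fine.
transitivity (\int[m1]_x \int[m2]_y (EFin \o f) (x, y))%E.
  apply: eq_integral => x _; rewrite EFinM fineK; last by apply: integrable_fin_num => //; exact: ibc.
  rewrite -integralZl//; last exact: ibc.
  by apply: eq_integral => y _; rewrite -EFinM /f/= mulrA.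
rewrite Fubini//; apply: eq_integral => y _.
rewrite EFinM fineK; last by apply: integrable_fin_num => //; exact: iac.
rewrite -integralZl//; last exact: iac.
by apply: eq_integral => x _; rewrite -EFinM /f/=; congr EFin; ring.
Qed.

End real_fubini.

Lemma integrable_restrict_EFin d (T : measurableType d) (R : realType)
    (mu : {measure set T -> \bar R}) (E : set T) (f : T -> R) : measurable E ->
  mu.-integrable E (EFin \o f) -> mu.-integrable setT (EFin \o (f \_ E)).
Proof.
by move=> mE fE; rewrite -restrict_EFin; apply/integrable_restrict => //; rewrite setTI.
Qed.

Lemma restrictM (T : Type) (R : realType) (E : set T) (f g : T -> R) x :
  (f \_ E) x * g x = ((fun x => f x * g x) \_ E) x.
(* Outside its set a restriction takes the default value [point], which is 0 in R. *)
Proof. by rewrite !patchE; case: ifP => // _; rewrite -[point]/(0 : R) mul0r. Qed.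

Lemma measurable_fun_natbool d (T : measurableType d) (R : realType) (b : T -> bool) :
  measurable_fun setT b -> measurable_fun setT (fun x => (b x)%:R : R).
Proof.
move=> mb; rewrite (_ : (fun _ => _) = (fun x => if b x then 1 else 0)).
  exact: measurable_fun_ifT.
by apply/funext => x; case: (b x).
Qed.

Section fejer_convolution.
Context d (X : measurableType d) (R : realType).
Notation leb := (@lebesgue_measure R).
Variables (mu : {sigma_finite_measure set X -> \bar R}) (psi S : X -> R) (T : R).
Hypotheses (ipsi : mu.-integrable setT (EFin \o psi)) (mS : measurable_fun setT S)
  (T0 : 0 < T).

Let tent t : R := 1 - t / T.

Let itent : leb.-integrable setT (EFin \o (tent \_ `]0, T])).
Proof. by apply: integrable_restrict_EFin => //; apply: continuous_integrable_itv; continuous_tac. Qed.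

Let tentE (g : R -> R) : \int[leb]_(t in `]0, T]) (tent t * g t) =
  \int[leb]_t ((tent \_ `]0, T]) t * g t).
Proof. by rewrite Rintegral_mkcond; apply: eq_Rintegral => t _; rewrite restrictM. Qed.

(** Insert the cosine representation of the kernel and integrate over v first: the integral of cos
    (t v) over ]a, b] is (sin (t b) - sin (t a)) / t. *)
Lemma fejer_itv (a b : R) : a <= b ->
  \int[leb]_(v in `]a, b]) fejer T v =
  \int[leb]_(t in `]0, T]) (tent t * ((sin (t * b) - sin (t * a)) / t)).
Proof.
move=> ab; rewrite tentE Rintegral_mkcond.
transitivity (\int[leb]_v ((cst (1 : R) \_ `]a, b]) v * \int[leb]_t ((tent \_ `]0, T]) t * cos (t * v)))).
  apply: eq_Rintegral => v _; rewrite -tentE -fejerE//.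
  by rewrite restrictM; rewrite !patchE; case: ifP => // _; rewrite mul1r.
transitivity (\int[leb]_t ((tent \_ `]0, T]) t * \int[leb]_v ((cst (1 : R) \_ `]a, b]) v * cos (t * v)))).
  apply: (@Rfubini _ _ _ _ _ leb leb _ _ (fun z : R * R => cos (z.2 * z.1)) 1) => //.
  - by apply: integrable_restrict_EFin => //; apply: continuous_integrable_itv; continuous_tac.
  - apply: measurableT_comp; first by apply: continuous_measurable_fun; exact: continuous_cos.
    exact: measurable_funM.
  - by move=> z; exact: cos_max.
rewrite -!tentE [RHS]Rintegral_mkcond [LHS]Rintegral_mkcond.
apply: eq_Rintegral => t _; rewrite !patchE; case: ifPn => // /set_mem /=.
rewrite in_itv/= => /andP[t0 _]; congr (_ * _).
have dF (x : R) : is_derive x 1 (fun v : R => sin (t * v) / t) (cos (t * x)).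
  by derive_tac; field; rewrite gt_eqF.
have cF : continuous (fun v : R => cos (t * v)) by continuous_tac.
rewrite mulrBl -(Rintegral_FTC2 ab cF dF) Rintegral_mkcond.
by apply: eq_Rintegral => v _; rewrite !patchE; case: ifP => _; rewrite ?mul1r // -[point]/(0 : R) mul0r.
Qed.

Hypothesis psi0 : forall w, 0 <= psi w.

Let F x := \int[mu]_(w in [set w | S w <= x]) psi w.

Let mset (x : R) : measurable [set w | S w <= x].
Proof.
rewrite (_ : mkset _ = S @^-1` `]-oo, x]).
  by rewrite -[X in measurable X]setTI; exact: mS.
by apply/seteqP; split => w; rewrite /= in_itv.
Qed.

Lemma dcdf_homo : {homo F : x y / x <= y}.
Proof.
move=> x y xy; rewrite /F; apply: fine_le.
- by apply: integrable_fin_num => //; exact: integrableS ipsi.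
- by apply: integrable_fin_num => //; exact: integrableS ipsi.
- apply: ge0_subset_integral => //.
  + by apply: measurable_funTS; exact: measurable_int ipsi.
  + by move=> w _; rewrite lee_fin.
  + by move=> w /= /le_trans; exact.
Qed.

Lemma dcdf_ge0 x : 0 <= F x.
Proof. by apply: Rintegral_ge0 => w _. Qed.

Lemma dcdf_le x : F x <= \int[mu]_w psi w.
Proof. exact: Rintegral_subset_ge0. Qed.

Lemma measurable_dcdf : measurable_fun setT F.
Proof. by apply: nondecreasing_measurable => // x y; exact: dcdf_homo. Qed.

Lemma dcdf_cvgNy : F x @[x --> -oo] --> 0.
Proof.
have Fn : F (- n%:R) @[n --> \oo] --> 0.
  apply: fine_cvg => /=.
  rewrite (_ : 0%:E = (\int[mu]_w (cst 0%E w))%E); last by rewrite integral0.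
  under eq_fun do rewrite integral_mkcond.
  apply: (@dominated_cvg _ _ _ mu _ measurableT
    (fun n => (EFin \o psi) \_ [set w | S w <= - n%:R]) _ (EFin \o psi)) => //=.
  - move=> n; apply/(measurable_restrictT _ (mset _)); apply: measurable_funTS.
    exact: measurable_int ipsi.
  - move=> w _; apply: cvg_near_cst; near=> n; apply/patchN.
    rewrite notin_setE/=; apply/negP; rewrite -ltNge ltrNl.
    near: n; exact: nbhs_infty_gtr.
  - by move=> n w _; rewrite patchE; case: ifP; rewrite ?abse0 ?lee_fin//= ger0_norm.
apply/cvgrPdist_le => e e0; move/cvgrPdist_le : Fn => /(_ _ e0)[n _ /(_ n (leqnn n)) /=].
rewrite sub0r normrN ger0_norm ?dcdf_ge0// => Fn.
near=> x; rewrite sub0r normrN ger0_norm ?dcdf_ge0// (le_trans _ Fn)// dcdf_homo//.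
Unshelve. all: by end_near. Qed.

Let ipsiM (g : X -> R) : measurable_fun setT g -> (forall w, `|g w| <= 1) ->
  mu.-integrable setT (EFin \o (fun w => psi w * g w)).
Proof.
move=> mg g1; apply: (integrable_le measurableT _ _ ipsi).
  by apply: measurable_funM => //; apply/measurable_EFinP; exact: measurable_int ipsi.
by move=> w _; rewrite normrM (ger0_norm (psi0 w)) ler_piMr.
Qed.

(** F (x - v) - F (y - v) is the mean of the indicator that v lies in ]y - S, x - S]. Integrating
    the kernel over that interval for fixed w and exchanging the integrals again produces the sine
    transforms. Without the difference in x and y, the coupling sin (t (x - S)) / t would not be
    bounded uniformly in S. *)
Lemma fejer_conv_cdf (x y : R) : y <= x ->
  \int[leb]_v (fejer T v * F (x - v)) - \int[leb]_v (fejer T v * F (y - v)) =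
  \int[leb]_(t in `]0, T]) (tent t *
    ((\int[mu]_w (psi w * sin (t * (x - S w))) - \int[mu]_w (psi w * sin (t * (y - S w)))) / t)).
Proof.
move=> yx.
have mshift z : measurable_fun setT (fun v : R => F (z - v)).
  by apply: (measurableT_comp measurable_dcdf); exact: measurable_funB.
have Fle z : `|F z| <= \int[mu]_w psi w by rewrite ger0_norm ?dcdf_ge0// dcdf_le.
rewrite -RintegralB//; last 2 first.
- exact: integrable_fejerM.
- exact: integrable_fejerM.
pose c (z : R * X) : R := ((S z.2 <= x - z.1)%R)%:R - ((S z.2 <= y - z.1)%R)%:R.
have mle z : measurable_fun setT (fun p : R * X => ((S p.2 <= z - p.1)%R)%:R : R).
  apply: measurable_fun_natbool; apply: measurable_fun_ler.
    exact: (measurableT_comp mS).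
  exact: measurable_funB.
have mle1 z : measurable_fun setT (fun w => ((S w <= z)%R)%:R : R).
  by apply: measurable_fun_natbool; exact: measurable_fun_ler.
have FE z : F z = \int[mu]_w (psi w * ((S w <= z)%R)%:R).
  rewrite /F Rintegral_mkcond; apply: eq_Rintegral => w _; rewrite patchE.
  case: ifPn => [/set_mem/= ->|/negP]; first by rewrite mulr1.
  by rewrite inE/= => /negP/negbTE ->; rewrite mulr0.
transitivity (\int[leb]_v (fejer T v * \int[mu]_w (psi w * c (v, w)))).
  apply: eq_Rintegral => v _; rewrite -mulrBr; congr (_ * _).
  rewrite !FE -RintegralB//; [|apply: ipsiM..].
  - by apply: eq_Rintegral => w _; rewrite -mulrBr.
  - exact: mle1.
  - by move=> w; case: (S w <= _); rewrite ?normr1 ?normr0.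
  - exact: mle1.
  - by move=> w; case: (S w <= _); rewrite ?normr1 ?normr0.
transitivity (\int[mu]_w (psi w * \int[leb]_v (fejer T v * c (v, w)))).
  apply: (@Rfubini _ _ _ _ _ leb mu _ _ c 1) => //.
  - exact: integrable_fejer.
  - by apply: measurable_funB; exact: mle.
  - move=> [v w]; rewrite /c/=; case: (S w <= _); case: (S w <= _);
      by rewrite ?subrr ?subr0 ?sub0r ?normrN ?normr1 ?normr0.
pose c' (z : X * R) : R := (sin (z.2 * (x - S z.1)) - sin (z.2 * (y - S z.1))) / z.2.
transitivity (\int[mu]_w (psi w * \int[leb]_t ((tent \_ `]0, T]) t * c' (w, t)))).
  apply: eq_Rintegral => w _; congr (_ * _).
  rewrite -tentE; transitivity (\int[leb]_(v in `]y - S w, x - S w]) fejer T v); last first.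
    by rewrite fejer_itv ?lerB.
  rewrite [RHS]Rintegral_mkcond.
  apply: eq_Rintegral => v _; rewrite patchE mem_setE in_itv/= /c/=.
  rewrite (_ : (v <= x - S w) = (S w <= x - v)); last by rewrite lerBrDr addrC -lerBrDr.
  rewrite (_ : (y - S w < v) = ~~ (S w <= y - v)); last first.
    by rewrite -ltNge ltrBlDr ltrBlDr addrC.
  have := @le_trans _ _ (y - v) (S w) (x - v).
  case: (S w <= y - v) => [/(_ isT)->|_]; rewrite ?lerB//= ?subrr ?mulr0//.
  by case: (S w <= _); rewrite subr0 ?mulr1 ?mulr0.
transitivity (\int[leb]_t ((tent \_ `]0, T]) t * \int[mu]_w (psi w * c' (w, t)))).
  (* The sine is 1-Lipschitz, so the difference of sines is at most |t| |x - y|, and dividing by t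
     leaves a bound independent of t and w. *)
  apply: (@Rfubini _ _ _ _ _ mu leb _ _ c' `|x - y|) => //.
  - have msin z : measurable_fun setT (fun p : X * R => sin (p.2 * (z - S p.1))).
      apply: measurableT_comp; first by apply: continuous_measurable_fun; exact: continuous_sin.
      apply: measurable_funM => //; apply: measurable_funB => //.
      exact: (measurableT_comp mS).
    apply: measurable_funM; first by apply: measurable_funB; exact: msin.
    by apply: measurable_funV; exact: measurable_snd.
  - move=> [w t]; rewrite /c'/= normrM normfV.
    have [->|t0] := eqVneq t 0; first by rewrite normr0 invr0 mulr0.
    rewrite ler_pdivrMr ?normr_gt0// (le_trans (abs_sinB_le _ _))// -mulrBr normrM mulrC.
    by rewrite (_ : x - S w - (y - S w) = x - y)//; ring.
rewrite -tentE; apply: eq_Rintegral => t; rewrite inE/= in_itv/= => /andP[t0 _].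
congr (_ * _).
have ms z : mu.-integrable setT (EFin \o (fun w => psi w * sin (t * (z - S w)))).
  apply: ipsiM => [|w]; last exact: sin_max.
  apply: measurableT_comp; first by apply: continuous_measurable_fun; exact: continuous_sin.
  by apply: measurable_funM => //; exact: measurable_funB.
rewrite -RintegralB// -RintegralZr//; last exact: integrable_sub.
by apply: eq_Rintegral => w _; rewrite -mulrBr mulrA.
Qed.

End fejer_convolution.

(** The counterpart of [fejer_conv_cdf] for the correction term of the expansion: that term is
    itself an integrable function, so no increment and no division by t are required. *)
Lemma fejer_density (R : realType) (T : R) (b : R -> R) : 0 < T ->
  lebesgue_measure.-integrable setT (EFin \o b) ->
  \int[lebesgue_measure]_v (fejer T v * b v) =
  \int[lebesgue_measure]_(t in `]0, T]) ((1 - t / T) * \int[lebesgue_measure]_v (b v * cos (t * v))).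
Proof.
move=> T0 ib; pose leb := @lebesgue_measure R; pose tent t : R := 1 - t / T.
have tentE (g : R -> R) : \int[leb]_(t in `]0, T]) (tent t * g t) =
    \int[leb]_t ((tent \_ `]0, T]) t * g t).
  by rewrite Rintegral_mkcond; apply: eq_Rintegral => t _; rewrite restrictM.
transitivity (\int[leb]_v (b v * \int[leb]_t ((tent \_ `]0, T]) t * cos (t * v)))).
  by apply: eq_Rintegral => v _; rewrite mulrC -tentE -fejerE.
rewrite tentE.
apply: (@Rfubini _ _ _ _ _ leb leb _ _ (fun z : R * R => cos (z.2 * z.1)) 1) => //.
- by apply: integrable_restrict_EFin => //; apply: continuous_integrable_itv; continuous_tac.
- apply: measurableT_comp; first by apply: continuous_measurable_fun; exact: continuous_cos.
  exact: measurable_funM.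
- by move=> z; exact: cos_max.
Qed.

(** * Gaussian integrals and Hermite polynomials *)

Section gaussian_decay.
Context {R : realType}.
Notation leb := (@lebesgue_measure R).

(** |z| ^ k is at most 1 + z ^ (2 (k + 1)), and the last power is controlled by a single term of the
    exponential series of c z ^ 2. *)
Lemma expn_le_expR (c : R) k : 0 < c ->
  exists2 C, 0 < C & forall z : R, `|z| ^+ k <= C * expR (c * z ^+ 2).
Proof.
move=> c0; exists (1 + k.+1`!%:R / c ^+ k.+1) => [|z].
  by rewrite ltr_pwDl// divr_ge0// ltW// exprn_gt0.
have e1 : 1 <= expR (c * z ^+ 2).
  by rewrite -expR0 ler_expR mulr_ge0 ?sqr_ge0// ltW.
have h1 : `|z| ^+ k <= 1 + z ^+ 2 ^+ k.+1.
  have [z1|z1] := leP `|z| 1.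
    rewrite (@le_trans _ _ 1)//; first by rewrite exprn_ile1.
    by rewrite lerDl exprn_ge0// sqr_ge0.
  rewrite -exprM (@le_trans _ _ (`|z| ^+ (2 * k.+1)))//.
    by rewrite ler_weXn2l// ?ltW// (leq_trans (leqnSn k))// leq_pmull.
  by rewrite [leRHS]addrC exprM real_normK ?num_real// -exprM lerDl.
have h2 : z ^+ 2 ^+ k.+1 <= k.+1`!%:R / c ^+ k.+1 * expR (c * z ^+ 2).
  have h : 1 + c ^+ k.+1 * (z ^+ 2 ^+ k.+1 / k.+1`!%:R) <= expR (c * z ^+ 2).
    by rewrite mulrA -exprMn expR_ge1Dxn// mulr_ge0 ?sqr_ge0// ltW.
  have f0 : 0 < (k.+1`!%:R : R) by rewrite ltr0n fact_gt0.
  have ck : 0 < c ^+ k.+1 by rewrite exprn_gt0.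
  have -> : z ^+ 2 ^+ k.+1 = k.+1`!%:R / c ^+ k.+1 * (c ^+ k.+1 * (z ^+ 2 ^+ k.+1 / k.+1`!%:R)).
    by field; rewrite !gt_eqF.
  rewrite ler_wpM2l ?divr_ge0 ?(ltW f0) ?(ltW ck)// (le_trans _ h)//.
  by rewrite lerDr.
by rewrite mulrDl mul1r (le_trans h1)// lerD.
Qed.

Lemma horner_le_expR (p : {poly R}) (c : R) : 0 < c ->
  exists2 C, 0 < C & forall z : R, `|p.[z]| <= C * expR (c * z ^+ 2).
Proof.
move=> c0; have /choice[C hC] k : exists C, 0 < C /\ forall z : R, `|z| ^+ k <= C * expR (c * z ^+ 2).
  by have [C C0 h] := expn_le_expR k c0; exists C.
have C0 k : 0 < C k by case: (hC k).
exists (1 + \sum_(i < size p) `|p`_i| * C i) => [|z].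
  by rewrite ltr_pwDl// sumr_ge0// => i _; rewrite mulr_ge0// ltW.
rewrite horner_coef (le_trans (ler_norm_sum _ _ _))// mulrDl ler_wpDl ?mulr_ge0 ?expR_ge0//.
rewrite mulr_suml ler_sum// => i _; rewrite normrM normrX -mulrA ler_wpM2l//.
by case: (hC i).
Qed.

Lemma integrable_gauss (c x : R) : 0 < c ->
  leb.-integrable setT (EFin \o (fun v => expR (- c * (x - v) ^+ 2))).
Proof.
move=> c0; pose s := Num.sqrt (2 * c)^-1.
have s2 : s ^+ 2 = (2 * c)^-1 by rewrite sqr_sqrtr// invr_ge0 mulr_ge0// ltW.
have s0 : s != 0 by rewrite -sqrf_eq0 s2 invr_eq0 mulf_neq0// gt_eqF.
have pk0 := normal_peak_gt0 s0.
have := integrable_Zl measurableT (normal_peak s)^-1 (@integrable_normal_pdf R x s).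
apply: eq_integrable => // v _ /=; rewrite normal_pdfE//; congr EFin.
rewrite mulrA mulVf ?gt_eqF// mul1r /normal_fun s2; congr expR.
by field; rewrite gt_eqF.
Qed.

Lemma cvg_gauss (c x : R) (u : nat -> R) : 0 < c -> `|u n| @[n --> \oo] --> +oo ->
  expR (- c * (x - u n) ^+ 2) @[n --> \oo] --> 0.
Proof.
move=> c0 uy; have h : c * (x - u n) ^+ 2 @[n --> \oo] --> +oo.
  apply/cvgryPge => A.
  have := uy => /cvgryPge /(_ (`|x| + Num.max 1 (A / c))) hu; near=> n.
  have : `|x| + Num.max 1 (A / c) <= `|u n| by near: n.
  have := ler_distD x (u n) 0; rewrite !subr0 distrC => h1 h2.
  have h3 : Num.max 1 (A / c) <= `|x - u n| by lra.
  have h4 : 1 <= `|x - u n| by rewrite (le_trans _ h3)// le_max lexx.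
  have h5 : A / c <= `|x - u n| by rewrite (le_trans _ h3)// le_max lexx orbT.
  rewrite -ler_pdivrMl// mulrC (le_trans h5)//.
  rewrite -[(_ - _) ^+ 2]real_normK ?num_real// expr2 ler_peMr//.
under eq_fun do rewrite mulNr.
exact: (cvg_comp _ _ h (@cvgr_expR R)).
Unshelve. all: by end_near. Qed.

(** Over ]- n, n] the integral is F n - F (- n), which the Gaussian bound sends to 0, while
    dominated convergence sends the left side to the full integral. *)
Lemma integral_derivative0 (f F : R -> R) (C c x : R) : 0 < c ->
  continuous f -> leb.-integrable setT (EFin \o f) ->
  (forall v : R, is_derive v 1 F (f v)) ->
  (forall v, `|F v| <= C * expR (- c * (x - v) ^+ 2)) ->
  \int[leb]_v f v = 0.
Proof.
move=> c0 cf fi dF Fb.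
have F0 (u : nat -> R) : `|u n| @[n --> \oo] --> +oo -> F (u n) @[n --> \oo] --> 0.
  move=> uy; apply: norm_cvg0.
  apply: (@squeeze_cvgr _ _ _ _ (cst 0) (fun n => C * expR (- c * (x - u n) ^+ 2))).
  - by apply: nearW => n; rewrite normr_ge0 Fb.
  - exact: cvg_cst.
  - by rewrite -(mulr0 C); apply: cvgM; [exact: cvg_cst|exact: cvg_gauss].
have FB : F n%:R - F (- n%:R) @[n --> \oo] --> 0.
  rewrite -(subr0 0); apply: cvgB; apply: F0.
    by under eq_fun do rewrite ger0_norm//; exact: cvgr_idn.
  by under eq_fun do rewrite normrN ger0_norm//; exact: cvgr_idn.
have : \int[leb]_(v in `]- n%:R, n%:R]) f v @[n --> \oo] --> \int[leb]_v f v.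
  apply: fine_cvg; rewrite fineK; last by apply: integrable_fin_num.
  under eq_fun do rewrite integral_mkcond.
  apply: (@dominated_cvg _ _ _ leb _ measurableT
    (fun n => (EFin \o f) \_ `]- n%:R, n%:R]) _ (EFin \o (fun v => `|f v|))) => //=.
  - move=> n; apply/(measurable_restrictT _ (measurable_itv _)); apply: measurable_funTS.
    exact: measurable_int fi.
  - move=> v _; apply: cvg_near_cst; near=> n; apply/patchT.
    rewrite mem_setE in_itv/=; apply/andP; split.
      by rewrite ltrNl; near: n; exact: nbhs_infty_gtr.
    by near: n; exact: nbhs_infty_ger.
  - exact: integrable_norm.
  - by move=> n v _; rewrite patchE; case: ifP; rewrite ?abse0 ?lee_fin.
rewrite (_ : (fun n => _) = (fun n => F n%:R - F (- n%:R))).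
  by move=> h; exact: (cvg_unique _ h FB).
by apply/funext => n; apply: Rintegral_FTC2 => //; rewrite -subr_ge0 opprK addr_ge0.
Unshelve. all: by end_near. Qed.

End gaussian_decay.

Section gaussian.
Context {R : realType}.
Notation leb := (@lebesgue_measure R).
Variable V : R.
Hypothesis V0 : 0 < V.
Notation g := (gauss_pdf V).

Let sV0 : Num.sqrt V != 0. Proof. by rewrite gt_eqF// sqrtr_gt0. Qed.
Let pk := normal_peak (Num.sqrt V).

Lemma gauss_pdfE z : g z = pk * expR (- (2 * V)^-1 * z ^+ 2).
Proof.
rewrite /gauss_pdf normal_pdfE// /normal_fun sqr_sqrtr ?(ltW V0)// subr0.
by congr (_ * expR _); field; rewrite gt_eqF.
Qed.

Lemma gauss_pdf_gt0 z : 0 < g z.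
Proof. by rewrite gauss_pdfE mulr_gt0 ?expR_gt0// normal_peak_gt0. Qed.

Lemma is_derive_gauss_pdf (x : R) : is_derive x 1 g (- (x / V) * g x).
Proof.
rewrite (_ : gauss_pdf V = (fun z => pk * expR (- (2 * V)^-1 * z ^+ 2))).
  by derive_tac; field; rewrite gt_eqF.
by apply/funext => z; exact: gauss_pdfE.
Qed.

Lemma pder_gauss (f : R -> R) (x a : R) : is_derive x 1 f a ->
  is_derive x 1 (fun t => g (f t)) (- (f x / V) * g (f x) * a).
Proof. by move=> fa; exact: (pder_comp (is_derive_gauss_pdf (f x)) fa). Qed.

Lemma horner_gauss_le (p : {poly R}) :
  exists2 C, 0 < C & forall z, `|p.[z]| * g z <= C * expR (- (4 * V)^-1 * z ^+ 2).
Proof.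
have c0 : 0 < (4 * V)^-1 by rewrite invr_gt0 mulr_gt0.
have [C C0 h] := horner_le_expR p c0.
have pk0 : 0 < pk by exact: normal_peak_gt0.
exists (C * pk) => [|z]; first exact: mulr_gt0.
rewrite gauss_pdfE mulrCA (mulrC C) -mulrA ler_wpM2l ?(ltW pk0)//.
apply: (@le_trans _ _ (C * expR ((4 * V)^-1 * z ^+ 2) * expR (- (2 * V)^-1 * z ^+ 2))).
  by rewrite ler_wpM2r ?expR_ge0.
rewrite -mulrA ler_wpM2l ?(ltW C0)// -expRD ler_expR le_eqVlt; apply/orP; left.
by apply/eqP; field; rewrite gt_eqF.
Qed.

(** The phase [a] covers cosine and sine transforms at once and lets differentiation act as a shift
    by pi / 2. The translation by x matches the integrands of the convolutions. *)
Definition hgauss (p : {poly R}) (x t a : R) :=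
  \int[leb]_v (p.[x - v] * g (x - v) * cos (t * (x - v) + a)).

Lemma continuous_hgauss (p : {poly R}) (x : R) (c : R -> R) : continuous c ->
  continuous (fun v : R => p.[x - v] * g (x - v) * c v).
Proof.
move=> cc v.
have dg : is_derive v 1 (fun v => g (x - v)) (- ((x - v) / V) * g (x - v) * (0 - 1)).
  by apply: pder_gauss; repeat derive_step.
have cpg : {for v, continuous (fun v : R => p.[x - v] * g (x - v))}.
  by notypeclasses refine (is_derive_continuous_at _); repeat derive_step.
exact: (cvgM cpg (cc v)).
Qed.

Lemma integrable_hgauss (p : {poly R}) (x : R) (c : R -> R) : continuous c ->
  (forall v, `|c v| <= 1) ->
  leb.-integrable setT (EFin \o (fun v => p.[x - v] * g (x - v) * c v)).
Proof.
move=> cc c1; have [C C0 hC] := horner_gauss_le p.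
refine (@integrable_le _ _ _ leb _ measurableT _
  (fun v => C * expR (- (4 * V)^-1 * (x - v) ^+ 2)) _ _ _).
- apply: continuous_measurable_fun; exact: continuous_hgauss.
- move=> v _; rewrite !normrM (gtr0_norm (gauss_pdf_gt0 _)).
  by rewrite (le_trans _ (hC _))// ler_piMr// mulr_ge0// ltW// gauss_pdf_gt0.
- by apply: integrable_Zl => //; apply: integrable_gauss; rewrite invr_gt0 mulr_gt0.
Qed.

Lemma integrable_horner_gauss (p : {poly R}) (x : R) :
  leb.-integrable setT (EFin \o (fun v => p.[x - v] * g (x - v))).
Proof.
have c1 (v : R) : `|(fun=> 1) v : R| <= 1 by rewrite normr1.
have cc : continuous (fun _ : R => 1 : R) by continuous_tac.
have := @integrable_hgauss p x (fun=> 1) cc c1; apply: eq_integrable => // v _.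
by rewrite /= mulr1.
Qed.

Lemma gauss_translate_pdf (x v : R) : g (x - v) = normal_pdf x (Num.sqrt V) v.
Proof.
rewrite /gauss_pdf !normal_pdfE// /normal_fun subr0.
by rewrite (_ : (x - v) ^+ 2 = (v - x) ^+ 2) //; ring.
Qed.

Lemma hgauss0 (p : {poly R}) (x a : R) :
  hgauss p x 0 a = cos a * \int[leb]_v (p.[x - v] * g (x - v)).
Proof.
rewrite -RintegralZl//; last exact: integrable_horner_gauss.
by apply: eq_Rintegral => v _; rewrite mul0r add0r mulrC.
Qed.

Let ccos (x t a : R) : continuous (fun v : R => cos (t * (x - v) + a)).
Proof. by continuous_tac. Qed.

(* Integration by parts against [p * g]: the boundary terms vanish. *)
Lemma hgauss_ibp (p : {poly R}) (x t a : R) :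
  hgauss (V^-1 *: ('X * p) - p^`()) x t a = t * hgauss p x t (a + pi / 2).
Proof.
pose F v := p.[x - v] * g (x - v) * cos (t * (x - v) + a).
pose f1 v := (V^-1 *: ('X * p) - p^`()).[x - v] * g (x - v) * cos (t * (x - v) + a).
pose f2 v := p.[x - v] * g (x - v) * cos (t * (x - v) + (a + pi / 2)).
have if1 : leb.-integrable setT (EFin \o f1) by apply: integrable_hgauss => // v; exact: cos_max.
have if2 : leb.-integrable setT (EFin \o f2) by apply: integrable_hgauss => // v; exact: cos_max.
have dF (v : R) : is_derive v 1 F (f1 v - t * f2 v).
  have dg : is_derive v 1 (fun v => g (x - v)) (- ((x - v) / V) * g (x - v) * (0 - 1)).
    by apply: pder_gauss; repeat derive_step.
  rewrite /F; derive_tac; rewrite /f1 /f2 hornerD hornerN hornerZ hornerM hornerX addrA cosDpihalf.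
  by field; rewrite gt_eqF.
have [C C0 hC] := horner_gauss_le p.
have c0 : 0 < (4 * V)^-1 by rewrite invr_gt0 mulr_gt0.
have := @integral_derivative0 R (fun v => f1 v - t * f2 v) F C _ x c0 _ _ dF _.
rewrite RintegralB ?RintegralZl//; last exact: integrable_Zl.
move=> H; apply/eqP; rewrite -subr_eq0; apply/eqP/H => [v||v].
- apply: cvgB; first exact: continuous_hgauss.
  by apply: cvgM; [exact: cvg_cst|exact: continuous_hgauss].
- by apply: integrable_sub => //; exact: integrable_Zl.
- rewrite /F !normrM (gtr0_norm (gauss_pdf_gt0 _)) (le_trans _ (hC _))//.
  by rewrite ler_piMr ?cos_max// mulr_ge0// ltW// gauss_pdf_gt0.
Qed.

Lemma hgaussZ (k : R) (p : {poly R}) (x t a : R) :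
  hgauss (k *: p) x t a = k * hgauss p x t a.
Proof.
rewrite -RintegralZl//; last by apply: integrable_hgauss => // v; exact: cos_max.
by apply: eq_Rintegral => v _; rewrite hornerZ !mulrA.
Qed.

Lemma integral_gauss_translate (x : R) : \int[leb]_v g (x - v) = 1.
Proof.
rewrite /Rintegral; under eq_integral do rewrite gauss_translate_pdf.
by rewrite integral_normal_pdf.
Qed.

(** Differentiating under the integral produces a factor 'X and shifts the phase back by pi / 2.
    Integration by parts with p = 1 converts this into - V t times the original, the differential
    equation of the Gaussian transform. *)
Lemma is_derive_hgauss1 (x a t : R) :
  is_derive t 1 (fun t => hgauss 1 x t a) (- (V * t) * hgauss 1 x t a).
Proof.
pose f (y v : R) := (1 : {poly R}).[x - v] * g (x - v) * cos (y * (x - v) + a).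
have df (y v : R) : is_derive y 1 (f^~ v)
    (- (('X : {poly R}).[x - v] * g (x - v) * cos (y * (x - v) + (a - pi / 2)))).
  rewrite /f; derive_tac; rewrite addrA cosBpihalf hornerC hornerX; ring.
have It : `](t - 1), (t + 1)[%classic t by rewrite /= in_itv/=; lra.
have intf (y : R) : leb.-integrable setT (EFin \o f y).
  by apply: integrable_hgauss => // v; exact: cos_max.
pose G v := `|('X : {poly R}).[x - v]| * g (x - v).
have G0 v : 0 <= G v by rewrite mulr_ge0// ltW// gauss_pdf_gt0.
have intG : leb.-integrable setT (EFin \o G).
  have := integrable_norm (integrable_horner_gauss 'X x).
  apply: eq_integrable => // v _ /=.
  by rewrite normrM (gtr0_norm (gauss_pdf_gt0 _)).
have Gub (y v : R) : `]t - 1, t + 1[%classic y -> setT v -> `|partial1of2 f y v| <= G v.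
  move=> _ _; rewrite partial1of2E (@derive_val _ _ _ _ _ _ _ (df y v)) normrN !normrM (gtr0_norm (gauss_pdf_gt0 _)).
  by apply: ler_piMr; [exact: (G0 v)|exact: cos_max].
have dd (y v : R) : `]t - 1, t + 1[%classic y -> setT v -> derivable (f^~ v) y 1.
  by move=> _ _; case: (df y v).
have h1 := @derivable_under_integral R _ _ leb f setT measurableT t _ _ It (fun y _ => intf y) dd G G0 intG Gub.
have h2 := @differentiation_under_integral R _ _ leb f setT measurableT t _ _ It (fun y _ => intf y) dd G G0 intG Gub.
apply: DeriveDef => //; rewrite -derive1E h2.
under eq_Rintegral do rewrite partial1of2E (@derive_val _ _ _ _ _ _ _ (df _ _)).
transitivity (- hgauss 'X x t (a - pi / 2)).
  rewrite -[RHS]mulN1r -RintegralZl//; last by apply: integrable_hgauss => // v; exact: cos_max.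
  by apply: eq_Rintegral => v _; rewrite mulN1r.
have := hgauss_ibp 1 x t (a - pi / 2).
rewrite mulr1 derivC subr0 hgaussZ subrK => h.
by rewrite mulNr -mulrA -h mulrA divff ?mul1r// gt_eqF.
Qed.

Lemma hgauss1E (x t a : R) : hgauss 1 x t a = expR (- (V / 2) * t ^+ 2) * cos a.
Proof.
pose Y (y : R) := hgauss 1 x y a * expR (V / 2 * y ^+ 2).
have dY (y : R) : is_derive y 1 Y 0.
  have dh := is_derive_hgauss1 x a y.
  by rewrite /Y; derive_tac; field.
have := is_derive_0_is_cst t 0 dY.
rewrite /Y expr0n/= mulr0 expR0 mulr1 hgauss0.
under [X in cos a * X]eq_Rintegral do rewrite hornerC mul1r.
rewrite integral_gauss_translate mulr1 => <-.
by rewrite mulrCA -expRD mulNr addNr expR0 mulr1.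
Qed.

(** Hermite polynomials scaled to variance V: [hermite_gauss j] times the density is (-1) ^ j times
    the j-th derivative of the density. *)
Fixpoint hermite_gauss (j : nat) : {poly R} :=
  if j is k.+1 then V^-1 *: ('X * hermite_gauss k) - (hermite_gauss k)^`() else 1.

Lemma hgauss_hermite j (x t a : R) : hgauss (hermite_gauss j) x t a =
  t ^+ j * expR (- (V / 2) * t ^+ 2) * cos (a + pi / 2 *+ j).
Proof.
elim: j a => [|j IH] a; first by rewrite hgauss1E mulr0n addr0 expr0 mul1r.
by rewrite hgauss_ibp IH -addrA -mulrS (exprS t j) !mulrA.
Qed.

End gaussian.

(** * Smoothing inequality for Edgeworth expansions *)

Section gaussian_lipschitz.
Context {R : realType}.
Notation leb := (@lebesgue_measure R).
Variable V : R.
Hypothesis V0 : 0 < V.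
Notation g := (gauss_pdf V).

Lemma continuous_gauss_pdf : continuous g.
Proof. by move=> x; exact: is_derive_continuous_at (is_derive_gauss_pdf V0 x). Qed.

Lemma integrable_gauss_pdf : leb.-integrable setT (EFin \o g).
Proof. exact: integrable_normal_pdf. Qed.

Lemma gauss_cdfE x : gauss_cdf V x = \int[leb]_(w in [set w | w <= x]) g w.
Proof. by []. Qed.

Lemma horner_gauss_bounded (p : {poly R}) : exists2 C, 0 < C & forall z, `|p.[z] * g z| <= C.
Proof.
have [C C0 hC] := horner_gauss_le V0 p; exists C => // z.
rewrite normrM (gtr0_norm (gauss_pdf_gt0 V0 _)) (le_trans (hC z))// ler_piMr ?(ltW C0)//.
by rewrite -expR0 ler_expR mulNr oppr_le0 mulr_ge0 ?sqr_ge0// invr_ge0 mulr_ge0// ltW.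
Qed.

Lemma horner_gauss_lipschitz (p : {poly R}) : exists2 L, 0 < L &
  forall x y, x <= y -> `|p.[y] * g y - p.[x] * g x| <= L * (y - x).
Proof.
have [L L0 hL] := horner_gauss_bounded (p^`() - V^-1 *: ('X * p)).
have dF (x : R) : is_derive x 1 (fun z => p.[z] * g z) ((p^`() - V^-1 *: ('X * p)).[x] * g x).
  have dg := is_derive_gauss_pdf V0 x.
  by derive_tac; rewrite hornerD hornerN hornerZ hornerM hornerX; field; rewrite gt_eqF.
exists L => // x y xy.
have cF : {within `[x, y], continuous (fun z => p.[z] * g z)}.
  by apply: continuous_subspaceT => z; exact: is_derive_continuous_at (dF z).
have [c _ ->] := MVT_segment xy (fun z _ => dF z) cF.
by rewrite normrM (ger0_norm (_ : 0 <= y - x)) ?subr_ge0// ler_wpM2r ?subr_ge0.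
Qed.

Lemma gauss_cdf_lipschitz : exists2 L, 0 < L &
  forall x y, x <= y -> gauss_cdf V y - gauss_cdf V x <= L * (y - x).
Proof.
have [L L0 hL] := horner_gauss_bounded 1; exists L => // x y xy.
rewrite !gauss_cdfE.
have mle z : measurable [set w : R | w <= z] by rewrite -set_itvNyc.
have -> : [set w | w <= y] = [set w | w <= x] `|` `]x, y].
  apply/seteqP; split => w /=; rewrite in_itv/=.
    by move=> ->; rewrite andbT; case: (leP w x); [left|right].
  by case=> [wx|/andP[]//]; exact: le_trans wx xy.
rewrite Rintegral_setU//; last 3 first.
- exact: mle.
- by apply: integrableS integrable_gauss_pdf => //; apply: measurableU => //; exact: mle.
- by apply/disj_setPS => w /= [wx]; rewrite in_itv/= ltNge wx.
rewrite addrAC subrr add0r.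
have -> : L * (y - x) = \int[leb]_(w in `]x, y]) L.
  by rewrite Rintegral_cst//= lebesgue_measure_itv/= lte_fin; move: xy; rewrite le_eqVlt => /predU1P[->|->]; rewrite ?ltxx ?subrr ?mulr0.
apply: le_Rintegral => //.
- exact: integrableS integrable_gauss_pdf.
- exact/continuous_integrable_itv/cst_continuous.
- by move=> z _; have := hL z; rewrite hornerC mul1r; exact: (le_trans (ler_norm _)).
Qed.

End gaussian_lipschitz.

Section trig_transform.
Context d (X : measurableType d) (R : realType).
Variables (mu : {measure set X -> \bar R}) (psi S : X -> R).
Hypotheses (ipsi : mu.-integrable setT (EFin \o psi)) (mS : measurable_fun setT S).

Lemma integrable_trig (c : R -> R) (t a : R) : continuous c -> (forall x, `|c x| <= 1) ->
  mu.-integrable setT (EFin \o (fun w => psi w * c (t * S w + a))).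
Proof.
move=> cc c1; refine (@integrable_le _ _ _ mu _ measurableT _ (fun w => `|psi w|) _ _ _).
- apply: measurable_funM; first by apply/measurable_EFinP; exact: measurable_int ipsi.
  apply: measurableT_comp; first exact: continuous_measurable_fun.
  by apply: measurable_funD => //; exact: measurable_funM.
- by move=> w _; rewrite normrM ler_piMr.
- exact: integrable_norm.
Qed.

Lemma continuous_trig (c : R -> R) : continuous c -> (forall x, `|c x| <= 1) ->
  continuous (fun t : R => \int[mu]_w (psi w * c (t * S w))).
Proof.
move=> cc c1 t.
have It : t \in `]t - 1, t + 1[%classic by rewrite inE/= in_itv/=; lra.
apply: (@continuity_under_integral _ _ _ mu (fun t w => psi w * c (t * S w)) setT measurableT _ _ _ _ (fun w => `|psi w|) _ _ _ It).
- move=> y _; have := integrable_trig y 0 cc c1; apply: eq_integrable => // w _ /=.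
  by rewrite addr0.
- apply: aeW => w _ y _.
  have cy : {for y, continuous (fun t : R => c (t * S w))}.
    by apply: continuous_comp; [exact: mulrr_continuous|exact: cc].
  exact: (cvgM (cvg_cst _) cy).
- exact: integrable_norm.
- by move=> y _; apply: aeW => w _; rewrite normrM ler_piMr.
Qed.

Let ic t : mu.-integrable setT (EFin \o (fun w => psi w * cos (t * S w))).
Proof.
by have := integrable_trig t 0 (@continuous_cos R) (@cos_max R); under eq_fun do rewrite addr0.
Qed.

Let isn t : mu.-integrable setT (EFin \o (fun w => psi w * sin (t * S w))).
Proof.
by have := integrable_trig t 0 (@continuous_sin R) (@sin_max R); under eq_fun do rewrite addr0.
Qed.

Lemma sin_transformE (t x : R) : \int[mu]_w (psi w * sin (t * (x - S w))) =
  sin (t * x) * \int[mu]_w (psi w * cos (t * S w)) -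
  cos (t * x) * \int[mu]_w (psi w * sin (t * S w)).
Proof.
rewrite -!RintegralZl// -RintegralB//; [|exact: integrable_Zl..].
by apply: eq_Rintegral => w _; rewrite mulrBr sinB; ring.
Qed.

Let A (t x : R) := \int[mu]_w (psi w * sin (t * (x - S w))).

Lemma continuous_sin_transform (x : R) : continuous (A^~ x).
Proof.
rewrite (_ : A^~ x = fun t => sin (t * x) * \int[mu]_w (psi w * cos (t * S w)) -
  cos (t * x) * \int[mu]_w (psi w * sin (t * S w))); last first.
  by apply/funext => t; exact: sin_transformE.
have c1 := continuous_trig (@continuous_cos R) (@cos_max R).
have c2 := continuous_trig (@continuous_sin R) (@sin_max R).
have c3 : continuous (fun t : R => sin (t * x)) by continuous_tac.
have c4 : continuous (fun t : R => cos (t * x)) by continuous_tac.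
by move=> t; exact: (cvgB (cvgM (c3 t) (c1 t)) (cvgM (c4 t) (c2 t))).
Qed.

(** The 1-Lipschitz bound on the sine cancels the 1 / t and leaves the constant |x - y| times the
    integral of |psi|, without any moment of [S]. *)
Lemma integrable_sin_transform (T x y : R) : 0 < T ->
  (@lebesgue_measure R).-integrable `]0, T]
    (EFin \o (fun t => (1 - t / T) * ((A t x - A t y) / t))).
Proof.
move=> T0.
have is1 t z : mu.-integrable setT (EFin \o (fun w => psi w * sin (t * (z - S w)))).
  have := integrable_trig (- t) (t * z) (@continuous_sin R) (@sin_max R).
  by apply: eq_integrable => // w _ /=; congr (_ * sin _)%:E; ring.
refine (@integrable_le _ _ _ (@lebesgue_measure R) _ (measurable_itv _) _
  (fun=> `|x - y| * \int[mu]_w `|psi w|) _ _ _).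
- apply: measurable_funTS; apply: measurable_funM.
    by apply: continuous_measurable_fun; continuous_tac.
  apply: measurable_funM; last exact: measurable_funV.
  apply: continuous_measurable_fun => t.
  by apply: cvgB; exact: continuous_sin_transform.
- move=> t /=; rewrite in_itv/= => /andP[t0 tT].
  have tT1 : t / T <= 1 by rewrite ler_pdivrMr// mul1r.
  have tT0 : 0 <= t / T by rewrite divr_ge0// ltW.
  rewrite normrM ger0_norm ?subr_ge0//.
  apply: (@le_trans _ _ (1 * (`|x - y| * \int[mu]_w `|psi w|))); last by rewrite mul1r.
  apply: ler_pM; rewrite ?subr_ge0//; first by rewrite gerBl.
  rewrite normrM normfV (gtr0_norm t0) ler_pdivrMr// -RintegralB//.
  have ib : mu.-integrable setT (EFin \o (fun w => `|psi w| * (`|x - y| * t))).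
    have := integrable_Zl measurableT (`|x - y| * t) (integrable_norm ipsi).
    by apply: eq_integrable => // w _ /=; rewrite mulrC.
  have isub : mu.-integrable setT (EFin \o (fun w => psi w * sin (t * (x - S w)) - psi w * sin (t * (y - S w)))).
    exact: integrable_sub.
  rewrite mulrAC [leRHS]mulrC -RintegralZr//; last exact: integrable_norm.
  apply: (le_trans (le_normr_Rintegral _ isub)) => //; apply: le_Rintegral => //.
    exact: integrable_norm.
  move=> w _; rewrite -mulrBr normrM ler_wpM2l// (le_trans (abs_sinB_le _ _))//.
  by rewrite -mulrBr normrM (gtr0_norm t0) mulrC (_ : x - S w - (y - S w) = x - y)//; ring.
- exact/continuous_integrable_itv/cst_continuous.
Qed.

End trig_transform.

Section edgeworth_smoothing.
Context d (X : measurableType d) (R : realType).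
Notation leb := (@lebesgue_measure R).
Variables (mu : {sigma_finite_measure set X -> \bar R}) (psi S : X -> R).
Variables (V T : R) (J : nat) (beta : nat -> R).
Hypotheses (V0 : 0 < V) (T0 : 0 < T).
Hypotheses (ipsi : mu.-integrable setT (EFin \o psi)) (mS : measurable_fun setT S).
Hypotheses (psi0 : forall w, 0 <= psi w).
Notation g := (gauss_pdf V).

Let F x := \int[mu]_(w in [set w | S w <= x]) psi w.
Let phr t := \int[mu]_w (psi w * cos (t * S w)).
Let phi t := \int[mu]_w (psi w * sin (t * S w)).
Let E (t : R) := expR (- (V / 2) * t ^+ 2).

(** Differentiating [hermite_gauss j] times the density gives minus [hermite_gauss j.+1] times the
    density. This explains the sign, and the shift by one: the measure with distribution function
    [W] has transform E t times the sum of beta_j (i t) ^ (j + 1). *)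
Definition edgeworth_poly : {poly R} := - \sum_(j < J) beta j *: hermite_gauss V j.

(* Real and imaginary parts of [E t * (1 + \sum_j beta_j (i t)^(j+1))]. *)
Definition edgeworth_re (t : R) : R :=
  E t * (1 + \sum_(j < J) beta j * t ^+ j.+1 * cos (pi / 2 *+ j.+1)).
Definition edgeworth_im (t : R) : R :=
  E t * \sum_(j < J) beta j * t ^+ j.+1 * sin (pi / 2 *+ j.+1).

Let W (z : R) := edgeworth_poly.[z] * g z.
Let D x := F x - gauss_cdf V x - W x.

Let gauss_sin_transform (t x : R) :
  \int[leb]_v (g v * sin (t * (x - v))) = E t * sin (t * x).
Proof.
have := hgauss1E V0 0 t (t * x - pi / 2); rewrite cosBpihalf => <-.
apply: eq_Rintegral => v _; rewrite hornerC mul1r sub0r /gauss_pdf.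
rewrite !normal_pdfE ?gt_eqF ?sqrtr_gt0// /normal_fun !subr0 sqrrN; congr (_ * _).
by rewrite addrA cosBpihalf; congr sin; ring.
Qed.

Let W_cos_transform (t x : R) : \int[leb]_v (W (x - v) * cos (t * v)) =
  - \sum_(j < J) beta j * t ^+ j * E t * cos (pi / 2 *+ j - t * x).
Proof.
pose c (v : R) := cos (t * (x - v) + - (t * x)).
have cc : continuous c by rewrite /c; continuous_tac.
have c1 v : `|c v| <= 1 by exact: cos_max.
have cE v : cos (t * v) = c v by rewrite /c -cosN; congr cos; ring.
have h (J' : nat) : \int[leb]_v ((\sum_(j < J') beta j *: hermite_gauss V j).[x - v] * g (x - v) * c v) =
    \sum_(j < J') beta j * t ^+ j * E t * cos (pi / 2 *+ j - t * x).
  elim: J' => [|K IH].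
    rewrite !big_ord0; under eq_Rintegral do rewrite horner0 !mul0r.
    by rewrite /Rintegral integral0.
  rewrite !big_ord_recr/= -IH.
  have -> : beta K * t ^+ K * E t * cos (pi / 2 *+ K - t * x) = hgauss V (beta K *: hermite_gauss V K) x t (- (t * x)).
    by rewrite hgaussZ// hgauss_hermite// (addrC (- (t * x))) /E !mulrA.
  rewrite -RintegralD//; [|exact: integrable_hgauss..].
  by apply: eq_Rintegral => v _; rewrite hornerD !mulrDl.
rewrite -mulN1r -h -RintegralZl//; last exact: integrable_hgauss.
by apply: eq_Rintegral => v _; rewrite /W /edgeworth_poly hornerN cE !mulNr mul1r.
Qed.

(** This is the imaginary part of e ^ (i t x) times the conjugate of the difference of the two
    characteristic functions, so it is bounded by that difference uniformly in x. *)
Let B (t x : R) := sin (t * x) * (phr t - edgeworth_re t) - cos (t * x) * (phi t - edgeworth_im t).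

Let BE (t x : R) : B t x = \int[mu]_w (psi w * sin (t * (x - S w))) -
  \int[leb]_v (g v * sin (t * (x - v))) - t * \int[leb]_v (W (x - v) * cos (t * v)).
Proof.
rewrite sin_transformE// gauss_sin_transform W_cos_transform /B /edgeworth_re /edgeworth_im.
rewrite -/(phr t) -/(phi t).
set S1 := \sum_(j < J) beta j * t ^+ j.+1 * cos _.
set S2 := \sum_(j < J) beta j * t ^+ j.+1 * sin _.
rewrite (_ : t * - _ = - (E t * (cos (t * x) * S2 - sin (t * x) * S1))).
  by ring.
rewrite mulrN mulr_sumr /S1 /S2 !mulr_sumr -sumrB mulr_sumr; congr (- _).
apply: eq_bigr => j _; rewrite (mulrSr (pi / 2) j) sinDpihalf cosDpihalf cosB (exprS t j).
ring.
Qed.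

Let C (x : R) := \int[leb]_v (fejer T v * D (x - v)).

Let igp := @integrable_gauss_pdf R V.

Let g0 v : 0 <= g v. Proof. exact/ltW/gauss_pdf_gt0. Qed.

Let mid : measurable_fun setT (fun w : R => w).
Proof. exact: measurable_id. Qed.

Let mF := measurable_dcdf ipsi mS psi0.
Let mN := measurable_dcdf igp mid g0.

Let mW : measurable_fun setT W.
Proof.
apply: measurable_funM; last by apply: continuous_measurable_fun; exact: continuous_gauss_pdf.
by apply: continuous_measurable_fun; continuous_tac.
Qed.

Let bounds : exists M : R, [/\ (forall x, `|F x| <= M), (forall x, `|gauss_cdf V x| <= M),
  (forall x, `|W x| <= M) & (forall x, `|D x| <= M)].
Proof.
have [M M0 hM] := horner_gauss_bounded V0 edgeworth_poly.
pose M1 := \int[mu]_w psi w; pose M2 := \int[leb]_w g w.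
have F1 x : `|F x| <= M1 by rewrite ger0_norm; [exact: (dcdf_le ipsi mS psi0)|exact: dcdf_ge0].
have N1 x : `|gauss_cdf V x| <= M2.
  by rewrite ger0_norm; [exact: (dcdf_le igp mid g0)|exact: dcdf_ge0].
have M10 : 0 <= M1 by exact: le_trans (F1 0).
have M20 : 0 <= M2 by exact: le_trans (N1 0).
exists (M1 + M2 + M); split => x.
- by rewrite (le_trans (F1 x))// -addrA lerDl addr_ge0// ltW.
- by rewrite (le_trans (N1 x))// addrAC lerDr addr_ge0// ltW.
- by rewrite (le_trans (hM x))// lerDr addr_ge0.
- rewrite (le_trans (ler_normB _ _))// lerD//; last exact: hM.
  by rewrite (le_trans (ler_normB _ _))// lerD.
Qed.

Let shift (f : R -> R) (x : R) : measurable_fun setT f -> measurable_fun setT (fun v : R => f (x - v)).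
Proof. by move=> mf; apply: (measurableT_comp mf); exact: measurable_funB. Qed.

Let iW x : leb.-integrable setT (EFin \o (fun v : R => W (x - v))).
Proof. exact: integrable_horner_gauss. Qed.

Let iWc x : leb.-integrable `]0, T]
  (EFin \o (fun t => (1 - t / T) * \int[leb]_v (W (x - v) * cos (t * v)))).
Proof.
apply: continuous_integrable_itv.
under eq_fun do rewrite W_cos_transform.
have h (J' : nat) : continuous (fun t : R => \sum_(j < J') beta j * t ^+ j * E t * cos (pi / 2 *+ j - t * x)).
  elim: J' => [|K IH].
    by under eq_fun do rewrite big_ord0; continuous_tac.
  under eq_fun do rewrite big_ord_recr/=.
  have cK : continuous (fun t : R => beta K * t ^+ K * E t * cos (pi / 2 *+ K - t * x)).
    by rewrite /E; continuous_tac.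
  by move=> t; exact: (cvgD (IH t) (cK t)).
have ct : continuous (fun t : R => 1 - t / T) by continuous_tac.
by move=> t; exact: (cvgM (ct t) (cvgN (h J t))).
Qed.

Let conv_diff x y : y <= x -> C x - C y =
  \int[leb]_(t in `]0, T]) ((1 - t / T) * ((B t x - B t y) / t)).
Proof.
move=> yx; have [M [FM NM WM DM]] := bounds.
have CE z : C z = \int[leb]_v (fejer T v * F (z - v)) -
    \int[leb]_v (fejer T v * gauss_cdf V (z - v)) - \int[leb]_v (fejer T v * W (z - v)).
  have i1 : leb.-integrable setT (EFin \o (fun v => fejer T v * F (z - v))).
    by apply: (integrable_fejerM T0 _ (fun v => FM _)); exact: shift.
  have i2 : leb.-integrable setT (EFin \o (fun v => fejer T v * gauss_cdf V (z - v))).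
    by apply: (integrable_fejerM T0 _ (fun v => NM _)); exact: shift.
  have i3 : leb.-integrable setT (EFin \o (fun v => fejer T v * W (z - v))).
    by apply: (integrable_fejerM T0 _ (fun v => WM _)); exact: shift.
  rewrite -RintegralB// -RintegralB//; last exact: integrable_sub.
  by apply: eq_Rintegral => v _; rewrite /D !mulrBr.
have e1 := fejer_conv_cdf ipsi mS T0 psi0 yx.
have e2 := fejer_conv_cdf igp mid T0 g0 yx.
rewrite !CE; rewrite -/F in e1.
rewrite (_ : forall a b c a' b' c' : R, a - b - c - (a' - b' - c') = (a - a') - (b - b') - (c - c')); last by move=> *; ring.
rewrite e1 e2 (fejer_density T0 (iW x)) (fejer_density T0 (iW y)).
have j1 := integrable_sin_transform ipsi mS x y T0.
have j2 := integrable_sin_transform igp mid x y T0.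
rewrite -(RintegralB _ (iWc x) (iWc y))// -(RintegralB _ j1 j2)//.
rewrite -(RintegralB _ (integrable_sub _ j1 j2) (integrable_sub _ (iWc x) (iWc y)))//.
apply: eq_Rintegral => t; rewrite inE/= in_itv/= => /andP[t0 _].
have alg (u a1 a2 b1 b2 c1 c2 : R) : u * ((a1 - a2) / t) - u * ((b1 - b2) / t) -
    (u * c1 - u * c2) = u * ((a1 - b1 - t * c1 - (a2 - b2 - t * c2)) / t).
  by field; rewrite gt_eqF.
by rewrite !BE; exact: alg.
Qed.

(** [F] is nondecreasing, so a Lipschitz bound on the Gaussian side alone gives the one-sided
    condition on [D]. The constant 16 is 8 times the 2 that comes from bounding B t x - B t y by the
    two terms separately. *)
Lemma edgeworth_smoothing (L w : R) : 0 < L ->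
  (forall x y, x <= y -> gauss_cdf V y + W y - (gauss_cdf V x + W x) <= L * (y - x)) ->
  (\int[leb]_(t in `]0%R, T]) ((`|phr t - edgeworth_re t| + `|phi t - edgeworth_im t|) / t)%:E
     <= w%:E)%E ->
  forall x, `|D x| <= 16 * w + 400 * (L / T).
Proof.
move=> L0 GL hw; have [M [FM NM WM DM]] := bounds.
have csum (c : nat -> R) : continuous (fun t : R => \sum_(j < J) beta j * t ^+ j.+1 * c j).
  elim: J => [|K IH]; first by under eq_fun do rewrite big_ord0; continuous_tac.
  under eq_fun do rewrite big_ord_recr/=.
  have cK : continuous (fun t : R => beta K * t ^+ K.+1 * c K) by continuous_tac.
  by move=> t; exact: (cvgD (IH t) (cK t)).
have cE : continuous E by rewrite /E; continuous_tac.
have cphr : continuous phr by exact: (continuous_trig ipsi mS (@continuous_cos R) (@cos_max R)).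
have cphi : continuous phi by exact: (continuous_trig ipsi mS (@continuous_sin R) (@sin_max R)).
have cre : continuous (fun t => phr t - edgeworth_re t).
  have c1 := csum (fun j => cos (pi / 2 *+ j.+1)).
  have c0 : continuous (fun _ : R => 1 : R) by continuous_tac.
  by move=> t; exact: (cvgB (cphr t) (cvgM (cE t) (cvgD (c0 t) (c1 t)))).
have cim : continuous (fun t => phi t - edgeworth_im t).
  have c1 := csum (fun j => sin (pi / 2 *+ j.+1)).
  by move=> t; exact: (cvgB (cphi t) (cvgM (cE t) (c1 t))).
have mD : measurable_fun setT D.
  by apply: measurable_funB => //; exact: measurable_funB.
have D0 : D x @[x --> -oo] --> 0.
  have W0 : W x @[x --> -oo] --> 0.
    (* Boundedness of x W x, obtained by multiplying the polynomial by 'X, forces [W] to vanish at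
       -oo. *)
    have [K K0 hK] := horner_gauss_bounded V0 ('X * edgeworth_poly).
    apply/cvgrPdist_le => e e0; near=> x.
    have x0 : x < 0 by near: x; exact: nbhs_ninfty_lt.
    have xe : x <= - (K / e) by near: x; apply: nbhs_ninfty_le; exact: num_real.
    have := hK x; rewrite hornerM hornerX -mulrA normrM ltr0_norm// -/(W x) => h.
    rewrite sub0r normrN -(@ler_pM2l _ (- x)) ?oppr_gt0// (le_trans h)//.
    by rewrite -ler_pdivrMr// lerNr.
  rewrite -(subr0 0) -[X in X - _](subr0 0).
  apply: cvgB W0; apply: cvgB; first exact: dcdf_cvgNy ipsi mS psi0.
  exact: dcdf_cvgNy igp mid g0.
rewrite (_ : 16 * w = 8 * (2 * w)); last by ring.
apply: (esseen_smoothing T0 mD DM L0 D0).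
- move=> x y xy; have Fxy := dcdf_homo ipsi mS psi0 xy; have := GL x y xy.
  by rewrite /D; rewrite /= in Fxy; rewrite -/(F x) -/(F y) in Fxy; lra.
move=> x y yx; rewrite -/(C x) -/(C y) conv_diff//.
pose h t := (`|phr t - edgeworth_re t| + `|phi t - edgeworth_im t|) / t.
have mh : measurable_fun setT h.
  apply: measurable_funM; last exact: measurable_funV.
  by apply: measurable_funD; apply: measurableT_comp => //; apply: continuous_measurable_fun.
have h0 t : `]0, T]%classic t -> 0 <= h t.
  by rewrite /= in_itv/= => /andP[t0 _]; rewrite divr_ge0 ?addr_ge0// ltW.
have ih : leb.-integrable `]0, T] (EFin \o h).
  apply/integrableP; split; first by apply/measurable_EFinP; exact: measurable_funTS.
  rewrite (le_lt_trans _ (ltry w))// (le_trans _ hw)// le_eqVlt; apply/orP; left; apply/eqP.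
  by apply: eq_integral => t; rewrite inE => ht; rewrite /= ger0_norm ?h0.
have cB z : continuous (B^~ z).
  have c1 : continuous (fun t : R => sin (t * z)) by continuous_tac.
  have c2 : continuous (fun t : R => cos (t * z)) by continuous_tac.
  by move=> t; exact: (cvgB (cvgM (c1 t) (cre t)) (cvgM (c2 t) (cim t))).
have kb t : `]0, T]%classic t -> `|(1 - t / T) * ((B t x - B t y) / t)| <= 2 * h t.
  rewrite /= in_itv/= => /andP[t0 tT].
  have tT1 : t / T <= 1 by rewrite ler_pdivrMr// mul1r.
  have tT0 : 0 <= t / T by rewrite divr_ge0// ltW.
  rewrite normrM ger0_norm ?subr_ge0// -[leRHS]mul1r.
  apply: ler_pM; rewrite ?subr_ge0//; first by rewrite gerBl.
  rewrite /h mulrA normrM normfV (gtr0_norm t0) ler_wpM2r// ?invr_ge0 ?(ltW t0)//.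
  have Bb z : `|B t z| <= `|phr t - edgeworth_re t| + `|phi t - edgeworth_im t|.
    by rewrite (le_trans (ler_normB _ _))// lerD// normrM ler_piMl ?sin_max ?cos_max.
  by rewrite (le_trans (ler_normB _ _))// mulr_natl mulr2n lerD.
have ik : leb.-integrable `]0, T] (EFin \o (fun t => (1 - t / T) * ((B t x - B t y) / t))).
  refine (@integrable_le _ _ _ leb _ (measurable_itv _) _ (fun t => 2 * h t) _ kb _).
    apply: measurable_funTS; apply: measurable_funM.
      by apply: continuous_measurable_fun; continuous_tac.
    apply: measurable_funM; last exact: measurable_funV.
    by apply: measurable_funB; apply: continuous_measurable_fun; exact: cB.
  exact: integrable_Zl.
rewrite (le_trans (le_normr_Rintegral _ ik))//.
apply: (@le_trans _ _ (\int[leb]_(t in `]0, T]) (2 * h t))).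
  apply: le_Rintegral => //.
  - exact: integrable_norm.
  - exact: integrable_Zl.
rewrite RintegralZl// ler_wpM2l// -lee_fin fineK//; exact: integrable_fin_num.
Unshelve. all: by end_near. Qed.

End edgeworth_smoothing.

(** * Complex-valued functions of a real variable *)

Section complex_modulus.
Context {R : realType}.
Implicit Types x y z : R[i].

Lemma ncD x y : nc (x + y) <= nc x + nc y. Proof. exact: le_normcD. Qed.
Lemma ncN x : nc (- x) = nc x. Proof. exact: normcN. Qed.
Lemma ncB x y : nc (x - y) <= nc x + nc y. Proof. by rewrite -(ncN y) ncD. Qed.
Lemma ncM x y : nc (x * y) = nc x * nc y. Proof. exact: Normc.normcM. Qed.
Lemma ncV x : nc x^-1 = (nc x)^-1. Proof. exact: Normc.normcV. Qed.
Lemma nc0 : nc (0 : R[i]) = 0. Proof. exact: Normc.normc0. Qed.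
Lemma nc1 : nc (1 : R[i]) = 1. Proof. exact: Normc.normc1. Qed.
Lemma nc_ge0 x : 0 <= nc x. Proof. by case: x => a b; exact: sqrtr_ge0. Qed.

Lemma ncX x n : nc (x ^+ n) = nc x ^+ n.
Proof. by elim: n => [|n IH]; rewrite ?expr0 ?nc1// !exprS ncM IH. Qed.

Lemma nc_real (a : R) : nc a%:C%C = `|a|.
Proof. by rewrite /Normc.normc /= expr0n/= addr0 sqrtr_sqr. Qed.

Lemma nc_nat n : nc (n%:R : R[i]) = n%:R.
Proof. by rewrite (_ : n%:R = (n%:R : R)%:C%C) ?nc_real ?normr_nat ?rmorph_nat. Qed.

Lemma nc_sum I (r : seq I) (P : pred I) (f : I -> R[i]) :
  nc (\sum_(i <- r | P i) f i) <= \sum_(i <- r | P i) nc (f i).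
Proof.
elim/big_ind2 : _ => [|a b c d ab cd|//]; first by rewrite nc0.
by rewrite (le_trans (ncD _ _))// lerD.
Qed.

Lemma nc_sqr z : nc z ^+ 2 = Re z ^+ 2 + Im z ^+ 2.
Proof. by case: z => a b; rewrite sqr_sqrtr// addr_ge0 ?sqr_ge0. Qed.

Lemma Re_le_nc z : `|Re z| <= nc z.
Proof. by rewrite -ler_sqr ?nnegrE ?nc_ge0// real_normK ?num_real// nc_sqr lerDl sqr_ge0. Qed.

Lemma Im_le_nc z : `|Im z| <= nc z.
Proof. by rewrite -ler_sqr ?nnegrE ?nc_ge0// real_normK ?num_real// nc_sqr lerDr sqr_ge0. Qed.

Lemma nc_le_ReIm z : nc z <= `|Re z| + `|Im z|.
Proof.
rewrite -ler_sqr ?nnegrE ?nc_ge0 ?addr_ge0// nc_sqr sqrrD !real_normK ?num_real//.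
by rewrite lerD2r lerDl mulrn_wge0// mulr_ge0.
Qed.

Lemma nc_conj z : nc (conjc z) = nc z.
Proof. by case: z => a b; rewrite /Normc.normc /= sqrrN. Qed.

Lemma cReD x y : Re (x + y) = Re x + Re y. Proof. by case: x; case: y. Qed.
Lemma cImD x y : Im (x + y) = Im x + Im y. Proof. by case: x; case: y. Qed.
Lemma cReN x : Re (- x) = - Re x. Proof. by case: x. Qed.
Lemma cImN x : Im (- x) = - Im x. Proof. by case: x. Qed.
Lemma cReM x y : Re (x * y) = Re x * Re y - Im x * Im y. Proof. by case: x; case: y. Qed.
Lemma cImM x y : Im (x * y) = Re x * Im y + Im x * Re y. Proof. by case: x; case: y. Qed.
Lemma cReMr x (a : R) : Re (x * a%:C%C) = Re x * a. Proof. by rewrite cReM /= mulr0 subr0. Qed.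
Lemma cImMr x (a : R) : Im (x * a%:C%C) = Im x * a. Proof. by rewrite cImM /= mulr0 add0r. Qed.

Lemma cReV x : Re x^-1 = Re x * (Re x ^+ 2 + Im x ^+ 2)^-1.
Proof. by case: x. Qed.
Lemma cImV x : Im x^-1 = - (Im x * (Re x ^+ 2 + Im x ^+ 2)^-1).
Proof. by case: x. Qed.

Lemma complex_eqP x y : Re x = Re y -> Im x = Im y -> x = y.
Proof. by case: x; case: y => ? ? ? ? /= -> ->. Qed.

End complex_modulus.

Section complex_derivative.
Context {R : realType}.
Implicit Types (f g : R -> R[i]) (s : R) (z w : R[i]).

Definition is_cderive s f z :=
  is_derive (s : R) (1 : R) (fun t : R => Re (f t) : R) (Re z : R) /\
  is_derive (s : R) (1 : R) (fun t : R => Im (f t) : R) (Im z : R).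

Definition cderivable f s :=
  derivable (fun t : R => Re (f t) : R) (s : R) (1 : R) /\
  derivable (fun t : R => Im (f t) : R) (s : R) (1 : R).

Lemma cderivableP f s : cderivable f s -> is_cderive s f (cderiv f s).
Proof. by move=> [? ?]; split; rewrite /= derive1E; exact: derivableP. Qed.

Lemma is_cderive_derivable f s z : is_cderive s f z -> cderivable f s.
Proof. by move=> [[? _] [? _]]. Qed.

Lemma is_cderive_val f s z : is_cderive s f z -> cderiv f s = z.
Proof. by move=> [[_ h1] [_ h2]]; apply: complex_eqP; rewrite /= derive1E. Qed.

Lemma is_cderiveD f g s z w : is_cderive s f z -> is_cderive s g w ->
  is_cderive s (fun t => f t + g t) (z + w).
Proof.
move=> [f1 f2] [g1 g2]; split.
  by under eq_fun do rewrite cReD; rewrite cReD; exact: (pder_add f1 g1).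
by under eq_fun do rewrite cImD; rewrite cImD; exact: (pder_add f2 g2).
Qed.

Lemma is_cderiveM f g s z w : is_cderive s f z -> is_cderive s g w ->
  is_cderive s (fun t => f t * g t) (z * g s + f s * w).
Proof.
move=> [f1 f2] [g1 g2]; split.
  under eq_fun do rewrite cReM.
  by derive_tac; rewrite cReD !cReM; ring.
under eq_fun do rewrite cImM.
by derive_tac; rewrite cImD !cImM; ring.
Qed.

Lemma is_cderive_cst z s : is_cderive s (fun=> z) 0.
Proof. by split; exact: pder_cst. Qed.

Lemma is_cderiveV f s z : f s != 0 -> is_cderive s f z ->
  is_cderive s (fun t => (f t)^-1) (- z * ((f s)^-1 * (f s)^-1)).
Proof.
move=> fs0 [f1 f2].
have n0 : Re (f s) ^+ 2 + Im (f s) ^+ 2 != 0.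
  rewrite -nc_sqr sqrf_eq0; apply: contra fs0 => /eqP h.
  by apply/eqP; exact: Normc.eq0_normc.
have dn := pder_add (pder_expn 2 f1) (pder_expn 2 f2).
have dV := @pder_inv R (fun t => Re (f t) ^+ 2 + Im (f t) ^+ 2) s _ n0 dn.
split.
  under eq_fun do rewrite cReV.
  by derive_tac; rewrite !(cReM, cReN, cImM, cImN, cReV, cImV) /=; field.
under eq_fun do rewrite cImV.
by derive_tac; rewrite !(cReM, cReN, cImM, cImN, cReV, cImV) /=; field.
Qed.

Section times_differentiable.
Variable d : R.
Notation D := [set s : R | `|s| < d].

Let D_nbhs s : D s -> \forall t \near s, D t.
Proof.
by move=> Ds; have /cvgr_lt/(_ _ Ds) := @norm_continuous R R s.
Qed.

(** Unlike [Ck_on], continuity of the k-th derivative is not recorded: Cauchy's form of the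
    remainder uses only the existence of the derivatives, and this makes closure under products and
    inverses a plain induction. *)
Definition kdiff (k : nat) f := forall j, (j < k)%N -> forall s, D s -> cderivable (cderivn j f) s.

(** Peeling off the innermost derivative gives an induction on k over all functions at once, which
    is how the closure properties below are proved. *)
Lemma kdiffS k f : kdiff k.+1 f <-> (forall s, D s -> cderivable f s) /\ kdiff k (cderiv f).
Proof.
split=> [h|[h0 h] [|j] jk s Ds].
- split=> [s|j jk s]; first exact: (h 0).
  by move=> Ds; have := h j.+1 jk s Ds; rewrite /cderivn iterSr.
- exact: h0.
- by have := h j jk s Ds; rewrite /cderivn iterSr.
Qed.

Lemma kdiff_le k l f : (l <= k)%N -> kdiff k f -> kdiff l f.
Proof. by move=> lk h j jl; apply: h; exact: leq_trans lk. Qed.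

Let is_cderive_near f g s z : {near s, f =1 g} -> is_cderive s f z -> is_cderive s g z.
Proof.
move=> fg [h1 h2]; split.
  by apply: near_eq_is_derive h1; near=> t; rewrite (near fg t).
by apply: near_eq_is_derive h2; near=> t; rewrite (near fg t).
Unshelve. all: by end_near. Qed.

Lemma eq_cderivable f g s : (forall t, D t -> f t = g t) -> D s -> cderivable f s -> cderivable g s.
Proof.
move=> fg Ds /cderivableP h; apply: is_cderive_derivable (is_cderive_near _ h).
by apply: filterS (D_nbhs Ds).
Qed.

Lemma eq_cderiv f g s : (forall t, D t -> f t = g t) -> D s -> cderivable f s -> cderiv f s = cderiv g s.
Proof.
move=> fg Ds /cderivableP h; apply/esym/is_cderive_val/(is_cderive_near _ h).
by apply: filterS (D_nbhs Ds).
Qed.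

(** The formulas for the derivative of a sum, product or inverse are known only on the disc; since
    it is open, agreement there determines all further derivatives there. *)
Lemma eq_kdiff k f g : (forall t, D t -> f t = g t) -> kdiff k f -> kdiff k g.
Proof.
elim: k f g => [|k IH] f g fg; first by move=> _ j.
move=> /kdiffS[h0 h]; apply/kdiffS; split=> [s Ds|].
  exact: (eq_cderivable fg Ds (h0 s Ds)).
by apply: IH h => t Dt; exact: (eq_cderiv fg Dt (h0 t Dt)).
Qed.

Lemma kdiff_cst k z : kdiff k (fun=> z).
Proof.
elim: k z => [|k IH] z; first by move=> j.
apply/kdiffS; split=> [s _|]; first exact: is_cderive_derivable (is_cderive_cst z s).
apply: eq_kdiff (IH 0) => t _; apply/esym.
exact: is_cderive_val (is_cderive_cst z t).
Qed.

Lemma kdiffD k f g : kdiff k f -> kdiff k g -> kdiff k (fun t => f t + g t).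
Proof.
elim: k f g => [|k IH] f g; first by move=> _ _ j.
move=> /kdiffS[f0 fk] /kdiffS[g0 gk]; apply/kdiffS.
have h s : D s -> is_cderive s (fun t => f t + g t) (cderiv f s + cderiv g s).
  by move=> Ds; apply: is_cderiveD; apply: cderivableP; [exact: f0|exact: g0].
split=> [s /h /is_cderive_derivable//|].
by apply: eq_kdiff (IH _ _ fk gk) => t /h /is_cderive_val ->.
Qed.

Lemma kdiffM k f g : kdiff k f -> kdiff k g -> kdiff k (fun t => f t * g t).
Proof.
elim: k f g => [|k IH] f g; first by move=> _ _ j.
move=> hf hg; have /kdiffS[f0 fk] := hf; have /kdiffS[g0 gk] := hg; apply/kdiffS.
have h s : D s -> is_cderive s (fun t => f t * g t) (cderiv f s * g s + f s * cderiv g s).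
  by move=> Ds; apply: is_cderiveM; apply: cderivableP; [exact: f0|exact: g0].
split=> [s /h /is_cderive_derivable//|].
apply: (@eq_kdiff _ (fun t => cderiv f t * g t + f t * cderiv g t)).
  by move=> t /h /is_cderive_val ->.
by apply: kdiffD; [exact: IH fk (kdiff_le (leqnSn k) hg)|exact: IH (kdiff_le (leqnSn k) hf) gk].
Qed.

Lemma kdiffX k f n : kdiff k f -> kdiff k (fun t => f t ^+ n).
Proof.
move=> hf; elim: n => [|n IH]; first exact: kdiff_cst.
by under eq_fun do rewrite exprS; exact: kdiffM.
Qed.

(** The derivative of 1 / f is - f' / f ^ 2, built from f' and 1 / f itself, so the induction
    hypothesis at order k gives order k + 1 through products. *)
Lemma kdiffV k f : (forall s, D s -> f s != 0) -> kdiff k f -> kdiff k (fun t => (f t)^-1).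
Proof.
move=> f_neq0; elim: k => [|k IH]; first by move=> _ j.
move=> hf; have /kdiffS[f0 fk] := hf; apply/kdiffS.
have h s : D s -> is_cderive s (fun t => (f t)^-1) (- cderiv f s * ((f s)^-1 * (f s)^-1)).
  by move=> Ds; apply: is_cderiveV; [exact: f_neq0|apply: cderivableP; exact: f0].
split=> [s /h /is_cderive_derivable//|].
apply: (@eq_kdiff _ (fun t => - cderiv f t * ((f t)^-1 * (f t)^-1))).
  by move=> t /h /is_cderive_val ->.
have iV : kdiff k (fun t => (f t)^-1) by apply: IH; exact: kdiff_le (leqnSn k) _.
apply: kdiffM; last exact: kdiffM.
under eq_fun do rewrite -mulN1r.
by apply: (@kdiffM _ (fun=> -1) (cderiv f)); [exact: kdiff_cst|exact: fk].
Qed.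

End times_differentiable.
End complex_derivative.

Section real_taylor.
Context {R : realType}.
Variables (d : R) (f : nat -> R -> R).
Implicit Types s u t : R.

(** The intermediate point is written th s with th in [0, 1], which treats both signs of s alike and
    is the form in which the multiplier is compared at s and th s. *)
Lemma mean_value (F dF : R -> R) (s : R) : `|s| < d ->
  (forall u : R, `|u| < d -> is_derive u 1 F (dF u)) ->
  exists th : R, [/\ 0 <= th, th <= 1 & F s - F 0 = s * dF (th * s)].
Proof.
move=> sd h; have hc (a b : R) : `|a| < d -> `|b| < d -> {within `[a, b], continuous F}.
  move=> ad bd; apply: derivable_within_continuous => u; rewrite in_itv/= => /andP[au ub].
  suff /h[] : `|u| < d by [].
  move: ad bd; rewrite !ltr_norml => /andP[? ?] /andP[? ?]; apply/andP; split; lra.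
have d0 : 0 < d by rewrite (le_lt_trans _ sd).
have hd (a b : R) : `|a| < d -> `|b| < d -> forall u : R, u \in `]a, b[ -> is_derive u 1 F (dF u).
  move=> ad bd u; rewrite in_itv/= => /andP[au ub]; apply: h.
  move: ad bd; rewrite !ltr_norml => /andP[? ?] /andP[? ?]; apply/andP; split; lra.
have z0 : `|0 : R| < d by rewrite normr0.
have [->|s_neq0] := eqVneq s 0; first by exists 0; rewrite subrr mul0r ler01 lexx.
have [s0|s0] := leP 0 s.
  have [c /itvP ci e] := MVT_segment s0 (hd _ _ z0 sd) (hc _ _ z0 sd).
  exists (c / s); split.
  - by rewrite divr_ge0 ?ci.
  - by rewrite ler_pdivrMr ?mul1r ?ci// lt_neqAle eq_sym s_neq0.
  - by rewrite e subr0 divfK// mulrC.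
have [c /itvP ci e] := MVT_segment (ltW s0) (hd _ _ sd z0) (hc _ _ sd z0).
exists (c / s); split.
- by rewrite -(opprK s) invrN mulrN -mulNr divr_ge0// oppr_ge0 ?ci// ltW.
- by rewrite ler_ndivrMr// mul1r ci.
- by rewrite divfK// -opprB e sub0r mulrN opprK mulrC.
Qed.

(** The mean value theorem is applied to the Taylor polynomial at u evaluated at s, as a function of
    u: its derivative telescopes to the last term, and its values at s and 0 are f s and the
    polynomial at 0. *)
Lemma taylor_cauchy (k : nat) s : `|s| < d ->
  (forall j, (j <= k)%N -> forall u : R, `|u| < d -> is_derive u 1 (f j) (f j.+1 u)) ->
  exists th : R, [/\ 0 <= th, th <= 1 &
    f 0 s - \sum_(j < k.+1) f j 0 * (s ^+ j / j`!%:R) =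
    s * (f k.+1 (th * s) * ((s - th * s) ^+ k / k`!%:R))].
Proof.
move=> sd h.
pose F k u := \sum_(j < k.+1) f j u * ((s - u) ^+ j / j`!%:R).
have dF k' : (k' <= k)%N -> forall u : R, `|u| < d ->
    is_derive u 1 (F k') (f k'.+1 u * ((s - u) ^+ k' / k'`!%:R)).
  elim: k' => [|k' IH] kk u ud.
    rewrite (_ : F 0 = f 0); first by rewrite expr0 fact0 divr1 mulr1; exact: h.
    by apply/funext => v; rewrite /F big_ord_recr big_ord0/= add0r expr0 fact0 divr1 mulr1.
  rewrite (_ : F k'.+1 = fun u => F k' u + f k'.+1 u * ((s - u) ^+ k'.+1 / k'.+1`!%:R)); last first.
    by apply/funext => v; rewrite /F big_ord_recr.
  have h0 := h k'.+1 kk u ud; have h1 := IH (ltnW kk) u ud.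
  derive_tac; rewrite factS natrM exprS.
  by field; rewrite nat1r !pnatr_eq0 -lt0n fact_gt0.
have [th [th0 th1 e]] := mean_value sd (dF k (leqnn k)).
exists th; split => //; rewrite -e; congr (_ - _).
  rewrite /F big_ord_recl/= subrr expr0 fact0 big1 ?addr0; first by field.
  by move=> i _; rewrite /= expr0n/= mul0r mulr0.
by apply: eq_bigr => j _; rewrite subr0.
Qed.

End real_taylor.

(** Induction on k along the shifted family: the derivative of the remainder is the remainder of the
    derivative, and the mean value theorem supplies one more factor s. *)
Lemma taylor_peano (R : realType) (k : nat) (d : R) (f : nat -> R -> R) : 0 < d ->
  (forall j, (j < k)%N -> forall u : R, `|u| < d -> is_derive u 1 (f j) (f j.+1 u)) ->
  {for 0, continuous (f k)} ->
  forall eps, 0 < eps -> exists eta, [/\ 0 < eta, eta <= d & forall s, `|s| < eta ->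
    `|f 0 s - \sum_(j < k.+1) f j 0 * (s ^+ j / j`!%:R)| <= eps * `|s| ^+ k].
Proof.
move=> d0; elim: k f => [|k IH] f h c0 eps eps0.
  have /cvgrPdist_le/(_ _ eps0)/nbhs_ballP[eta /= eta0 he] := c0.
  exists (Num.min eta d); split; rewrite ?lt_min ?eta0 ?ge_min ?lexx ?orbT// => s.
  rewrite lt_min => /andP[se _]; rewrite big_ord_recl big_ord0/= !expr0 fact0 addr0 divr1 !mulr1.
  by rewrite distrC; apply: he; rewrite /ball/= sub0r normrN.
have [|eta [eta0 etad he]] := IH (fun j => f j.+1) _ c0 eps eps0.
  by move=> j jk u ud; exact: h.
exists eta; split => // s se.
pose G u := f 0 u - \sum_(j < k.+2) f j 0 * (u ^+ j / j`!%:R).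
pose dG u := f 1 u - \sum_(j < k.+1) f j.+1 0 * (u ^+ j / j`!%:R).
have dsum (K : nat) (u : R) : is_derive u 1 (fun u : R => \sum_(j < K.+1) f j 0 * (u ^+ j / j`!%:R))
    (\sum_(j < K) f j.+1 0 * (u ^+ j / j`!%:R)).
  elim: K => [|K IHK].
    by under eq_fun do rewrite big_ord_recr big_ord0/=; rewrite big_ord0; derive_tac; rewrite fact0; field.
  under eq_fun do rewrite big_ord_recr/=.
  rewrite [X in is_derive _ _ _ X]big_ord_recr/=; derive_tac; rewrite factS natrM.
  by field; rewrite nat1r !pnatr_eq0 -lt0n fact_gt0.
have dGP (u : R) : `|u| < eta -> is_derive u 1 G (dG u).
  move=> ue; have h0 := h 0 (ltn0Sn k) u (lt_le_trans ue etad).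
  have h1 := dsum k.+1 u.
  by rewrite /G; derive_tac.
have [th [th0 th1]] := mean_value se dGP.
have -> : G 0 = 0.
  rewrite /G big_ord_recl/= expr0 fact0 big1 ?addr0; first by field.
  by move=> i _; rewrite /= expr0n/= mul0r mulr0.
rewrite subr0 -/(G s) => ->.
have ths : `|th * s| <= `|s| by rewrite normrM ger0_norm// ler_piMl.
rewrite normrM exprS mulrCA ler_wpM2l// (le_trans (he _ (le_lt_trans ths se)))//.
by rewrite ler_wpM2l ?(ltW eps0)// lerXn2r ?nnegrE.
Qed.

(** * The multiplier near zero *)

Section complex_taylor.
Context {R : realType}.
Implicit Types (f g : R -> R[i]) (p q : {poly R[i]}) (s d : R).

Lemma kdiff_jet d k f j s : kdiff d k f -> (j < k)%N -> `|s| < d ->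
  is_cderive s (cderivn j f) (cderivn j.+1 f s).
Proof. by move=> kf jk sd; apply: cderivableP; exact: kf. Qed.

Lemma Ck_on_kdiff d k f : Ck_on k f [set s | `|s| < d] -> kdiff d k f.
Proof. by move=> [h _] j jk s sd; exact: h. Qed.

(** The point s = 0 is left out so that a factor s can be cancelled from both sides, as in
    [poly_lilo]. *)
Definition lilo (k : nat) f := forall eps, 0 < eps -> exists2 eta, 0 < eta &
  forall s, s != 0 -> `|s| < eta -> nc (f s) <= eps * `|s| ^+ k.

Lemma lilo_add k f g : lilo k f -> lilo k g -> lilo k (fun s => f s + g s).
Proof.
move=> hf hg eps eps0; have e2 : 0 < eps / 2 by rewrite divr_gt0.
have [e1 e10 h1] := hf _ e2; have [e3 e30 h3] := hg _ e2.
exists (Num.min e1 e3); first by rewrite lt_min e10.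
move=> s s0; rewrite lt_min => /andP[/(h1 s s0) a /(h3 s s0) b].
by rewrite (le_trans (ncD _ _))// (splitr eps) mulrDl lerD.
Qed.

Lemma lilo_mulr k f g (M r : R) : 0 < r -> (forall s, `|s| < r -> nc (g s) <= M) ->
  lilo k f -> lilo k (fun s => f s * g s).
Proof.
move=> r0 gM hf eps eps0; have M0 : 0 <= M.
  by rewrite (le_trans (nc_ge0 (g 0)))// gM// normr0.
have M1 : 0 < M + 1 by rewrite ltr_wpDl.
have [e1 e10 h1] := hf _ (divr_gt0 eps0 M1).
exists (Num.min e1 r); first by rewrite lt_min e10.
move=> s s0; rewrite lt_min => /andP[/(h1 s s0) a /gM b].
rewrite ncM (le_trans (ler_pM (nc_ge0 _) (nc_ge0 _) a b))// mulrAC ler_wpM2r ?exprn_ge0//.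
by rewrite mulrAC ler_pdivrMr// ler_wpM2l ?(ltW eps0)// lerDl.
Qed.

Lemma lilo_opp k f : lilo k f -> lilo k (fun s => - f s).
Proof. by move=> h eps /h[eta e0 he]; exists eta => // s s0 /(he s s0); rewrite ncN. Qed.

Lemma eq_lilo k f g : f =1 g -> lilo k f -> lilo k g.
Proof. by move=> fg h eps /h[eta e0 he]; exists eta => // s s0 /(he s s0); rewrite fg. Qed.

Lemma lilo_le l k f : (l <= k)%N -> lilo k f -> lilo l f.
Proof.
move=> lk h eps /[dup] eps0 /h[eta e0 he]; exists (Num.min eta 1); first by rewrite lt_min e0 ltr01.
move=> s s0; rewrite lt_min => /andP[/(he s s0) a s1]; rewrite (le_trans a)//.
by rewrite ler_wpM2l ?(ltW eps0)// ler_wiXn2l// ltW.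
Qed.

Lemma nc_horner_le_expR p (c : R) : 0 < c ->
  exists2 C, 0 < C & forall t : R, nc p.[t%:C%C] <= C * expR (c * t ^+ 2).
Proof.
move=> c0; have [C C0 hC] := @horner_le_expR R (\poly_(i < size p) nc p`_i) c c0.
exists C => // t; have := hC `|t|; rewrite real_normK ?num_real// => h.
rewrite (le_trans _ h)// (le_trans _ (ler_norm _))// horner_poly horner_coef.
rewrite (le_trans (nc_sum _ _ _))// ler_sum// => i _.
by rewrite ncM ncX nc_real.
Qed.

Lemma nc_horner_bounded p (r : R) : exists2 M, 0 < M & forall s, `|s| <= r -> nc p.[s%:C%C] <= M.
Proof.
have [C C0 hC] := nc_horner_le_expR p ltr01.
exists (C * expR (r ^+ 2)) => [|s sr]; first by rewrite mulr_gt0 ?expR_gt0.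
rewrite (le_trans (hC s))// ler_wpM2l ?(ltW C0)// ler_expR mul1r -real_normK ?num_real//.
by rewrite ler_sqr ?nnegrE// (le_trans _ sr).
Qed.

(** The constant coefficient is the limit at 0 and so vanishes; one factor s is cancelled and the
    argument repeats. This is how coefficients of different expansions of one function are
    identified. *)
Lemma poly_lilo p k : lilo k (fun s => p.[s%:C%C]) -> exists q, p = q * 'X^(k.+1).
Proof.
have base p' : lilo 0 (fun s => p'.[s%:C%C]) -> exists q, p' = q * 'X.
  move: p' => {}p hp; have [q Hq] : exists q, p = q * 'X + (p.[0])%:P.
    have /factor_theorem[q Hq] : root (p - (p.[0])%:P) 0 by rewrite rootE hornerD hornerN hornerC subrr.
    by exists q; rewrite -[p in LHS](subrK (p.[0])%:P) Hq subr0.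
  exists q; rewrite {1}Hq.
  suff -> : p.[0] = 0 by rewrite addr0.
  apply: Normc.eq0_normc; apply/eqP; rewrite eq_le nc_ge0 andbT.
  apply/ler_addgt0Pr => e e0; rewrite add0r.
  have [M M0 hM] := nc_horner_bounded q 1.
  have [eta eta0 heta] := hp _ (divr_gt0 e0 (ltr0n R 2)).
  pose s := Num.min (eta / 2) (Num.min 1 (e / (2 * M))).
  have s0 : 0 < s by rewrite !lt_min divr_gt0//= ltr01 divr_gt0// mulr_gt0.
  have seta : `|s| < eta.
    by rewrite gtr0_norm// gt_min ltr_pdivrMr// ltr_pMr// ltr1n.
  have s1 : `|s| <= 1 by rewrite gtr0_norm// !ge_min lexx !orbT.
  have sM : s * M <= e / 2.
    rewrite -ler_pdivlMr// -mulrA -invfM; rewrite /s !ge_min lexx !orbT//.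
  have -> : p.[0] = p.[s%:C%C] - q.[s%:C%C] * s%:C%C by rewrite [X in X.[s%:C%C]]Hq !hornerE addrAC subrr add0r.
  rewrite (le_trans (ncB _ _))// (splitr e) lerD//.
    by have := heta s (lt0r_neq0 s0) seta; rewrite expr0 mulr1.
  rewrite ncM nc_real gtr0_norm// (le_trans _ sM)// mulrC ler_wpM2l ?(ltW s0)//.
  exact: hM.
elim: k p => [|k IH] p hp; first by have [q ->] := base p hp; exists q; rewrite expr1.
have [q Hq] := base p (lilo_le (leq0n _) hp).
have /IH[q' Hq'] : lilo k (fun s => q.[s%:C%C]).
  move=> eps /hp[eta e0 he]; exists eta => // s s0 /(he s s0).
  rewrite Hq hornerM hornerX ncM nc_real exprSr mulrA ler_pM2r ?normr_gt0//.
by exists q'; rewrite Hq Hq' -mulrA -exprSr.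
Qed.

Definition taylor_poly k f : {poly R[i]} := \poly_(j < k.+1) (cderivn j f 0 / j`!%:R).

Lemma horner_taylor_poly k f s :
  (taylor_poly k f).[s%:C%C] = \sum_(j < k.+1) cderivn j f 0 * (s ^+ j / j`!%:R)%:C%C.
Proof.
rewrite horner_poly; apply: eq_bigr => j _.
by rewrite rmorphM rmorphXn fmorphV rmorph_nat mulrAC mulrA.
Qed.

Lemma cRe_sum I (r : seq I) (P : pred I) (F : I -> R[i]) :
  Re (\sum_(i <- r | P i) F i) = \sum_(i <- r | P i) Re (F i).
Proof. by rewrite (big_morph _ (@cReD R) (erefl _)). Qed.

Lemma cIm_sum I (r : seq I) (P : pred I) (F : I -> R[i]) :
  Im (\sum_(i <- r | P i) F i) = \sum_(i <- r | P i) Im (F i).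
Proof. by rewrite (big_morph _ (@cImD R) (erefl _)). Qed.

Lemma Ck_on_peano k f d : 0 < d -> Ck_on k f [set s | `|s| < d] ->
  lilo k (fun s => f s - (taylor_poly k f).[s%:C%C]).
Proof.
move=> d0 hf eps eps0; have kf := Ck_on_kdiff hf; have [_ cf] := hf.
have z0 : `|0 : R| < d by rewrite normr0.
have [cRe cIm] := cf 0 z0; have e2 : 0 < eps / 2 by rewrite divr_gt0.
have hRe j : (j < k)%N -> forall u : R, `|u| < d ->
    is_derive u 1 (fun t : R => Re (cderivn j f t) : R) (Re (cderivn j.+1 f u) : R).
  by move=> jk u ud; case: (kdiff_jet kf jk ud).
have hIm j : (j < k)%N -> forall u : R, `|u| < d ->
    is_derive u 1 (fun t : R => Im (cderivn j f t) : R) (Im (cderivn j.+1 f u) : R).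
  by move=> jk u ud; case: (kdiff_jet kf jk ud).
have [e1 [e10 _ h1]] := taylor_peano d0 hRe cRe e2.
have [e3 [e30 _ h3]] := taylor_peano d0 hIm cIm e2.
exists (Num.min e1 e3); first by rewrite lt_min e10.
move=> s s0; rewrite lt_min => /andP[/h1 a /h3 b].
rewrite (le_trans (nc_le_ReIm _))// horner_taylor_poly cReD cImD cReN cImN cRe_sum cIm_sum.
under eq_bigr do rewrite cReMr.
under [X in _ + `|_ - X|]eq_bigr do rewrite cImMr.
by rewrite (splitr eps) mulrDl lerD.
Qed.

Lemma Ck_on_le l k f d : (l <= k)%N -> Ck_on k f [set s | `|s| < d] -> Ck_on l f [set s | `|s| < d].
Proof.
rewrite leq_eqVlt => /predU1P[->//|lk] [h _]; split=> [j jl|s sd].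
  by apply: h; exact: ltn_trans lk.
by have [h1 h2] := cderivableP (h l lk s sd); split;
  [exact: (is_derive_continuous_at h1)|exact: (is_derive_continuous_at h2)].
Qed.

Lemma Ck_on_cderiv k f d : Ck_on k.+1 f [set s | `|s| < d] -> Ck_on k (cderiv f) [set s | `|s| < d].
Proof.
move=> [h c]; split=> [j jk s sd|s sd].
  by have := h j.+1 jk s sd; rewrite /cderivn iterSr.
by have := c s sd; rewrite /cderivn iterSr.
Qed.

(** Substitute V s ^ 2 in the expansion of the exponential to order k; for |s| <= 1 the resulting
    error in (s ^ 2) ^ k is at most one in |s| ^ k. Dividing eps by V ^ k absorbs the scale. *)
Lemma expR_sqr_peano (V : R) k : 0 < V -> exists p : {poly R[i]},
  lilo k (fun s => (expR (V * s ^+ 2))%:C%C - p.[s%:C%C]).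
Proof.
move=> V0; pose p : {poly R[i]} := \sum_(j < k.+1) ((V ^+ j / j`!%:R)%:C%C)%:P * 'X^(2 * j).
exists p => eps eps0.
have [eta [eta0 _ heta]] := @taylor_peano R k 1 (fun _ => expR) ltr01
  (fun j jk u _ => is_derive_expR u) (@continuous_expR R 0) (eps / V ^+ k) (divr_gt0 eps0 (exprn_gt0 k V0)).
exists (Num.min 1 (eta / V)); first by rewrite lt_min ltr01 divr_gt0.
move=> s s0; rewrite lt_min => /andP[s1 sV].
have sx : `|V * s ^+ 2| < eta.
  rewrite normrM (gtr0_norm V0) -ltr_pdivlMl// mulrC (le_lt_trans _ sV)//.
  by rewrite normrX expr2 ler_piMl// ltW.
have -> : p.[s%:C%C] = (\sum_(j < k.+1) expR 0 * ((V * s ^+ 2) ^+ j / j`!%:R))%:C%C.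
  rewrite /p horner_sum rmorph_sum; apply: eq_bigr => j _.
  rewrite expR0 mul1r hornerM hornerC hornerXn exprMn -exprM.
  by rewrite -rmorphXn -rmorphM; congr (_%:C)%C; ring.
rewrite -rmorphB nc_real (le_trans (heta _ sx))// normrM exprMn (gtr0_norm V0).
rewrite mulrA divfK ?expf_neq0 ?gt_eqF// ler_wpM2l ?(ltW eps0)//.
by rewrite normrX lerXn2r ?nnegrE// expr2 ler_piMl// ltW.
Qed.

End complex_taylor.

Section characteristic_multiplier.
Context {R : realType}.
Variables (lam : R -> R[i]) (V d : R) (m : nat).
Hypotheses (V0 : 0 < V) (d0 : 0 < d) (Clam : Ck_on m.+2 lam [set s | `|s| < d]).
Hypothesis lam_sqr : lilo 2 (fun s => lam s - (1 - V * s ^+ 2 / 2)%:C%C).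

Let e (s : R) : R := expR (V / 2 * s ^+ 2).

Let e_bounded s : `|s| < 1 -> nc (e s)%:C%C <= expR (V / 2).
Proof.
move=> s1; rewrite nc_real ger0_norm ?expR_ge0// ler_expR ler_piMr ?divr_ge0 ?(ltW V0)//.
by rewrite -real_normK ?num_real// expr_le1// ltW.
Qed.

(** The product of the Taylor polynomials of lam and of exp (V s ^ 2 / 2), minus 1, is o(s ^ 2) by
    the second order expansion of lam; being a polynomial, it is then divisible by 'X^3. *)
Lemma multiplier_flat : exists q : {poly R[i]},
  lilo m.+2 (fun s => lam s * (e s)%:C%C - 1 - s%:C%C ^+ 3 * q.[s%:C%C]).
Proof.
pose pl := taylor_poly m.+2 lam.
have hl : lilo m.+2 (fun s => lam s - pl.[s%:C%C]) by exact: Ck_on_peano Clam.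
have [pe he] := @expR_sqr_peano R (V / 2) m.+2 (divr_gt0 V0 (ltr0n R 2)).
have [M M0 hM] := nc_horner_bounded pl 1.
have hg : lilo m.+2 (fun s => lam s * (e s)%:C%C - 1 - (pl * pe - 1).[s%:C%C]).
  apply: (@eq_lilo _ m.+2 (fun s => (lam s - pl.[s%:C%C]) * (e s)%:C%C +
      ((e s)%:C%C - pe.[s%:C%C]) * pl.[s%:C%C])).
    by move=> s; rewrite hornerD hornerN hornerC hornerM; ring.
  apply: lilo_add; first exact: (lilo_mulr ltr01 e_bounded hl).
  by apply: (@lilo_mulr _ _ _ _ M 1 ltr01 _ he) => s /ltW; exact: hM.
have h2 : lilo 2 (fun s => (pl * pe - 1).[s%:C%C]).
  apply: (@eq_lilo _ 2 (fun s => - (lam s * (e s)%:C%C - 1 - (pl * pe - 1).[s%:C%C]) +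
     ((lam s - (1 - V * s ^+ 2 / 2)%:C%C) * (e s)%:C%C +
      (((1 - V * s ^+ 2 / 2) * e s - 1)%:C%C)))).
    by move=> s; rewrite rmorphB rmorphM rmorph1; ring.
  apply: lilo_add; first by apply: lilo_opp; apply: lilo_le hg.
  apply: lilo_add; first exact: (lilo_mulr ltr01 e_bounded lam_sqr).
  move=> eps eps0.
  (* With y = V s ^ 2 / 2 these radii give y <= 1 and y ^ 2 <= eps s ^ 2. The quantity (1 - y) e ^ y
     - 1 lies between - y ^ 2 and 0, because e ^ y >= 1 + y and 1 - y <= e ^ (- y). *)
  exists (Num.min 1 (Num.min (2 / V) (4 * eps / V ^+ 2))).
    by rewrite !lt_min ltr01 !divr_gt0 ?mulr_gt0 ?exprn_gt0.
  move=> s _; rewrite !lt_min => /andP[s1 /andP[sV se]].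
  have ss : `|s| ^+ 2 <= `|s| by rewrite expr2 ler_piMl// ltW.
  pose y := V / 2 * s ^+ 2; rewrite (_ : V * s ^+ 2 / 2 = y); last by rewrite /y; field.
  rewrite nc_real.
  have y0 : 0 <= y by rewrite mulr_ge0 ?sqr_ge0// divr_ge0// ltW.
  have y1 : y <= 1.
    rewrite /y -[s ^+ 2]real_normK ?num_real// -ler_pdivlMl ?divr_gt0// mulr1 invf_div.
    by rewrite (le_trans ss)// ltW.
  have y2 : y ^+ 2 <= eps * `|s| ^+ 2.
    rewrite (_ : y ^+ 2 = V ^+ 2 / 4 * `|s| ^+ 2 * `|s| ^+ 2); last first.
      by rewrite /y -[s ^+ 2]real_normK ?num_real//; field.
    have : `|s| ^+ 2 <= 4 * eps / V ^+ 2 by rewrite (le_trans ss)// ltW.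
    rewrite ler_pdivlMr ?exprn_gt0// => h.
    by rewrite ler_wpM2r ?exprn_ge0//; lra.
  apply: le_trans y2; rewrite ler_norml; apply/andP; split.
    have : (1 - y) * (1 + y) <= (1 - y) * e s.
      by rewrite ler_wpM2l ?subr_ge0// /e -/y expR_ge1Dx.
    lra.
  have : (1 - y) * e s <= expR (- y) * e s.
    by rewrite ler_wpM2r ?expR_ge0//; exact: expR_ge1Dx.
  rewrite /e -/y -expRD addNr expR0; have := sqr_ge0 y; lra.
have [q Hq] := poly_lilo h2; exists q.
by apply: eq_lilo hg => s; rewrite Hq hornerM hornerXn; congr (_ - _); rewrite mulrC.
Qed.

(** Two quadratic polynomials approximating lam up to o(s ^ 2) differ by a multiple of 'X^3, so
    their coefficients agree. *)
Lemma multiplier_jet : [/\ lam 0 = 1, cderivn 1 lam 0 = 0 & cderivn 2 lam 0 = - V%:C%C].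
Proof.
have h2 := Ck_on_peano d0 (@Ck_on_le R 2 m.+2 lam d isT Clam).
pose p := taylor_poly 2 lam - (1 - (V / 2)%:C%C *: 'X^2).
have [q Hq] : exists q, p = q * 'X^3.
  apply: poly_lilo; apply: (@eq_lilo _ 2 (fun s => - (lam s - (taylor_poly 2 lam).[s%:C%C]) +
    (lam s - (1 - V * s ^+ 2 / 2)%:C%C))).
    move=> s; rewrite /p hornerD hornerN hornerD hornerN hornerC hornerZ hornerXn.
    by rewrite rmorphB rmorph1 mulrAC rmorphM rmorphXn; ring.
  by apply: lilo_add => //; exact: lilo_opp.
have c j : (j < 3)%N -> (taylor_poly 2 lam)`_j = (1 - (V / 2)%:C%C *: 'X^2 : {poly R[i]})`_j.
  by move=> j3; apply/eqP; rewrite -subr_eq0 -coefB -/p Hq coefMXn j3.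
split.
- have := c 0 isT; rewrite coef_poly coefB coefC coefZ coefXn /= fact0 divr1 mulr0 subr0; exact.
- have := c 1 isT; rewrite coef_poly coefB coefC coefZ coefXn /= divr1 mulr0 subr0; exact.
- have := c 2 isT; rewrite coef_poly coefB coefC coefZ coefXn /= mulr1 sub0r => h.
  have n2 : (2`!%:R : R[i]) != 0 by rewrite pnatr_eq0.
  apply: (mulIf (invr_neq0 n2)); rewrite h rmorphM fmorphV rmorph_nat.
  by rewrite (_ : 2`! = 2) ?mulNr.
Qed.

Let lam_cderive s : `|s| < d -> is_cderive s lam (cderiv lam s).
Proof. by move=> sd; exact: (@kdiff_jet R d m.+2 lam 0 s (Ck_on_kdiff Clam) isT sd). Qed.

Let N (s : R) : R := Re (lam s) ^+ 2 + Im (lam s) ^+ 2.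

(** The leading term of N' s is - 2 V s ^ 2, and half of it is given up to cover the errors. *)
Lemma multiplier_decreasing : exists2 d1, 0 < d1 <= d & forall s : R, `|s| < d1 ->
  exists2 dN : R, is_derive s 1 N dN & dN * s <= - V * s ^+ 2.
Proof.
have [l0 l1 l2] := multiplier_jet.
have h1 := Ck_on_peano d0 (Ck_on_cderiv (@Ck_on_le R 2 m.+2 lam d isT Clam)).
have e0 : 0 < Num.min 4^-1 (V / 6) by rewrite lt_min divr_gt0// invr_gt0 ltr0n.
(* The errors add up to at most 2 (V / 4 + 3 eps / 2) s ^ 2; with eps <= V / 6 this is V s ^ 2,
   exactly the half of 2 V s ^ 2 that may be lost. *)
pose eps := Num.min 4^-1 (V / 6).
have eps4 : eps <= 4^-1 by rewrite ge_min lexx.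
have epsV : eps <= V / 6 by rewrite ge_min lexx orbT.
have [r1 r10 hr1] := h1 _ e0; have [r2 r20 hr2] := lam_sqr e0.
rewrite -/eps in e0 hr1 hr2.
pose d1 := Num.min (Num.min d 1) (Num.min (eps / (V + eps)) (Num.min r1 r2)).
exists d1; first by rewrite !lt_min d0 ltr01 r10 r20 divr_gt0 ?addr_gt0//= !ge_min lexx.
move=> s; rewrite !lt_min => /andP[/andP[sd s1] /andP[sV /andP[sr1 sr2]]].
have [f1 f2] := lam_cderive sd.
have dN := pder_add (pder_expn 2 f1) (pder_expn 2 f2).
eexists; first exact: dN.
have [->|s0] := eqVneq s 0; first by rewrite mulr0 expr0n/= mulr0.
have tE : (taylor_poly 1 (cderiv lam)).[s%:C%C] = (- (V * s))%:C%C.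
  rewrite horner_taylor_poly !big_ord_recr big_ord0/= add0r /cderivn/=.
  rewrite /cderivn/= in l1 l2; rewrite l1 l2 mul0r add0r expr1 divr1.
  by rewrite rmorphN rmorphM mulNr.
have a := hr1 s s0 sr1; have b := hr2 s s0 sr2; rewrite tE expr1 in a.
have s2 : `|s| ^+ 2 = s ^+ 2 by rewrite real_normK ?num_real.
have s20 : 0 < s ^+ 2 by rewrite exprn_even_gt0.
have ss : s ^+ 2 <= `|s| by rewrite -s2 expr2 ler_piMl// ltW.
have sVe : (V + eps) * s ^+ 2 <= eps.
  by rewrite mulrC -ler_pdivlMr ?addr_gt0// (le_trans ss)// ltW.
have ar : `|Re (cderiv lam s) + V * s| <= eps * `|s|.
  by have := le_trans (Re_le_nc _) a; rewrite cReD cReN /= opprK.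
have ai : `|Im (cderiv lam s)| <= eps * `|s|.
  by have := le_trans (Im_le_nc _) a; rewrite cImD cImN /= oppr0 addr0.
have br : `|Re (lam s) - (1 - V * s ^+ 2 / 2)| <= eps * s ^+ 2.
  by have := le_trans (Re_le_nc _) b; rewrite cReD cReN /= s2.
have bi : `|Im (lam s)| <= eps * s ^+ 2.
  by have := le_trans (Im_le_nc _) b; rewrite cImD cImN /= oppr0 addr0 s2.
have es : eps * s ^+ 2 <= eps by rewrite ler_piMr ?(ltW e0)// (le_trans ss)// ltW.
have Vs : V * s ^+ 2 <= eps by apply: le_trans sVe; rewrite ler_wpM2r ?(ltW s20)// lerDl ltW.
have Vs0 : 0 < V * s ^+ 2 by rewrite mulr_gt0.
have es0 : 0 < eps * s ^+ 2 by rewrite mulr_gt0.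
have rs : `|Re (cderiv lam s) * s + V * s ^+ 2| <= eps * s ^+ 2.
  rewrite (_ : _ + _ = (Re (cderiv lam s) + V * s) * s); last by ring.
  by rewrite normrM -s2 expr2 mulrA ler_wpM2r.
have is_ : `|Im (cderiv lam s) * s| <= eps * s ^+ 2.
  by rewrite normrM -s2 expr2 mulrA ler_wpM2r.
have prod1 : `|(Re (lam s) - 1) * (Re (cderiv lam s) * s)| <= eps * ((V + eps) * s ^+ 2).
  rewrite normrM; apply: ler_pM => //.
    move: br; rewrite !ler_norml => /andP[? ?]; apply/andP; split; lra.
  move: rs; rewrite !ler_norml => /andP[? ?]; apply/andP; split; lra.
have prod2 : `|Im (lam s) * (Im (cderiv lam s) * s)| <= eps * (eps * s ^+ 2).
  by rewrite normrM; apply: ler_pM => //; exact: le_trans bi es.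
have q1 : eps * ((V + eps) * s ^+ 2) <= 4^-1 * ((V + eps) * s ^+ 2).
  by rewrite ler_wpM2r// mulr_ge0 ?addr_ge0 ?(ltW s20) ?(ltW V0) ?(ltW e0).
have q2 : eps * (eps * s ^+ 2) <= 4^-1 * (eps * s ^+ 2) by rewrite ler_wpM2r// ltW.
have q3 : eps * s ^+ 2 <= V / 6 * s ^+ 2 by rewrite ler_wpM2r// ltW.
rewrite -[2.-1]/(1%N) !expr1 mulNr.
rewrite (_ : _ * s = 2 * (Re (cderiv lam s) * s + (Re (lam s) - 1) * (Re (cderiv lam s) * s) +
  Im (lam s) * (Im (cderiv lam s) * s))); last by ring.
move: rs prod1 prod2; rewrite !ler_norml => /andP[? ?] /andP[? ?] /andP[? ?].
lra.
Qed.

(* [|lam|^2 + V s^2 / 2] is nonincreasing in [|s|]. *)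
Lemma multiplier_ratio : exists2 d1, 0 < d1 <= d & forall s th : R, `|s| < d1 ->
  0 <= th -> th <= 1 ->
  nc (lam s) <= nc (lam (th * s)) * expR (- (V / 4) * (s ^+ 2 * (1 - th))).
Proof.
have [d1 /andP[d10 d1d] hN] := multiplier_decreasing.
have [l0 _ _] := multiplier_jet.
exists d1; first by rewrite d10.
have Nle s th : `|s| < d1 -> 0 <= th -> th <= 1 ->
    N s + V / 2 * s ^+ 2 <= N (th * s) + V / 2 * (th * s) ^+ 2.
  move=> sd th0 th1; pose F u := N (u * s) + V / 2 * (u * s) ^+ 2.
  have usd u : 0 <= u -> u <= 1 -> `|u * s| < d1.
    move=> u0 u1; apply: le_lt_trans sd.
    by rewrite normrM ger0_norm// ler_piMl.
  (* The derivative of [N] is known only pointwise through an existence statement; [xget] turns it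
     into a function, whose default 0 is never reached for u in [0, 1]. *)
  pose dN u := xget 0 [set x : R | is_derive (u * s) 1 N x /\ x * (u * s) <= - V * (u * s) ^+ 2].
  have dNP u : 0 <= u -> u <= 1 -> is_derive (u * s) 1 N (dN u) /\ dN u * (u * s) <= - V * (u * s) ^+ 2.
    move=> u0 u1; have [x h1 h2] := hN _ (usd u u0 u1).
    by have := @xgetPex _ 0 [set x : R | is_derive (u * s) 1 N x /\ x * (u * s) <= - V * (u * s) ^+ 2]; apply; exists x.
  have dF (u : R) : 0 <= u -> u <= 1 -> is_derive u 1 F (dN u * s + V * u * s ^+ 2).
    move=> u0 u1; have [h1 _] := dNP u u0 u1.
    have h2 : is_derive u 1 (fun u : R => N (u * s)) (dN u * s).
      have := @pder_comp R N (fun u => u * s) u _ _ h1 (pder_mul (pder_id u) (pder_cst s u)).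
      by rewrite mulr0 add0r mulr1.
    by rewrite /F; derive_tac; field.
  have uin (u : R) : u \in `]th, 1[ -> [/\ 0 <= u, u <= 1 & 0 < u].
    by rewrite in_itv/= => /andP[a b]; split; lra.
  have cF : {within `[th, 1], continuous F}.
    apply: derivable_within_continuous => u; rewrite in_itv/= => /andP[a b].
    by have [] := dF u (le_trans th0 a) b.
  move: th1; rewrite le_eqVlt => /predU1P[->|th1]; first by rewrite mul1r.
  have dFin (u : R) : u \in `]th, 1[ -> is_derive u 1 F (dN u * s + V * u * s ^+ 2).
    by move=> /uin[a b _]; exact: dF.
  have [c /uin[c0 c1 cgt0] h] := MVT th1 dFin cF.
  rewrite -subr_le0; move: h; rewrite /F mul1r => ->.
  rewrite mulr_le0_ge0 ?subr_ge0 ?(ltW th1)// -(pmulr_rle0 _ cgt0).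
  have [_ h2] := dNP c c0 c1.
  rewrite (_ : c * _ = dN c * (c * s) + V * (c * s) ^+ 2); last by ring.
  by move: h2; rewrite mulNr; lra.
have N1 s : `|s| < d1 -> N s <= 1.
  move=> sd; have := Nle s 0 sd (lexx 0) ler01.
  rewrite mul0r /N l0 /= expr1n !expr0n/= mulr0 !addr0.
  have : 0 <= V / 2 * s ^+ 2 by rewrite mulr_ge0 ?sqr_ge0// divr_ge0// ltW.
  lra.
move=> s th sd th0 th1.
have ths : `|th * s| < d1 by apply: le_lt_trans sd; rewrite normrM ger0_norm// ler_piMl.
rewrite -ler_sqr ?nnegrE ?nc_ge0 ?mulr_ge0 ?expR_ge0 ?nc_ge0//.
rewrite exprMn !nc_sqr -/(N s) -/(N (th * s)) -expRM_natr.
have N0 : 0 <= N (th * s) by rewrite addr_ge0 ?sqr_ge0.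
pose w := V / 2 * (s ^+ 2 * (1 - th)).
have w0 : 0 <= w.
  apply: mulr_ge0; first by rewrite divr_ge0// ltW.
  by apply: mulr_ge0; rewrite ?sqr_ge0 ?subr_ge0.
rewrite (_ : - (V / 4) * _ * 2 = - w); last by rewrite /w; field.
(* Monotonicity gives N s <= N (th s) - w, using th ^ 2 <= th, and N (th s) <= 1 replaces w by N (th
   s) w. The square root then halves V / 2 to V / 4 in the exponent. *)
apply: (@le_trans _ _ (N (th * s) * (1 - w))); last first.
  by rewrite ler_wpM2l//; exact: expR_ge1Dx.
have h1 := Nle s th sd th0 th1; have h2 := N1 _ ths.
have h3 : N (th * s) * w <= w by rewrite ler_piMl.
have h4 : w <= V / 2 * s ^+ 2 - V / 2 * (th * s) ^+ 2.
  rewrite /w exprMn -subr_ge0.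
  rewrite (_ : _ - _ = V / 2 * s ^+ 2 * (th * (1 - th))); last by ring.
  apply: mulr_ge0; last by apply: mulr_ge0; rewrite ?subr_ge0.
  by apply: mulr_ge0; rewrite ?sqr_ge0 ?divr_ge0 ?(ltW V0).
lra.
Qed.

End characteristic_multiplier.

(** * Expansion of the characteristic function near zero *)

Section powers.
Context {R : realType}.
Implicit Types x y g h : R[i].

Lemma nc_subXX x y (A : R) n : 1 <= A -> nc x <= A -> nc y <= A ->
  nc (x ^+ n - y ^+ n) <= n%:R * nc (x - y) * A ^+ n.
Proof.
move=> A1 xA yA; elim: n => [|n IH]; first by rewrite !expr0 subrr nc0 !mul0r.
have A0 : 0 <= A by rewrite (le_trans _ A1).
rewrite (_ : x ^+ n.+1 - y ^+ n.+1 = x * (x ^+ n - y ^+ n) + (x - y) * y ^+ n); last first.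
  by rewrite 2!(exprS _ n); ring.
apply: (le_trans (ncD _ _)); rewrite !ncM ncX.
have h1 : nc x * nc (x ^+ n - y ^+ n) <= A * (n%:R * nc (x - y) * A ^+ n).
  by apply: ler_pM => //; exact: nc_ge0.
have h2 : nc (x - y) * nc y ^+ n <= nc (x - y) * (A * A ^+ n).
  apply: ler_wpM2l; first exact: nc_ge0.
  apply: (@le_trans _ _ (A ^+ n)); first by apply: lerXn2r => //; rewrite nnegrE ?nc_ge0.
  by apply: ler_peMl => //; exact: exprn_ge0.
apply: (le_trans (lerD h1 h2)); rewrite (exprS A n) -(natr1 n); lra.
Qed.

Lemma nc_onePX h (c : R) n : nc h <= c -> nc (1 + h) ^+ n <= expR (n%:R * c).
Proof.
move=> hc; rewrite expRM_natl; apply: lerXn2r; rewrite ?nnegrE ?nc_ge0 ?expR_ge0//.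
by apply: (le_trans (ncD _ _)); rewrite nc1; apply: le_trans (expR_ge1Dx _); rewrite lerD2l.
Qed.

(** Pascal's rule gives D (n + 1, k + 1) = D (n, k + 1) + h D (n, k) for the remainders, and the
    bound follows by induction on n. *)
Lemma binomial_remainder h n k :
  nc ((1 + h) ^+ n - \sum_(i < k) 'C(n, i)%:R * h ^+ i) <=
  (n%:R * nc h) ^+ k * expR (n%:R * nc h).
Proof.
elim: n k => [|n IH] [|k].
- by rewrite big_ord0 subr0 !expr0 !mul0r expR0 nc1 mulr1.
- rewrite big_ord_recl expr0 bin0 mulr1 big1 ?addr0 ?subrr ?nc0 ?mul0r ?expR0 ?expr0n//= ?mul0r//.
  by move=> i _; rewrite bin0n mul0r.
- by rewrite big_ord0 subr0 expr0 mul1r ncX nc_onePX.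
pose D j := (1 + h) ^+ n - \sum_(i < j) 'C(n, i)%:R * h ^+ i.
rewrite (_ : _ - _ = D k.+1 + h * D k); last first.
  rewrite /D (exprS _ n) (_ : \sum_(i < k.+1) 'C(n.+1, i)%:R * h ^+ i =
    \sum_(i < k.+1) 'C(n, i)%:R * h ^+ i + h * \sum_(i < k) 'C(n, i)%:R * h ^+ i); first by ring.
  rewrite !big_ord_recl !bin0 -addrA; congr (_ + _).
  rewrite mulr_sumr -big_split; apply: eq_bigr => i _ /=.
  by rewrite binS natrD mulrDl [in RHS]mulrCA -exprS.
apply: (le_trans (ncD _ _)); rewrite ncM.
set x := nc h; have x0 : 0 <= x by exact: nc_ge0.
have nx : 0 <= n%:R * x by rewrite mulr_ge0.
have h2 : x * nc (D k) <= x * ((n%:R * x) ^+ k * expR (n%:R * x)) by apply: ler_wpM2l => //; exact: IH.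
apply: (le_trans (lerD (IH k.+1) h2)).
have -> : (n%:R * x) ^+ k.+1 * expR (n%:R * x) + x * ((n%:R * x) ^+ k * expR (n%:R * x)) =
  (n%:R * x) ^+ k * (n.+1%:R * x) * expR (n%:R * x).
  by rewrite (exprSr _ k) -natr1; ring.
rewrite (exprSr (n.+1%:R * x)); apply: ler_pM; rewrite ?expR_ge0//.
- by rewrite !mulr_ge0 ?exprn_ge0.
- apply: ler_wpM2r; first by rewrite mulr_ge0.
  by apply: lerXn2r; rewrite ?nnegrE ?mulr_ge0// ler_wpM2r// ler_nat.
- by rewrite ler_expR ler_wpM2r// ler_nat.
Qed.

End powers.

Section multiplier_power.
Context {R : realType}.
Variables (lam : R -> R[i]) (V d : R) (m : nat) (q : {poly R[i]}).
Hypotheses (V0 : 0 < V) (d0 : 0 < d).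

Let h (s : R) : R[i] := s%:C%C ^+ 3 * q.[s%:C%C].

Hypothesis flat : lilo m.+2 (fun s => lam s * (expR (V / 2 * s ^+ 2))%:C%C - 1 - h s).

(** Write lam s = e ^ (- V s ^ 2 / 2) (1 + g). Replacing g by [h s] costs the first error term,
    truncating the binomial series the second. Both 1 + g and 1 + h are at most e ^ (V s ^ 2 / 4) in
    modulus, so half of the Gaussian survives. *)
Lemma multiplier_power : exists2 C : R, 0 < C & forall eta, 0 < eta ->
  exists2 dl, 0 < dl & forall (n : nat) (s : R), s != 0 -> `|s| < dl ->
  nc (lam s ^+ n - (\sum_(i < m.+1) 'C(n, i)%:R * h s ^+ i) *
      (expR (- (V / 2) * (n%:R * s ^+ 2)))%:C%C) <=
  (eta * (n%:R * `|s| ^+ m.+2) + C * (n%:R * `|s| ^+ 3) ^+ m.+1) *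
  expR (- (V / 4) * (n%:R * s ^+ 2)).
Proof.
have [M M0 hM] := nc_horner_bounded q 1.
exists (M ^+ m.+1); first exact: exprn_gt0.
move=> eta eta0; have [e1 e10 he1] := flat eta0.
(* The quadratic bound is shared equally: V / 8 for g - h and V / 8 for h, hence V / 4 for g. *)
have [e2 e20 he2] := @lilo_le _ 2 m.+2 _ isT flat (V / 8) (divr_gt0 V0 (ltr0n R 8)).
exists (Num.min 1 (Num.min (V / 8 / M) (Num.min e1 e2))).
  by rewrite !lt_min ltr01 e10 e20 !divr_gt0.
move=> n s s0; rewrite !lt_min => /andP[s1 /andP[sM /andP[se1 se2]]].
pose e := (expR (V / 2 * s ^+ 2))%:C%C : R[i].
pose g := lam s * e - 1.
have hgh : nc (g - h s) <= eta * `|s| ^+ m.+2 by exact: he1.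
have s2 : s ^+ 2 = `|s| ^+ 2 by rewrite real_normK ?num_real.
have hh : nc (h s) <= M * `|s| ^+ 3.
  by rewrite ncM ncX nc_real mulrC ler_wpM2r ?exprn_ge0// hM// ltW.
have hV : nc (h s) <= V / 8 * s ^+ 2.
  apply: (le_trans hh); rewrite s2 (exprSr `|s| 2) mulrCA mulrC.
  by apply: ler_wpM2r; rewrite ?exprn_ge0// mulrC -ler_pdivlMr// ltW.
have gV : nc g <= V / 4 * s ^+ 2.
  rewrite -(subrK (h s) g); apply: (le_trans (ncD _ _)).
  have := he2 _ s0 se2; rewrite -/e -/g -s2; lra.
have hV' : nc (h s) <= V / 4 * s ^+ 2 by have := mulr_ge0 (ltW V0) (sqr_ge0 s); lra.
pose E := expR (- (V / 2) * (n%:R * s ^+ 2)).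
have lamE : lam s ^+ n = (1 + g) ^+ n * E%:C%C.
  have -> : E = expR (- (V / 2 * s ^+ 2)) ^+ n by rewrite -expRM_natl /E; congr expR; ring.
  have -> : (expR (- (V / 2 * s ^+ 2)) ^+ n)%:C%C = (expR (- (V / 2 * s ^+ 2)))%:C%C ^+ n :> R[i].
    by rewrite rmorphXn.
  rewrite -exprMn; congr (_ ^+ _).
  have ee : e * (expR (- (V / 2 * s ^+ 2)))%:C%C = 1.
    have -> : e * (expR (- (V / 2 * s ^+ 2)))%:C%C = (expR (V / 2 * s ^+ 2) * expR (- (V / 2 * s ^+ 2)))%:C%C.
      by rewrite rmorphM.
    by rewrite -expRD addrN expR0.
  by rewrite /g -[LHS]mulr1 -ee; ring.
rewrite lamE -mulrBl ncM nc_real ger0_norm ?expR_ge0//.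
have EE : E = expR (- (n%:R * (V / 4 * s ^+ 2))) * expR (- (V / 4) * (n%:R * s ^+ 2)).
  by rewrite -expRD /E; congr expR; field.
rewrite EE (mulrA (nc _)); apply: ler_wpM2r; first exact: expR_ge0.
rewrite expRN ler_pdivrMr ?expR_gt0//.
set b := \sum_(i < m.+1) _.
rewrite (_ : (1 + g) ^+ n - b = ((1 + g) ^+ n - (1 + h s) ^+ n) + ((1 + h s) ^+ n - b)); last by ring.
apply: (le_trans (ncD _ _)); rewrite mulrDl; apply: lerD.
  have A1 : 1 <= expR (V / 4 * s ^+ 2) by rewrite -expR0 ler_expR mulr_ge0 ?sqr_ge0 ?divr_ge0// ltW.
  have lexp x : nc x <= V / 4 * s ^+ 2 -> nc (1 + x) <= expR (V / 4 * s ^+ 2).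
    by move=> hx; have := nc_onePX 1 hx; rewrite expr1 mul1r.
  have := nc_subXX n A1 (lexp _ gV) (lexp _ hV').
  rewrite expRM_natl => /le_trans; apply.
  rewrite (_ : 1 + g - (1 + h s) = g - h s); last by ring.
  apply: ler_wpM2r; first by rewrite exprn_ge0 ?expR_ge0.
  by rewrite [leRHS]mulrCA ler_wpM2l.
apply: (le_trans (binomial_remainder _ _ _)); apply: ler_pM; rewrite ?expR_ge0 ?exprn_ge0 ?mulr_ge0 ?nc_ge0//.
  rewrite -exprMn; apply: lerXn2r; rewrite ?nnegrE ?mulr_ge0 ?nc_ge0 ?exprn_ge0 ?(ltW M0)//.
  by rewrite mulrCA ler_wpM2l.
by rewrite ler_expR ler_wpM2l.
Qed.

End multiplier_power.

Section normalized_taylor.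
Context {R : realType}.
Variables (lam H : R -> R[i]) (V d d1 C M : R) (k n : nat).
Hypotheses (n0 : (0 < n)%N) (kH : kdiff d k.+1 H) (d1d : d1 <= d) (V0 : 0 < V).
Hypothesis ratio : forall s th : R, `|s| < d1 -> 0 <= th -> th <= 1 ->
  nc (lam s) <= nc (lam (th * s)) * expR (- (V / 4) * (s ^+ 2 * (1 - th))).
Hypothesis hC : forall z : R, `|z| ^+ k <= C * expR (V / 4 * z ^+ 2).
Hypothesis hM : forall s, `|s| < d -> nc (lam s ^+ n * cderivn k.+1 H s) <= M.

(** Stated for a real [a], since it is applied to the real and to the imaginary part of the top
    derivative, each with its own intermediate point. *)
Let remainder_bound (s th a : R) : `|s| < d1 -> 0 <= th -> th <= 1 ->
  `|a| <= nc (cderivn k.+1 H (th * s)) ->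
  nc (lam s) ^+ n * `|s * (a * ((s - th * s) ^+ k / k`!%:R))| <=
  `|s| * M * (C * (Num.sqrt n%:R) ^- k).
Proof.
move=> sd th0 th1 ha.
have M0 : 0 <= M.
  by apply: le_trans (hM (_ : `|0| < d)); rewrite ?nc_ge0// normr0 (le_lt_trans _ (lt_le_trans sd d1d)).
have tsd : `|th * s| < d.
  by rewrite normrM (ger0_norm th0) (le_lt_trans _ (lt_le_trans sd d1d))// ler_piMl.
pose y := 1 - th; have y0 : 0 <= y by rewrite subr_ge0.
have y1 : y <= 1 by rewrite /y; lra.
pose sn := Num.sqrt (n%:R : R).
have sn0 : 0 < sn by rewrite sqrtr_gt0 ltr0n.
have sn2 : sn ^+ 2 = n%:R by rewrite sqr_sqrtr.
pose L := nc (lam (th * s)) ^+ n.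
pose E := expR (- (V / 4) * (s ^+ 2 * y)) ^+ n.
have hl : nc (lam s) ^+ n <= L * E.
  rewrite -exprMn; apply: lerXn2r; rewrite ?nnegrE ?mulr_ge0 ?nc_ge0 ?expR_ge0//; exact: ratio.
have hLa : L * `|a| <= M.
  apply: le_trans (hM tsd); rewrite ncM ncX; apply: ler_wpM2l => //; exact/exprn_ge0/nc_ge0.
have f0 : (0 : R) < k`!%:R by rewrite ltr0n fact_gt0.
have -> : `|s * (a * ((s - th * s) ^+ k / k`!%:R))| = `|s| * `|a| * ((`|s| * y) ^+ k / k`!%:R).
  rewrite !normrM normfV normrX (ger0_norm (ltW f0)) (_ : s - th * s = s * y) ?normrM ?(ger0_norm y0)//; last by rewrite /y; ring.
  by rewrite !mulrA.
have hf : (`|s| * y) ^+ k / k`!%:R <= (`|s| * y) ^+ k.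
  by rewrite ler_pdivrMr// ler_peMr ?exprn_ge0 ?mulr_ge0// ler1n fact_gt0.
(* The exponential is linear in y = 1 - th, while absorbing the power of |s| y sqrt n calls for y ^
   2; since 0 <= y <= 1, y ^ 2 <= y. *)
have hw : E * (`|s| * y) ^+ k <= C * sn ^- k.
  rewrite -ler_pdivrMr ?invr_gt0 ?exprn_gt0// invrK -mulrA -exprMn.
  have w2 : (`|s| * y * sn) ^+ 2 = n%:R * (s ^+ 2 * (y * y)).
    by rewrite !exprMn sn2 real_normK ?num_real//; ring.
  have := hC (`|s| * y * sn); rewrite w2 ger0_norm ?mulr_ge0 ?(ltW sn0)// => h.
  have EE : E = (expR (V / 4 * (n%:R * (s ^+ 2 * y))))^-1.
    by rewrite /E -expRN -expRM_natl; congr expR; ring.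
  rewrite EE mulrC ler_pdivrMr ?expR_gt0//; apply: (le_trans h).
  have C0 : 0 <= C.
    have := hC 0; rewrite expr0n mulr0 expR0 mulr1 => h0; apply: le_trans h0.
    by rewrite exprn_ge0.
  apply: ler_wpM2l => //; rewrite ler_expR.
  apply: ler_wpM2l; first by rewrite divr_ge0 ?(ltW V0).
  by apply: ler_wpM2l => //; apply: ler_wpM2l; rewrite ?sqr_ge0// ler_piMr.
have s0 := normr_ge0 s; have a0 := normr_ge0 a.
have L0 : 0 <= L by exact/exprn_ge0/nc_ge0.
have E0 : 0 <= E by exact/exprn_ge0/expR_ge0.
have w0 : 0 <= (`|s| * y) ^+ k by rewrite exprn_ge0 ?mulr_ge0.
apply: (@le_trans _ _ (L * E * (`|s| * `|a| * (`|s| * y) ^+ k))).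
  apply: ler_pM => //; first exact/exprn_ge0/nc_ge0.
    by apply: mulr_ge0; [exact: mulr_ge0|rewrite divr_ge0 // ltW].
  by apply: ler_wpM2l => //; exact: mulr_ge0.
have -> : L * E * (`|s| * `|a| * (`|s| * y) ^+ k) = `|s| * (L * `|a|) * (E * (`|s| * y) ^+ k) by ring.
apply: ler_pM => //; [exact: mulr_ge0 (mulr_ge0 _ _)|exact: mulr_ge0|exact: ler_wpM2l].
Qed.

(** The factor 2 comes from applying Cauchy's form separately to the real and imaginary parts. *)
Lemma normalized_taylor s : `|s| < d1 ->
  nc (lam s ^+ n * (H s - \sum_(j < k.+1) cderivn j H 0 * (s ^+ j / j`!%:R)%:C%C)) <=
  2 * (`|s| * M * (C * (Num.sqrt n%:R) ^- k)).
Proof.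
move=> sd; have sd' := lt_le_trans sd d1d.
have [th1 [a0 a1 e1]] := @taylor_cauchy R d (fun j s => Re (cderivn j H s)) k s sd'
  (fun j jk u ud => (kdiff_jet kH jk ud).1).
have [th2 [b0 b1 e2]] := @taylor_cauchy R d (fun j s => Im (cderivn j H s)) k s sd'
  (fun j jk u ud => (kdiff_jet kH jk ud).2).
rewrite ncM ncX mulr2n mulrDl mul1r.
set z := H s - _.
have re : Re z = s * (Re (cderivn k.+1 H (th1 * s)) * ((s - th1 * s) ^+ k / k`!%:R)).
  rewrite -e1 /z cReD cReN cRe_sum; congr (_ - _).
  by apply: eq_bigr => j _; rewrite cReMr.
have im : Im z = s * (Im (cderivn k.+1 H (th2 * s)) * ((s - th2 * s) ^+ k / k`!%:R)).
  rewrite -e2 /z cImD cImN cIm_sum; congr (_ - _).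
  by apply: eq_bigr => j _; rewrite cImMr.
apply: (@le_trans _ _ (nc (lam s) ^+ n * (`|Re z| + `|Im z|))).
  by apply: ler_wpM2l; [exact/exprn_ge0/nc_ge0|exact: nc_le_ReIm].
rewrite mulrDr; apply: lerD; rewrite ?re ?im; apply: remainder_bound => //.
- exact: Re_le_nc.
- exact: Im_le_nc.
Qed.

End normalized_taylor.

Section bivariate_expansion.
Variable F : numFieldType.
Implicit Types (p q b : {poly F}) (x t : F).

(** Two-variable polynomials are elements of [{poly {poly F}}]: the outer variable stands for
    [n ^ (-1/2)], the inner one for the frequency. *)
Definition product_substitution p : {poly {poly F}} := \poly_(j < size p) (p`_j *: 'X^j).

Lemma horner_product_substitution p x t : (product_substitution p).[x%:P].[t] = p.[x * t].
Proof.
rewrite /product_substitution horner_poly horner_sum horner_coef; apply: eq_bigr => j _.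
by rewrite -rmorphXn hornerM hornerC hornerZ hornerXn exprMn; ring.
Qed.

Lemma natr_ffact n k : (n ^_ k)%:R = \prod_(i < k) (n%:R - i%:R) :> F.
Proof.
elim: k => [|k IH]; first by rewrite big_ord0 ffactn0.
rewrite ffactnSr natrM IH big_ord_recr /=.
have [kn|nk] := leqP k n; first by rewrite natrB.
by rewrite -IH ffact_small// !mul0r.
Qed.

Lemma edgeworth_expansion m q b : b`_0 = 1 -> exists A : {poly {poly F}},
  [/\ A`_0 = 1, forall l, (0 < l)%N -> (A`_l).[0] = 0 &
  forall n x t, n%:R * x ^+ 2 = 1 ->
  (\sum_(i < m.+1) 'C(n, i)%:R * ((x * t) ^+ 3 * q.[x * t]) ^+ i) * b.[x * t] = A.[x%:P].[t]].
Proof.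
move=> b0; pose h := 'X * ('X^3)%:P * product_substitution q : {poly {poly F}}.
pose c k := (\prod_(i < k) (1 - i%:R *: 'X^2)) * ((k`!%:R)^-1)%:P%:P : {poly {poly F}}.
have c0 : c 0%N = 1 by rewrite /c big_ord0 fact0 invr1 mul1r.
exists ((\sum_(k < m.+1) c k * h ^+ k) * product_substitution b); split.
- rewrite -horner_coef0 hornerM horner_sum big_ord_recl big1 ?addr0 => [|i _].
    rewrite c0 expr0 mulr1 hornerC mul1r.
    rewrite horner_coef0 coef_poly b0 expr0 scale1r; case: ifPn => //.
    by rewrite -leqNgt leqn0 size_poly_eq0 => /eqP bE; move: b0; rewrite bE coef0 => /eqP; rewrite eq_sym oner_eq0.
  by rewrite hornerM horner_exp /h !hornerM hornerX !mul0r expr0n mulr0.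
- move=> l l0; set A := _ * _.
  (* Evaluating the inner variable t at 0 is a ring morphism that kills [h] and sends the other
     factors to 1, so the whole product maps to 1. *)
  pose phi : {rmorphism {poly {poly F}} -> {poly F}} := map_poly (horner_eval (0 : F)).
  have phiE (P : {poly {poly F}}) l' : (phi P)`_l' = (P`_l').[0] by rewrite /phi coef_map.
  have phih : phi h = 0.
    rewrite /h !(rmorphM phi); have -> : phi ('X^3)%:P = 0.
      by apply/polyP => j; rewrite phiE coefC coef0; case: eqP => _; rewrite ?horner0// hornerXn expr0n.
    by rewrite mulr0 mul0r.
  have phib : phi (product_substitution b) = 1.
    apply/polyP => j; rewrite phiE coef_poly coef1; case: ifPn => [_|].
      by rewrite hornerZ hornerXn; case: j => [|j]; rewrite ?b0 ?mulr1// expr0n mulr0.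
    case: j => [|j]; rewrite ?horner0// -leqNgt leqn0 size_poly_eq0 => /eqP bE.
    by move: b0; rewrite bE coef0 => /eqP; rewrite eq_sym oner_eq0.
  have : phi A = 1.
    rewrite /A (rmorphM phi) phib mulr1 (rmorph_sum phi) big_ord_recl big1 => [|i _].
      by rewrite addr0 c0 expr0 mulr1 (rmorph1 phi).
    by rewrite (rmorphM phi) (rmorphXn phi) phih expr0n mulr0.
  by move=> /(congr1 (fun p => p`_l)); rewrite phiE coef1 eqn0Ngt l0 => ->.
- move=> n x t nx; rewrite hornerM hornerM horner_product_substitution; congr (_ * _).
  rewrite !horner_sum; apply: eq_bigr => i _; rewrite /c !hornerM !hornerC horner_exp horner_exp.
  rewrite /h !hornerM hornerX !hornerC hornerXn horner_product_substitution.
  have hc : ('C(n, i)%:R : F) = \prod_(j < i) (n%:R - j%:R) / i`!%:R.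
    rewrite -natr_ffact -bin_ffact natrM mulfK// pnatr_eq0 -lt0n fact_gt0 //.
  have -> : (\prod_(j < i) (1 - j%:R *: 'X^2) : {poly {poly F}}).[x%:P].[t] =
            \prod_(j < i) (n%:R - j%:R) * (x ^+ 2) ^+ i.
    rewrite !horner_prod (_ : (x ^+ 2) ^+ i = \prod_(j < i) x ^+ 2); last first.
      by rewrite prodr_const card_ord.
    rewrite -big_split; apply: eq_bigr => j _ /=.
    rewrite hornerD hornerN hornerC hornerZ hornerXn hornerD hornerN hornerC hornerM -rmorphXn.
    by rewrite hornerC -(rmorph_nat polyC) hornerC mulrBl nx.
  rewrite hc; set P := \prod_(j < i) _; set Q := q.[_].
  have -> : ((x * t) ^+ 3 * Q) ^+ i = (x ^+ 2) ^+ i * (x * t ^+ 3 * Q) ^+ i.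
    by rewrite -exprMn; congr (_ ^+ _); ring.
  by ring.
Qed.

End bivariate_expansion.

Section decay.
Context {R : realType}.
Implicit Types (a b : nat -> R) (eps : R).

Lemma SP_small a k eps : SP a -> 0 < eps -> \forall n \near \oo, `|a n| * n%:R ^+ k <= eps.
Proof.
move=> ha eps0; have /cvgr0Pnorm_le /(_ _ eps0) := ha k.+1%:R (ltr0Sn R k).
apply: filter_app; near=> n => h; apply: le_trans h.
have n1 : (1 : R) <= n%:R by rewrite ler1n; near: n; exact: nbhs_infty_ge.
have n0 : (0 : R) <= n%:R by [].
rewrite powR_mulrn// normrM (ger0_norm (exprn_ge0 _ n0)); apply: ler_wpM2l => //.
by apply: ler_weXn2l.
Unshelve. all: by end_near. Qed.

Lemma LP_small b eps : LP b -> 0 < eps -> \forall n \near \oo, `|b n| * (Num.sqrt n%:R)^-1 <= eps.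
Proof.
move=> hb eps0; have /cvgr0Pnorm_le /(_ _ eps0) := hb 2^-1 (ltac:(by rewrite invr_gt0)).
apply: filter_app; near=> n => h; apply: le_trans h.
by rewrite powR12_sqrt// normrM normfV (ger0_norm (sqrtr_ge0 _)).
Unshelve. all: by end_near. Qed.

Lemma invr_sqrt_small eps : 0 < eps -> \forall n \near \oo, (Num.sqrt n%:R)^-1 <= eps.
Proof.
move=> eps0; near=> n.
have n0 : (0 : R) < n%:R by rewrite ltr0n; near: n; exact: nbhs_infty_gt.
rewrite invf_ple ?posrE ?sqrtr_gt0// -[_^-1]ger0_norm ?invr_ge0 ?(ltW eps0)// -sqrtr_sqr.
by rewrite ler_sqrt ?(ltW n0)//; near: n; exact: nbhs_infty_ger.
Unshelve. all: by end_near. Qed.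

Lemma near_ord_bound (f : nat -> nat -> R) (a : nat -> R) k :
  (forall j, (j <= k)%N -> exists C : R, \forall n \near \oo, f j n <= C * a n) ->
  exists2 C, 0 <= C & \forall n \near \oo, forall j, (j <= k)%N -> f j n <= C * `|a n|.
Proof.
elim: k => [|k IH] h.
  have [C hC] := h 0%N isT; exists `|C| => //; near=> n => j; rewrite leqn0 => /eqP->.
  rewrite -normrM; apply: le_trans (ler_norm _); near: n; exact: hC.
have [C C0 hC] := IH (fun j jk => h j (leqW jk)); have [D hD] := h k.+1 (leqnn _).
exists (C + `|D|); first by rewrite addr_ge0.
near=> n => j; rewrite leq_eqVlt ltnS mulrDl => /orP[/eqP->|jk].
  rewrite -normrM ler_wpDl ?mulr_ge0//; apply: le_trans (ler_norm _); near: n; exact: hD.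
rewrite ler_wpDr ?mulr_ge0//; apply: (near hC) => //.
Unshelve. all: by end_near. Qed.

End decay.

Section charf_expansion.
Context {R : realType}.
Variables (m n0 : nat) (V delta : R) (f : nat -> R -> R[i]) (lam : R -> R[i])
  (b a : nat -> R) (B : nat -> R[i]).
Let H n s := (lam s ^+ n)^-1 * f n s.
Hypotheses (V0 : 0 < V) (delta0 : 0 < delta).
Hypothesis f0 : forall n, (1 <= n)%N -> f n 0 = 1.
Hypothesis Cf : forall n, (n0 <= n)%N -> Ck_on m.+2 (f n) [set s | `|s| < delta].
Hypotheses (hb : LP b) (ha : SP a) (Clam : Ck_on m.+2 lam [set s | `|s| < delta]).
Hypothesis lamN0 : forall s, `|s| < delta -> lam s != 0.
Hypothesis lam2 : forall eps : R, 0 < eps -> exists eta : R, 0 < eta /\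
  forall s : R, `|s| < eta -> nc (lam s - (1 - V * s ^+ 2 / 2)%:C%C) <= eps * s ^+ 2.
Hypothesis jetH : forall j, (j <= m.+2)%N -> exists C : R,
  \forall n \near \oo, nc (cderivn j (H n) 0 - B j) <= C * a n.
Hypothesis boundH : forall n, (n0 <= n)%N -> forall s, `|s| < delta -> forall j, (j <= m.+2)%N ->
  nc (lam s ^+ n * cderivn j (H n) s) <= b n * expR (- (V * s ^+ 2) / 8) + a n.

Let lam_lilo : lilo 2 (fun s => lam s - (1 - V * s ^+ 2 / 2)%:C%C).
Proof.
move=> eps eps0; have [eta [eta0 h]] := lam2 eps0; exists eta => // s _ /h.
by rewrite real_normK ?num_real.
Qed.

Let lam0 : lam 0 = 1. Proof. by have [] := multiplier_jet delta0 Clam lam_lilo. Qed.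

Let H0 n : (1 <= n)%N -> H n 0 = 1.
Proof. by move=> n1; rewrite /H lam0 expr1n invr1 mul1r f0. Qed.

(** [H n 0] is 1 for every n >= 1 and the distance to [B 0] is O(a n), which tends to 0. *)
Let B0 : B 0%N = 1.
Proof.
have [C C0 hC] := near_ord_bound (fun j jk => jetH (leq_trans jk (leq0n m.+2))).
apply/eqP; rewrite -subr_eq0 -oppr_eq0 opprB; apply/eqP; apply: Normc.eq0_normc.
apply/eqP; rewrite eq_le nc_ge0 andbT; apply/ler_addgt0Pl => e e0; rewrite addr0.
have eC : 0 < e / (C + 1) by rewrite divr_gt0// ltr_wpDl.
near \oo => n.
have n1 : (1 <= n)%N by near: n; exact: nbhs_infty_ge.
have h1 : nc (1 - B 0%N) <= C * `|a n|.
  by rewrite -(H0 n1); apply: (near hC n _ 0%N) => //.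
have h2 : `|a n| * n%:R ^+ 0 <= e / (C + 1) by near: n; exact: SP_small.
apply: (le_trans h1); rewrite expr0 mulr1 ler_pdivlMr ?ltr_wpDl// in h2.
by apply: le_trans h2; rewrite mulrC; apply: ler_wpM2l => //; rewrite lerDl.
Unshelve. all: by end_near. Qed.

Let kH n : (n0 <= n)%N -> kdiff delta m.+2 (H n).
Proof.
move=> n0n; apply: kdiffM; last exact: Ck_on_kdiff (Cf n0n).
apply: kdiffV; first by move=> s sd; rewrite expf_neq0// lamN0.
exact/kdiffX/Ck_on_kdiff.
Qed.

(** Three errors are added: the Taylor remainder of [H n], the replacement of its derivatives at 0
    by the B_j, and the expansion of lam ^ n. The first two give the term in n^(-1/2) |t|, the third
    the Gaussian term. *)
Lemma charf_expansion : exists A : {poly {poly R[i]}},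
  [/\ A`_0 = 1, forall l, (0 < l)%N -> (A`_l).[0] = 0 &
  forall eta : R, 0 < eta -> exists2 dl : R, 0 < dl & \forall n \near \oo, forall t : R, t != 0 ->
   `|t| < dl * Num.sqrt n%:R ->
   nc (f n (t / Num.sqrt n%:R) -
       A.[((Num.sqrt n%:R)^-1)%:C%C%:P].[t%:C%C] * (expR (- (V / 2) * t ^+ 2))%:C%C) <=
   eta * (Num.sqrt n%:R)^-1 ^+ m * ((Num.sqrt n%:R)^-1 * `|t| +
     (`|t| ^+ m.+2 + `|t| ^+ (3 * m.+1)) * expR (- (V / 4) * t ^+ 2))].
Proof.
have [q hq] := multiplier_flat V0 delta0 Clam lam_lilo.
have [Cm Cm0 hCm] := multiplier_power V0 hq.
have [d1 /andP[d10 d1d] ratio] := multiplier_ratio V0 delta0 Clam lam_lilo.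
have [C0 C00 hC0] := expn_le_expR m.+1 (divr_gt0 V0 (ltr0n R 4)).
pose p := \poly_(j < m.+2) (B j / j`!%:R).
have p0 : p`_0 = 1 by rewrite coef_poly B0 fact0 divr1.
have [A [A0 Al hA]] := edgeworth_expansion m q p0.
exists A; split=> // eta eta0.
have [Mp Mp0 hMp] := nc_horner_bounded p 1.
have [dl dl0 hdl] := hCm _ (divr_gt0 eta0 Mp0).
have [CB CB0 hCB] := near_ord_bound jetH.
have K0 : 0 < m.+2%:R * CB + 1 by rewrite ltr_wpDl// mulr_ge0.
have K1 : 0 < eta / 2 / (m.+2%:R * CB + 1) by rewrite divr_gt0// divr_gt0.
exists (Num.min 1 (Num.min dl d1)); first by rewrite !lt_min ltr01 dl0.
near=> n.
have n1 : (1 <= n)%N by near: n; exact: nbhs_infty_ge.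
have n0n : (n0 <= n)%N by near: n; exact: nbhs_infty_ge.
pose e := (Num.sqrt n%:R)^-1 : R.
have sn0 : 0 < Num.sqrt n%:R :> R by rewrite sqrtr_gt0 ltr0n.
have e0 : 0 < e by rewrite invr_gt0.
have ne : n%:R * e ^+ 2 = 1 by rewrite exprVn sqr_sqrtr// mulfV// pnatr_eq0 -lt0n.
(* The remainder is of order n^(-(m+1)/2) |s|, one factor n^(-1/2) better than required; that spare
   factor pays for the slowly growing [b n]. *)
have E1 : 2 * (C0 * (`|b n| + `|a n|) * e) <= eta / 2.
  have h1 : `|b n| * (Num.sqrt n%:R)^-1 <= eta / 8 / C0 by near: n; apply: LP_small => //; apply: divr_gt0 => //; exact: divr_gt0.
  have h2 : `|a n| * n%:R ^+ 0 <= eta / 8 / C0 by near: n; apply: SP_small => //; apply: divr_gt0 => //; exact: divr_gt0.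
  have e1 : (Num.sqrt n%:R)^-1 <= 1 :> R by near: n; exact: invr_sqrt_small.
  rewrite expr0 mulr1 in h2.
  have h3 : `|a n| * e <= eta / 8 / C0 by apply: le_trans h2; rewrite ler_piMr.
  have : C0 * ((`|b n| + `|a n|) * e) <= C0 * (eta / 8 / C0 + eta / 8 / C0).
    by apply: ler_wpM2l; [exact: ltW|rewrite mulrDl lerD].
  have hc : C0 * (eta / 8 / C0) = eta / 8 by rewrite mulrC divfK// gt_eqF.
  by rewrite mulrDr hc; lra.
have E2 : m.+2%:R * (CB * `|a n|) <= eta / 2 * e ^+ m.
  have h : `|a n| * n%:R ^+ m <= eta / 2 / (m.+2%:R * CB + 1) by near: n; exact: SP_small.
  rewrite /e exprVn ler_pdivlMr ?exprn_gt0//.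
  rewrite ler_pdivlMr// in h; apply: le_trans h; rewrite [leRHS]mulrAC.
  apply: ler_pM.
  - by apply: mulr_ge0 => //; exact: mulr_ge0.
  - by apply: exprn_ge0; exact: ltW.
  - by rewrite mulrA mulrC; apply: ler_wpM2l => //; rewrite lerDl.
  apply: lerXn2r; rewrite ?nnegrE ?(ltW sn0)//.
  rewrite -[leRHS]sqr_sqrtr// expr2; apply: ler_peMl; first exact: ltW.
  by rewrite -[leLHS]sqrtr1 ler_sqrt// ler1n.
(* The binomial truncation error carries a spare n^(-1/2), so its constant [Cm], which does not
   shrink with eta, becomes harmless for large n. *)
have E3 : Mp * (Cm * e) <= eta.
  have : (Num.sqrt n%:R)^-1 <= eta / (Mp * Cm) by near: n; apply: invr_sqrt_small; rewrite divr_gt0 ?mulr_gt0.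
  by rewrite ler_pdivlMr ?mulr_gt0// mulrC mulrA.
move=> t tN0 tlt; pose s := t / Num.sqrt n%:R : R.
have tE : t = s / e by rewrite /s /e invrK mulfVK// gt_eqF.
have sE : s = e * t by rewrite /s mulrC.
have sN0 : s != 0 by rewrite mulf_neq0// gt_eqF.
have : `|s| < Num.min 1 (Num.min dl d1).
  by rewrite /s normrM normfV (gtr0_norm sn0) ltr_pdivrMr.
rewrite !lt_min => /andP[s1 /andP[sdl sd1]].
have sdelta : `|s| < delta by exact: lt_le_trans d1d.
pose E := (expR (- (V / 2) * t ^+ 2))%:C%C : R[i].
pose Q := \sum_(i < m.+1) 'C(n, i)%:R * (s%:C%C ^+ 3 * q.[s%:C%C]) ^+ i.
have nes : n%:R * s ^+ 2 = t ^+ 2 by rewrite sE exprMn mulrA ne mul1r.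
have QA : A.[e%:C%C%:P].[t%:C%C] = Q * p.[s%:C%C].
  have nec : n%:R * e%:C%C ^+ 2 = 1 :> R[i].
    have : (n%:R * e ^+ 2)%:C%C = 1%:C%C :> R[i] by rewrite ne.
    by rewrite rmorphM rmorphXn rmorph_nat.
  have sc : s%:C%C = e%:C%C * t%:C%C :> R[i] by rewrite sE rmorphM.
  by rewrite -(hA _ _ _ nec) -sc.
pose Tn := \sum_(j < m.+2) cderivn j (H n) 0 * (s ^+ j / j`!%:R)%:C%C.
have fE : f n s = lam s ^+ n * H n s by rewrite /H mulVKf// expf_neq0// lamN0.
rewrite -/e -/s QA fE -/E.
have -> : lam s ^+ n * H n s - Q * p.[s%:C%C] * E = lam s ^+ n * (H n s - Tn) +
   (lam s ^+ n * (Tn - p.[s%:C%C]) + (lam s ^+ n - Q * E) * p.[s%:C%C]) by ring.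
have lam1 : nc (lam s ^+ n) <= 1.
  rewrite ncX; apply: exprn_ile1; first exact: nc_ge0.
  have := ratio s 0 sd1 (lexx _) ler01; rewrite mul0r lam0 nc1 mul1r => /le_trans; apply.
  rewrite subr0 mulr1.
  by rewrite -[leRHS]expR0 ler_expR mulNr oppr_le0 mulr_ge0 ?sqr_ge0// divr_ge0// ltW.
have P1 : nc (lam s ^+ n * (H n s - Tn)) <= eta / 2 * (e ^+ m * (e * `|t|)).
  have hM u : `|u| < delta -> nc (lam u ^+ n * cderivn m.+2 (H n) u) <= `|b n| + `|a n|.
    move=> ud; apply: (le_trans (boundH n0n ud (leqnn _))).
    apply: lerD; last exact: ler_norm.
    apply: (@le_trans _ _ (`|b n| * expR (- (V * u ^+ 2) / 8))).
      by apply: ler_wpM2r; [exact: expR_ge0|exact: ler_norm].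
    apply: ler_piMr => //; rewrite -[leRHS]expR0 ler_expR mulNr oppr_le0.
    by rewrite divr_ge0// mulr_ge0 ?sqr_ge0// ltW.
  have := normalized_taylor n1 (kH n0n) d1d V0 ratio hC0 hM sd1.
  move=> /le_trans; apply; rewrite -exprVn -/e.
  have -> : 2 * (`|s| * (`|b n| + `|a n|) * (C0 * e ^+ m.+1)) =
    2 * (C0 * (`|b n| + `|a n|) * e) * (e ^+ m * (e * `|t|)).
    by rewrite sE normrM (gtr0_norm e0) (exprS _ m); ring.
  apply: ler_wpM2r => //; apply: mulr_ge0; first exact/exprn_ge0/ltW.
  by apply: mulr_ge0 => //; exact: ltW.
have P2 : nc (lam s ^+ n * (Tn - p.[s%:C%C])) <= eta / 2 * (e ^+ m * (e * `|t|)).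
  rewrite ncM.
  have hT : nc (Tn - p.[s%:C%C]) <= m.+2%:R * (CB * `|a n|) * `|s|.
    rewrite horner_poly -sumrB; apply: (le_trans (nc_sum _ _ _)).
    rewrite -mulrA mulr_natl -[X in _ *+ X](card_ord m.+2) -sumr_const.
    apply: ler_sum => j _.
    have -> : cderivn j (H n) 0 * (s ^+ j / j`!%:R)%:C%C - B j / j`!%:R * s%:C%C ^+ j =
       (cderivn j (H n) 0 - B j) * (s ^+ j / j`!%:R)%:C%C.
      by rewrite rmorphM rmorphXn fmorphV rmorph_nat; ring.
    (* The constant terms agree exactly, so the difference keeps the factor |s| that the weight 1 /
       t demands. *)
    have [->|j0] := eqVneq (nat_of_ord j) 0%N.
      by rewrite B0 [cderivn 0 _ _]H0// subrr mul0r nc0 !mulr_ge0.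
    rewrite ncM nc_real; apply: ler_pM; rewrite ?nc_ge0//.
      by apply: (near hCB n) => //; rewrite ltnW.
    have f0' : (0 : R) < j`!%:R by rewrite ltr0n fact_gt0.
    rewrite normrM normfV normrX (gtr0_norm f0') ler_pdivrMr//.
    apply: (@le_trans _ _ `|s|); last by rewrite ler_peMr// ler1n fact_gt0.
    by rewrite -[leRHS]expr1; apply: ler_wiXn2l; rewrite ?lt0n// ltW.
  apply: (@le_trans _ _ (1 * (m.+2%:R * (CB * `|a n|) * `|s|))).
    by apply: ler_pM; rewrite ?nc_ge0.
  rewrite mul1r sE normrM (gtr0_norm e0) (mulrA (eta / 2)); apply: ler_wpM2r => //.
    by rewrite mulr_ge0// ltW.
have P3 : nc ((lam s ^+ n - Q * E) * p.[s%:C%C]) <=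
   eta * (e ^+ m * ((`|t| ^+ m.+2 + `|t| ^+ (3 * m.+1)) * expR (- (V / 4) * t ^+ 2))).
  have h1 := hdl n s sN0 sdl; rewrite nes -/E -/Q in h1.
  have h2 : nc p.[s%:C%C] <= Mp by apply: hMp; exact: ltW.
  rewrite ncM; apply: (le_trans (ler_pM (nc_ge0 _) (nc_ge0 _) h1 h2)).
  have -> : n%:R * `|s| ^+ m.+2 = e ^+ m * `|t| ^+ m.+2.
    rewrite sE normrM (gtr0_norm e0) exprMn.
    have -> : e ^+ m.+2 = e ^+ m * e ^+ 2 by rewrite -exprD addn2.
    set w := `|t| ^+ _; set y := e ^+ m.
    by transitivity (n%:R * e ^+ 2 * (y * w)); [ring|rewrite ne mul1r].
  have -> : (n%:R * `|s| ^+ 3) ^+ m.+1 = e ^+ m * (e * `|t| ^+ (3 * m.+1)).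
    have -> : n%:R * `|s| ^+ 3 = e * `|t| ^+ 3.
      by rewrite sE normrM (gtr0_norm e0); transitivity (n%:R * e ^+ 2 * (e * `|t| ^+ 3)); [ring|rewrite ne mul1r].
    by rewrite exprMn -exprM (exprSr _ m) mulrA.
  set x := expR _; have x0 : 0 <= x by exact: expR_ge0.
  set u := `|t| ^+ m.+2; have u0 : 0 <= u by exact: exprn_ge0.
  set v := `|t| ^+ (3 * m.+1); have v0 : 0 <= v by exact: exprn_ge0.
  have em0 : 0 <= e ^+ m by rewrite exprn_ge0// ltW.
  have -> : (eta / Mp * (e ^+ m * u) + Cm * (e ^+ m * (e * v))) * x * Mp =
     eta * (e ^+ m * (u * x)) + Mp * (Cm * e) * (e ^+ m * (v * x)).
    by field; rewrite gt_eqF.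
  rewrite (mulrDl u v) (mulrDr (e ^+ m)) (mulrDr eta) lerD2l.
  by apply: ler_wpM2r => //; rewrite !mulr_ge0.
apply: (le_trans (ncD _ _)); apply: (le_trans (lerD P1 (ncD _ _))).
apply: (le_trans (lerD (lexx _) (lerD P2 P3))).
by rewrite le_eqVlt; apply/orP; left; apply/eqP; field.
Unshelve. all: by end_near. Qed.

End charf_expansion.

(** * Symmetrization *)

Section symmetrization.
Context {R : realType}.
Implicit Types (p : {poly R[i]}) (t e : R).

Local Notation I := ('i%C : R[i]).

Lemma exp_imaginary k : I ^+ k = Complex (cos (pi / 2 *+ k)) (sin (pi / 2 *+ k)).
Proof.
elim: k => [|k IH]; first by rewrite !mulr0n cos0 sin0 expr0.
rewrite exprSr IH (mulrSr (pi / 2) k) cosDpihalf sinDpihalf.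
by apply: complex_eqP; rewrite ?cReM ?cImM /=; ring.
Qed.

Let conjM (x y : R[i]) : conjc (x * y) = conjc x * conjc y. Proof. exact: rmorphM. Qed.

Let conjX (x : R[i]) n : conjc (x ^+ n) = conjc x ^+ n. Proof. exact: rmorphXn. Qed.

(** With z_j = p_j (- i) ^ j one has p (t) = sum of z_j (i t) ^ j, and the conjugate of p (- t) has
    the conjugate coefficients; half the sum of the two keeps the real parts. *)
Definition frequency_coef p j : R := Re (p`_j * (- I) ^+ j).

Lemma horner_conj_sum p J t : (size p <= J)%N ->
  p.[t%:C%C] + conjc p.[(- t)%:C%C] = 2 * \sum_(j < J) (frequency_coef p j)%:C%C * (I * t%:C%C) ^+ j.
Proof.
move=> pJ; rewrite !(horner_coef_wide _ pJ) rmorph_sum mulr_sumr -big_split; apply: eq_bigr => j _ /=.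
set c := p`_j; set z := c * (- I) ^+ j.
have II : (- I) * I = 1 by rewrite mulNr -expr2 sqr_i opprK.
have cE : c = z * I ^+ j by rewrite /z -mulrA -exprMn II expr1n mulr1.
have cz : conjc z = conjc c * I ^+ j.
  by rewrite /z conjM conjX; congr (_ * _ ^+ _); apply: complex_eqP => /=; rewrite ?oppr0 ?opprK.
have zz : z + conjc z = 2 * (frequency_coef p j)%:C%C.
  rewrite /frequency_coef -/c -/z mulr_natl mulr2n.
    by apply: complex_eqP; rewrite ?cReD ?cImD /=; case: (z) => u v /=; ring.
have hc : conjc (c * (- t)%:C%C ^+ j) = conjc z * I ^+ j * t%:C%C ^+ j.
  rewrite conjM conjX conjc_real cz (_ : (- t)%:C%C = I * (I * t%:C%C)) ?exprMn; first by ring.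
  by rewrite mulrA -expr2 sqr_i mulN1r rmorphN.
by rewrite hc exprMn mulrA -zz {1}cE; ring.
Qed.

(** Conjugate averaging makes the coefficients real, and the vanishing of each A_l at 0 removes the
    constant power of i t, as [edgeworth_re] and [edgeworth_im] require. Orders beyond M are
    discarded at a cost e ^ (M + 1), still with a factor t. *)
Lemma edgeworth_symmetrization (A : {poly {poly R[i]}}) (V : R) (M : nat) :
  A`_0 = 1 -> (forall l, (0 < l)%N -> (A`_l).[0] = 0) ->
  exists (alpha : nat -> nat -> R) (J : nat) (D : {poly R}), forall e t, 0 <= e -> e <= 1 -> 0 <= t ->
  nc (Complex (edgeworth_re V J (fun j => \sum_(l < M) e ^+ l.+1 * alpha l j) t)
              (edgeworth_im V J (fun j => \sum_(l < M) e ^+ l.+1 * alpha l j) t) -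
      (A.[e%:C%C%:P].[t%:C%C] + conjc A.[e%:C%C%:P].[(- t)%:C%C]) / 2 *
        (expR (- (V / 2) * t ^+ 2))%:C%C) <=
  e ^+ M.+1 * (t * D.[t]) * expR (- (V / 2) * t ^+ 2).
Proof.
(* Adding M to the size pads the sum with zero terms, so that the first M orders always form an
   initial segment of it. *)
move=> A0 Al; pose N := (size A + M)%N; pose J := (\max_(l < N.+1) size (A`_l)%R)%N.
pose al l j : R := frequency_coef (A`_l.+1) j.+1.
exists al, J, (\poly_(j < J) \sum_(l < N) `|al l j|) => e t e0 e1 t0.
have sA : (size A <= N.+1)%N by rewrite leqW// leq_addr.
have AE u : A.[e%:C%C%:P].[u] = \sum_(l < N.+1) (A`_l).[u] * e%:C%C ^+ l.
  by rewrite (horner_coef_wide _ sA) horner_sum; apply: eq_bigr => l _; rewrite hornerM -rmorphXn hornerC.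
pose F l : R[i] := \sum_(j < J) (al l j)%:C%C * (I * t%:C%C) ^+ j.+1.
have half : (2 : R[i]) != 0 by rewrite pnatr_eq0.
have SE : (A.[e%:C%C%:P].[t%:C%C] + conjc A.[e%:C%C%:P].[(- t)%:C%C]) / 2 =
    1 + \sum_(l < N) e%:C%C ^+ l.+1 * F l.
  rewrite !AE rmorph_sum -big_split big_ord_recl /= A0 !hornerC !expr0 !mulr1 rmorph1.
  rewrite mulrDl (_ : (1 + 1) / 2 = 1 :> R[i]); last by field.
  congr (_ + _); rewrite mulr_suml; apply: eq_bigr => l _.
  have sJ : (size (A`_l.+1)%R <= J.+1)%N.
    by apply: leqW; exact: (@leq_bigmax _ (fun l : 'I_N.+1 => size (A`_l)%R) (lift ord0 l)).
  rewrite /bump leq0n add1n conjM conjX conjc_real -mulrDl (horner_conj_sum _ sJ) big_ord_recl.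
  rewrite {1}/frequency_coef -horner_coef0 Al// mul0r /= mul0r add0r.
  by rewrite mulrAC (mulrC 2) mulfK// mulrC.
have E0 : 0 <= expR (- (V / 2) * t ^+ 2) by exact: expR_ge0.
have GE : Complex (edgeworth_re V J (fun j => \sum_(l < M) e ^+ l.+1 * al l j) t)
              (edgeworth_im V J (fun j => \sum_(l < M) e ^+ l.+1 * al l j) t) =
   (1 + \sum_(l < M) e%:C%C ^+ l.+1 * F l) * (expR (- (V / 2) * t ^+ 2))%:C%C.
  have -> : \sum_(l < M) e%:C%C ^+ l.+1 * F l =
     \sum_(j < J) (\sum_(l < M) e ^+ l.+1 * al l j)%:C%C * (I * t%:C%C) ^+ j.+1.
    under eq_bigr do rewrite mulr_sumr; rewrite exchange_big; apply: eq_bigr => j _ /=.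
    rewrite rmorph_sum mulr_suml; apply: eq_bigr => l _.
    by rewrite mulrA rmorphM rmorphXn.
  have TE j : (I * t%:C%C) ^+ j.+1 = Complex (t ^+ j.+1 * cos (pi / 2 *+ j.+1)) (t ^+ j.+1 * sin (pi / 2 *+ j.+1)).
    rewrite exprMn exp_imaginary -rmorphXn /=.
    by apply: complex_eqP; rewrite ?cReM ?cImM /=; ring.
  rewrite /edgeworth_re /edgeworth_im; apply: complex_eqP.
    rewrite cReMr cReD cRe_sum mulrC /=; congr ((_ + _) * _).
    by apply: eq_bigr => j _; rewrite cReM TE /=; ring.
  rewrite cImMr cImD cIm_sum [RHS]mulrC /= add0r; congr (_ * _).
  by apply: eq_bigr => j _; rewrite cImM TE /=; ring.
rewrite SE GE -mulrBl ncM nc_real (ger0_norm E0); apply: ler_wpM2r => //.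
have -> : 1 + \sum_(l < M) e%:C%C ^+ l.+1 * F l - (1 + \sum_(l < N) e%:C%C ^+ l.+1 * F l) =
   - \sum_(M <= l < N) e%:C%C ^+ l.+1 * F l.
  rewrite -!(big_mkord xpredT (fun l => e%:C%C ^+ l.+1 * F l)).
  by rewrite (big_cat_nat (n := M) (p := N)) ?leq_addl//=; ring.
rewrite ncN; apply: (le_trans (nc_sum _ _ _)).
have Fle l : nc (F l) <= t * \sum_(j < J) `|al l j| * t ^+ j.
  apply: (le_trans (nc_sum _ _ _)); rewrite mulr_sumr; apply: ler_sum => j _.
  rewrite ncM ncX ncM nc_real nc_real (ger0_norm t0) (_ : nc I = 1) ?mul1r ?exprS.
    by rewrite mulrCA.
  by rewrite /Normc.normc /= expr0n expr1n add0r sqrtr1.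
apply: (@le_trans _ _ (\sum_(M <= l < N) e ^+ M.+1 * (t * \sum_(j < J) `|al l j| * t ^+ j))).
  apply: ler_sum_nat => l /andP[Ml lN]; rewrite ncM ncX nc_real (ger0_norm e0).
  apply: ler_pM; rewrite ?exprn_ge0 ?nc_ge0//.
  by apply: ler_wiXn2l.
rewrite -mulr_sumr; apply: ler_wpM2l; first exact: exprn_ge0.
rewrite -mulr_sumr; apply: ler_wpM2l => //; rewrite horner_poly.
rewrite exchange_big; apply: ler_sum => j _ /=; rewrite mulr_suml.
rewrite -(big_mkord xpredT (fun l => `|al l j| * t ^+ j)) (big_cat_nat (m := 0) (n := M) (p := N)) ?leq_addl//=.
by rewrite lerDr sumr_ge0// => l _; rewrite mulr_ge0// exprn_ge0.
Qed.

End symmetrization.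

Section near_zero.
Context {R : realType}.
Variables (V : R) (m M : nat) (f : nat -> R -> R[i]) (A : {poly {poly R[i]}}) (rho : nat -> R).
Hypotheses (V0 : 0 < V) (A0 : A`_0 = 1) (Al : forall l, (0 < l)%N -> (A`_l).[0] = 0).
Hypothesis fconj : forall n s, (1 <= n)%N -> f n (- s) = conjc (f n s).
Hypothesis expansion : forall eta : R, 0 < eta -> exists2 dl : R, 0 < dl & \forall n \near \oo,
  forall t : R, t != 0 -> `|t| < dl * Num.sqrt n%:R ->
   nc (f n (t / Num.sqrt n%:R) -
       A.[((Num.sqrt n%:R)^-1)%:C%C%:P].[t%:C%C] * (expR (- (V / 2) * t ^+ 2))%:C%C) <=
   eta * (Num.sqrt n%:R)^-1 ^+ m * ((Num.sqrt n%:R)^-1 * `|t| +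
     (`|t| ^+ m.+2 + `|t| ^+ (3 * m.+1)) * expR (- (V / 4) * t ^+ 2)).
Hypothesis rho_m : \forall n \near \oo, (Num.sqrt n%:R)^-1 ^+ m <= rho n.
Hypothesis rho_M : forall eta, 0 < eta -> \forall n \near \oo, (Num.sqrt n%:R)^-1 ^+ M.+1 <= eta * rho n.

(** The expansion is used at t and at - t; conjugating the second turns it into another
    approximation of the same value, and the two are averaged. [rho] stands for the final rate
    n^(-min(r,r')/2), entering only through its comparison with the orders m and M + 1. *)
Lemma charf_near_zero : exists (alpha : nat -> nat -> R) (J : nat) (C : R), 0 < C /\
  forall eta : R, 0 < eta -> exists2 dl : R, 0 < dl & \forall n \near \oo,
  forall t : R, 0 < t -> t < dl * Num.sqrt n%:R ->
  `|Re (f n (t / Num.sqrt n%:R)) -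
     edgeworth_re V J (fun j => \sum_(l < M) (Num.sqrt n%:R)^-1 ^+ l.+1 * alpha l j) t| +
  `|Im (f n (t / Num.sqrt n%:R)) -
     edgeworth_im V J (fun j => \sum_(l < M) (Num.sqrt n%:R)^-1 ^+ l.+1 * alpha l j) t| <=
  t * (eta * rho n * ((Num.sqrt n%:R)^-1 + C * expR (- (V / 8) * t ^+ 2))).
Proof.
have [alpha [J [D hD]]] := edgeworth_symmetrization V M A0 Al.
have V8 : 0 < V / 8 by rewrite divr_gt0.
have [C1 C10 hC1] := horner_le_expR ('X^(m.+1) + 'X^(3 * m + 2)) V8.
have [C2 C20 hC2] := horner_le_expR D V8.
exists alpha, J, (C1 + C2); split=> [|eta eta0]; first exact: addr_gt0.
have eta2 : 0 < eta / 2 by rewrite divr_gt0.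
have [dl dl0 hdl] := expansion eta2; exists dl => //; near=> n => t t0 tdl.
have hn : forall u : R, u != 0 -> `|u| < dl * Num.sqrt n%:R -> nc (f n (u / Num.sqrt n%:R) -
    A.[((Num.sqrt n%:R)^-1)%:C%C%:P].[u%:C%C] * (expR (- (V / 2) * u ^+ 2))%:C%C) <=
  eta / 2 * (Num.sqrt n%:R)^-1 ^+ m * ((Num.sqrt n%:R)^-1 * `|u| +
    (`|u| ^+ m.+2 + `|u| ^+ (3 * m.+1)) * expR (- (V / 4) * u ^+ 2)) by near: n.
have n1 : (1 <= n)%N by near: n; exact: nbhs_infty_ge.
pose sn := Num.sqrt n%:R : R; pose e := sn^-1.
have sn0 : 0 < sn by rewrite sqrtr_gt0 ltr0n.
have e0 : 0 <= e by rewrite invr_ge0 ltW.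
have e1 : (Num.sqrt n%:R)^-1 <= 1 :> R by near: n; exact: invr_sqrt_small.
have r1 : (Num.sqrt n%:R)^-1 ^+ m <= rho n by near: n.
have r2 : (Num.sqrt n%:R)^-1 ^+ M.+1 <= eta / 2 * rho n by near: n; exact: rho_M.
rewrite -/sn -/e in r1 r2 e1 hn *; set gr := edgeworth_re _ _ _ _; set gi := edgeworth_im _ _ _ _.
set s := t / sn; pose E := expR (- (V / 2) * t ^+ 2).
pose w := expR (- (V / 8) * t ^+ 2); rewrite -/w.
have w0 : 0 <= w by exact: expR_ge0.
pose X := eta / 2 * e ^+ m * (e * t + (t ^+ m.+2 + t ^+ (3 * m.+1)) * expR (- (V / 4) * t ^+ 2)).
have k1 : nc (f n s - A.[e%:C%C%:P].[t%:C%C] * E%:C%C) <= X.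
  by have := hn t; rewrite (gtr0_norm t0); apply; rewrite ?gt_eqF.
have k2 : nc (f n s - conjc A.[e%:C%C%:P].[(- t)%:C%C] * E%:C%C) <= X.
  have := hn (- t); rewrite normrN (gtr0_norm t0) oppr_eq0 sqrrN => /(_ _ _).
  rewrite mulNr fconj// -/s => h; rewrite -nc_conj.
  have -> : conjc (f n s - conjc A.[e%:C%C%:P].[(- t)%:C%C] * E%:C%C) =
    conjc (f n s) - A.[e%:C%C%:P].[(- t)%:C%C] * E%:C%C.
    by move: (f n s) A.[_].[_] (E) => [? ?] [? ?] ?; apply: complex_eqP => /=; ring.
  by apply: h; rewrite ?gt_eqF.
have k3 : nc (Complex gr gi - (A.[e%:C%C%:P].[t%:C%C] + conjc A.[e%:C%C%:P].[(- t)%:C%C]) / 2 * E%:C%C) <=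
   e ^+ M.+1 * (t * D.[t]) * E by apply: hD => //; exact: ltW.
have k : nc (f n s - Complex gr gi) <= X + e ^+ M.+1 * (t * D.[t]) * E.
  set a1 := A.[_].[_] in k1 k3 *; set a2 := conjc _ in k2 k3 *.
  have -> : f n s - Complex gr gi = ((f n s - a1 * E%:C%C) + (f n s - a2 * E%:C%C)) / 2
     - (Complex gr gi - (a1 + a2) / 2 * E%:C%C) by field.
  apply: (le_trans (ncB _ _)); apply: lerD => //.
  rewrite ncM ncV nc_nat ler_pdivrMr// mulr_natr mulr2n.
  by apply: (le_trans (ncD _ _)); exact: lerD.
have hX : X <= eta / 2 * rho n * (t * (e + C1 * w)).
  rewrite /X; apply: ler_pM.
  - by rewrite mulr_ge0 ?exprn_ge0// ltW.
  - by rewrite addr_ge0 ?mulr_ge0 ?addr_ge0 ?exprn_ge0 ?expR_ge0 ?(ltW t0).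
  - by apply: ler_wpM2l; first exact: ltW.
  rewrite mulrDr (mulrC t e) lerD2l.
  have -> : t ^+ m.+2 + t ^+ (3 * m.+1) = t * (t ^+ m.+1 + t ^+ (3 * m + 2)).
    by rewrite mulrDr -!exprS -addnS mulnS addnC.
  rewrite -mulrA; apply: ler_wpM2l; first exact: ltW.
  have := hC1 t; rewrite hornerD !hornerXn => /(le_trans (ler_norm _)) h.
  have -> : C1 * w = C1 * expR (V / 8 * t ^+ 2) * expR (- (V / 4) * t ^+ 2).
    by rewrite -mulrA -expRD /w; congr (_ * expR _); field.
  by apply: ler_wpM2r; first exact: expR_ge0.
have hZ : e ^+ M.+1 * (t * D.[t]) * E <= eta / 2 * rho n * (t * (C2 * w)).
  have hDw : D.[t] * E <= C2 * w.
    have := hC2 t => /(le_trans (ler_norm _)) h.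
    apply: (@le_trans _ _ (C2 * expR (V / 8 * t ^+ 2) * E)); first by apply: ler_wpM2r; first exact: expR_ge0.
    rewrite -mulrA -expRD; apply: ler_wpM2l; first exact: ltW.
    by rewrite ler_expR; have := mulr_ge0 (ltW V0) (sqr_ge0 t); lra.
  apply: (@le_trans _ _ (e ^+ M.+1 * (t * (C2 * w)))).
    by rewrite -mulrA -mulrA; apply: ler_wpM2l; rewrite ?exprn_ge0//; apply: ler_wpM2l => //; exact: ltW.
  by apply: ler_wpM2r => //; rewrite !mulr_ge0 ?(ltW t0) ?(ltW C20).
have Re1 : `|Re (f n s) - gr| <= nc (f n s - Complex gr gi).
  by have := Re_le_nc (f n s - Complex gr gi); rewrite cReD cReN.
have Im1 : `|Im (f n s) - gi| <= nc (f n s - Complex gr gi).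
  by have := Im_le_nc (f n s - Complex gr gi); rewrite cImD cImN.
apply: (le_trans (lerD Re1 Im1)); apply: (le_trans (lerD k k)).
apply: (le_trans (lerD (lerD hX hZ) (lerD hX hZ))).
by rewrite le_eqVlt; apply/orP; left; apply/eqP; field.
Unshelve. all: by end_near. Qed.

End near_zero.

(** * Splitting the smoothing integral *)

Section range_splitting.
Context {R : realType}.
Notation leb := (@lebesgue_measure R).
Local Open Scope ereal_scope.

Lemma ge0_le_integralD (D : set R) (f g h : R -> R) : measurable D ->
  measurable_fun D f -> measurable_fun D g -> measurable_fun D h ->
  (forall t, D t -> (0 <= f t)%R) -> (forall t, D t -> (0 <= g t)%R) -> (forall t, D t -> (0 <= h t)%R) ->
  (forall t, D t -> (f t <= g t + h t)%R) ->
  \int[leb]_(t in D) (f t)%:E <= \int[leb]_(t in D) (g t)%:E + \int[leb]_(t in D) (h t)%:E.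
Proof.
move=> mD mf mg mh f0 g0 h0 fgh; rewrite -ge0_integralD//.
- apply: ge0_le_integral => //.
  + exact/measurable_EFinP.
  + by apply: emeasurable_funD; exact/measurable_EFinP.
- exact/measurable_EFinP.
- exact/measurable_EFinP.
Qed.

Lemma ge0_le_integral_cover (D A B : set R) (f : R -> R) : measurable D -> measurable A -> measurable B ->
  D `<=` A `|` B -> measurable_fun (A `|` B) f -> (forall t, (A `|` B) t -> (0 <= f t)%R) ->
  \int[leb]_(t in D) (f t)%:E <= \int[leb]_(t in A) (f t)%:E + \int[leb]_(t in B) (f t)%:E.
Proof.
move=> mD mA mB DAB mf f0; have mAB : measurable (A `|` B) by exact: measurableU.
apply: (@le_trans _ _ (\int[leb]_(t in A `|` B) (f t)%:E)).
  by apply: ge0_subset_integral => //; exact/measurable_EFinP.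
have mBA : measurable (B `\` A) by exact: measurableD.
have e : A `|` B = A `|` (B `\` A) 
    by apply/seteqP; split => x; have [Ax|nAx] := pselect (A x); [left|case=> // Bx; right|left|case=> // -[? _]; right].
rewrite e ge0_integral_setU//.
- apply: leeD2l; apply: ge0_subset_integral => //.
  + by apply/measurable_EFinP; apply: measurable_funS mf => // x; right.
  + by move=> t Bt; rewrite lee_fin f0//; right.
- by rewrite -e; exact/measurable_EFinP.
- by move=> t; rewrite -e lee_fin; exact: f0.
- by apply/disj_setPS => x [Ax []].
Qed.

Lemma ge0_integral_scale_le (D : set R) (k I : R) (h : R -> R) : measurable D -> measurable_fun setT h ->
  (0 <= k)%R -> (forall t, (0 <= h t)%R) -> \int[leb]_t (h t)%:E <= I%:E ->
  \int[leb]_(t in D) (k * h t)%:E <= (k * I)%:E.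
Proof.
move=> mD mh k0 h0 hI; under eq_integral do rewrite EFinM.
rewrite ge0_integralZl_EFin//; last 2 first.
- by move=> t _; rewrite lee_fin.
- by apply/measurable_EFinP; exact: measurable_funTS.
rewrite EFinM; apply: lee_wpmul2l; first by rewrite lee_fin.
apply: le_trans hI; apply: ge0_subset_integral => //; first exact/measurable_EFinP.
by move=> t _; rewrite lee_fin.
Qed.

(** The measure dt / t is invariant under dilation. *)
Lemma integral_invr_scale (f : R -> R) (sn a b : R) : (0 < sn)%R -> (0 < a)%R -> (a <= b)%R -> continuous f ->
  \int[leb]_(t in `[(a * sn)%R, (b * sn)%R]) (f (t / sn) / t)%:E = \int[leb]_(s in `[a, b]) (f s / s)%:E.
Proof.
move=> sn0 a0 ab cf; pose F (t : R) : R := (t * sn^-1)%R.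
have dF (x : R) : is_derive x 1%R F sn^-1%R.
  by rewrite /F; derive_tac; ring.
have F' : (F^`() = fun=> sn^-1)%classic%R.
  by apply/funext => x; rewrite derive1E; exact: derive_val.
have cF (x : R) : {for x, continuous F} by exact: is_derive_continuous_at (dF x).
have Fa : F (a * sn)%R = a by rewrite /F mulfK// gt_eqF.
have Fb : F (b * sn)%R = b by rewrite /F mulfK// gt_eqF.
have absn : (a * sn <= b * sn)%R by rewrite ler_pM2r.
have := @integration_by_substitution_increasing R F (fun s => (f s / s)%R) (a * sn)%R (b * sn)%R absn.
rewrite F' Fa Fb => -> //.
- apply: eq_integral => t; rewrite inE /= in_itv /= => /andP[at_ tb].
  have t0 : (t != 0)%R by rewrite gt_eqF// (lt_le_trans _ at_)// mulr_gt0.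
  congr EFin; rewrite -[RHS]/(f (t / sn) / (t / sn) * sn^-1)%R.
  by field; rewrite t0 gt_eqF.
- by move=> x y _ _ xy; rewrite /F ltr_pM2r// invr_gt0.
- by move=> x _; exact: cvg_cst.
- exact: is_cvg_cst.
- exact: is_cvg_cst.
- split.
  + by move=> x _; case: (dF x).
  + by apply: cvg_at_right_filter; exact: cF.
  + by apply: cvg_at_left_filter; exact: cF.
apply: continuous_in_subspaceT => x; rewrite inE /= in_itv /= => /andP[ax _].
apply: cvgM; first exact: cf.
by apply: cvgV => //; rewrite gt_eqF// (lt_le_trans a0).
Qed.

End range_splitting.

Lemma continuous_nc (R : realType) (f : R -> R[i]) : continuous (fun s : R => Re (f s) : R) ->
  continuous (fun s : R => Im (f s) : R) -> continuous (fun s : R => nc (f s) : R).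
Proof.
move=> cfr cfi.
have -> : (fun s : R => nc (f s)) = (fun s => Num.sqrt (Re (f s) ^+ 2 + Im (f s) ^+ 2)).
  by apply/funext => s; case: (f s).
move=> s; apply: (@continuous_comp _ _ _ (fun s : R => Re (f s) ^+ 2 + Im (f s) ^+ 2) Num.sqrt).
  by apply: cvgD; apply: cvgM; [exact: cfr|exact: cfr|exact: cfi|exact: cfi].
exact: sqrt_continuous.
Qed.

Section three_ranges.
Context {R : realType}.
Notation leb := (@lebesgue_measure R).
Variables (f : R -> R[i]) (gr gi : R -> R) (V sn c T K k1 k2 k3 I8 I4 a D : R).
Hypotheses (V0 : 0 < V) (sn0 : 0 < sn) (c0 : 0 < c) (K0 : 0 < K).
Hypotheses (k10 : 0 <= k1) (k20 : 0 <= k2) (k30 : 0 <= k3) (a0 : 0 <= a) (D0 : 0 <= D).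
Hypotheses (cfr : continuous (fun s : R => Re (f s) : R)) (cfi : continuous (fun s : R => Im (f s) : R)).
Hypotheses (cgr : continuous gr) (cgi : continuous gi).
Let U t := `|Re (f (t / sn)) - gr t| + `|Im (f (t / sn)) - gi t|.
Let w q (t : R) := expR (- (V / q) * t ^+ 2).
Hypothesis near0 : forall t, 0 < t -> t < c -> U t <= t * (k1 + k2 * w 8 t).
Hypothesis gauss : forall t, c <= t -> `|gr t| + `|gi t| <= t * (k3 * w 4 t).
Hypothesis middle : forall s, c / sn <= s -> s <= K -> nc (f s) <= a.
Hypothesis far : (\int[leb]_(s in `[K, (T / sn)%R]) (nc (f s) / s)%:E <= D%:E)%E.
Hypothesis hI8 : (\int[leb]_t (w 8 t)%:E <= I8%:E)%E.
Hypothesis hI4 : (\int[leb]_t (w 4 t)%:E <= I4%:E)%E.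

Let cnc := continuous_nc cfr cfi.

Let cw q : continuous (w q).
Proof. by rewrite /w; continuous_tac. Qed.

Let csn : continuous (fun t : R => t / sn).
Proof. by continuous_tac. Qed.

Let cU : continuous U.
Proof.
move=> t; have h (g h : R -> R) : continuous g -> continuous h -> {for t, continuous (fun u : R => `|g (u / sn) - h u| : R)}.
  move=> cg ch; apply: (@continuous_comp _ _ _ (fun u : R => g (u / sn) - h u : R) Num.norm); last exact: norm_continuous.
  apply: cvgB; last exact: ch.
  by apply: (@continuous_comp _ _ _ (fun u : R => u / sn) g); [exact: csn|exact: cg].
by apply: cvgD; [exact: (h _ _ cfr cgr)|exact: (h _ _ cfi cgi)].
Qed.

Let mUt : measurable_fun setT (fun t => U t / t).
Proof.
apply: measurable_funM; first exact: continuous_measurable_fun.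
exact: measurable_funV.
Qed.

Let mnc : measurable_fun setT (fun t : R => nc (f (t / sn)) / t : R).
Proof.
apply: measurable_funM; last exact: measurable_funV.
apply: (@measurableT_comp _ _ _ _ _ _ (fun s : R => nc (f s) : R) _ (fun t : R => t / sn : R)); exact: continuous_measurable_fun.
Qed.

Let mw q : measurable_fun setT (w q). Proof. exact: continuous_measurable_fun. Qed.

Let Ut_ge0 t : 0 <= t -> 0 <= U t / t.
Proof. by move=> t0; rewrite divr_ge0// addr_ge0. Qed.

Let Ut_far t : c <= t -> U t / t <= 2 * (nc (f (t / sn)) / t) + k3 * w 4 t.
Proof.
move=> ct; have t0 : 0 < t by exact: lt_le_trans ct.
rewrite ler_pdivrMr// mulrDl mulrA mulfVK ?gt_eqF//.
have h := gauss ct; rewrite mulrC in h.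
have := ler_normB (Re (f (t / sn))) (gr t); have := ler_normB (Im (f (t / sn))) (gi t).
have := Re_le_nc (f (t / sn)); have := Im_le_nc (f (t / sn)); rewrite /U; lra.
Qed.

Local Open Scope ereal_scope.

(** Below c the approximation is divided by t and integrated. Beyond c the two transforms are
    bounded separately: the real and imaginary parts of f by its modulus, whence the factors 2, and
    the Gaussian tail is charged to each of the two outer ranges. In the middle, 1 / t <= 1 / c and
    the length is at most K sn. *)
Lemma integral_three_ranges :
  \int[leb]_(t in `]0%R, T]) (U t / t)%:E <=
  (k1 * c + k2 * I8 + 2 * (k3 * I4) + 2 * (a * K * sn / c) + 2 * D)%R%:E.
Proof.
have mT (g : R -> R) A : measurable_fun setT g -> measurable_fun A g by exact: measurable_funTS.
pose A1 : set R := `]0%R, c[%classic.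
pose A2 : set R := `[c, (K * sn)%R]%classic.
(* The maximum covers the case K sn < c, where the middle range is empty. *)
pose A3 : set R := `[(Num.max c (K * sn))%R, T]%classic.
have mA1 : measurable A1 by exact: measurable_itv.
have mA2 : measurable A2 by exact: measurable_itv.
have mA3 : measurable A3 by exact: measurable_itv.
have I40 : (0 <= I4)%R.
  by rewrite -lee_fin; apply: le_trans hI4; apply: integral_ge0 => t _; rewrite lee_fin expR_ge0.
have Ksn0 : (0 < K * sn)%R by rewrite mulr_gt0.
have h1 : \int[leb]_(t in A1) (U t / t)%:E <= (k1 * c + k2 * I8)%:E.
  apply: (@le_trans _ _ (\int[leb]_(t in A1) (k1)%:E + \int[leb]_(t in A1) (k2 * w 8 t)%:E)).
    apply: (@ge0_le_integralD R _ (fun t => U t / t)%R (fun=> k1) (fun t => k2 * w 8 t)%R) => //.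
    - exact: (mT _ _ mUt).
    - by apply: mT; apply: measurable_funM.
    - by move=> t; rewrite /A1 /= in_itv /= => /andP[t0 _]; exact/Ut_ge0/ltW.
    - by move=> t _; rewrite mulr_ge0// expR_ge0.
    - move=> t; rewrite /A1 /= in_itv /= => /andP[t0 tc].
      by rewrite ler_pdivrMr// mulrC; exact: near0.
  rewrite EFinD; apply: leeD.
    rewrite integral_cst//= lebesgue_measure_itv/= lte_fin c0 -EFinD -EFinM subr0//.
  by apply: ge0_integral_scale_le => // t; exact: expR_ge0.
have h2 : \int[leb]_(t in A2) (U t / t)%:E <= (2 * (a * K * sn / c) + k3 * I4)%:E.
  apply: (@le_trans _ _ (\int[leb]_(t in A2) (2 * (a / c))%:E + \int[leb]_(t in A2) (k3 * w 4 t)%:E)).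
    apply: (@ge0_le_integralD R _ (fun t => U t / t)%R (fun=> 2 * (a / c))%R (fun t => k3 * w 4 t)%R) => //.
    - exact: (mT _ _ mUt).
    - by apply: mT; apply: measurable_funM.
    - by move=> t; rewrite /A2 /= in_itv /= => /andP[ct _]; exact/Ut_ge0/ltW/(lt_le_trans c0).
    - by move=> t _; rewrite mulr_ge0// divr_ge0// ltW.
    - by move=> t _; rewrite mulr_ge0// expR_ge0.
    - move=> t; rewrite /A2 /= in_itv /= => /andP[ct tK].
      have t0 : (0 < t)%R by exact: lt_le_trans ct.
      apply: (le_trans (Ut_far ct)); rewrite lerD2r ler_pM2l//.
      apply: ler_pM; rewrite ?nc_ge0 ?invr_ge0 ?(ltW t0)//.
        by apply: middle; rewrite ?ler_pM2r ?invr_gt0// ler_pdivrMr.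
      by rewrite lef_pV2 ?posrE.
  rewrite EFinD; apply: leeD; last by apply: ge0_integral_scale_le => // t; exact: expR_ge0.
  rewrite integral_cst//= lebesgue_measure_itv/= lte_fin; case: ifPn => _.
    rewrite -EFinD -EFinM lee_fin.
    have -> : (2 * (a * K * sn / c) = 2 * (a / c) * (K * sn))%R by ring.
    apply: ler_wpM2l; first by rewrite mulr_ge0 ?divr_ge0 ?(ltW c0).
    by rewrite lerBlDr lerDl ltW.
  rewrite mule0 lee_fin; apply: mulr_ge0 => //; apply: divr_ge0; last exact: ltW.
  by rewrite !mulr_ge0 ?(ltW K0) ?(ltW sn0).
have h3 : \int[leb]_(t in A3) (U t / t)%:E <= (2 * D + k3 * I4)%:E.
  have A3c t : A3 t -> (c <= t)%R /\ (K * sn <= t)%R.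
    by rewrite /A3 /= in_itv /= ge_max => /andP[/andP[]].
  apply: (@le_trans _ _ (\int[leb]_(t in A3) (2 * (nc (f (t / sn)) / t))%:E + \int[leb]_(t in A3) (k3 * w 4 t)%:E)).
    apply: (@ge0_le_integralD R _ (fun t => U t / t)%R (fun t => 2 * (nc (f (t / sn)) / t))%R (fun t => k3 * w 4 t)%R) => //.
    - exact: (mT _ _ mUt).
    - by apply: mT; apply: measurable_funM.
    - by apply: mT; apply: measurable_funM.
    - by move=> t /A3c[ct _]; exact/Ut_ge0/ltW/(lt_le_trans c0).
    - move=> t /A3c[ct _]; apply: mulr_ge0 => //; apply: divr_ge0; first exact: nc_ge0.
      exact/ltW/(lt_le_trans c0).
    - by move=> t _; rewrite mulr_ge0// expR_ge0.
    - by move=> t /A3c[ct _]; exact: Ut_far.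
  rewrite EFinD; apply: leeD; last by apply: ge0_integral_scale_le => // t; exact: expR_ge0.
  under eq_integral do rewrite EFinM.
  have ncpos t : (K * sn <= t)%R -> (0 <= nc (f (t / sn)) / t)%R.
    by move=> Kt; rewrite divr_ge0 ?nc_ge0// ltW// (lt_le_trans _ Kt).
  rewrite ge0_integralZl_EFin//; last 2 first.
  - by move=> t /A3c[_ Kt]; rewrite lee_fin; exact: ncpos.
  - by apply/measurable_EFinP; exact: mT.
  rewrite EFinM; apply: lee_wpmul2l; first by rewrite lee_fin.
  apply: (@le_trans _ _ (\int[leb]_(t in `[(K * sn)%R, T]) (nc (f (t / sn)) / t)%:E)).
    apply: ge0_subset_integral => //.
    - by apply/measurable_EFinP; exact: mT.
    - by move=> t /=; rewrite in_itv /= => /andP[Kt _]; rewrite lee_fin; exact: ncpos.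
    - by move=> t h; have [_ Kt] := A3c _ h; move: h; rewrite /A3 /= !in_itv /= Kt => /andP[].
  have [TK|KT] := ltP (T / sn)%R K.
    rewrite set_itv_ge ?integral_set0 ?lee_fin// bnd_simp -ltNge.
    by rewrite -ltr_pdivrMr.
  have -> : T = (T / sn * sn)%R by rewrite mulfVK// gt_eqF.
  by rewrite (@integral_invr_scale _ (fun s : R => nc (f s) : R)).
apply: (@le_trans _ _ (\int[leb]_(t in A1) (U t / t)%:E + \int[leb]_(t in A2 `|` A3) (U t / t)%:E)).
  apply: ge0_le_integral_cover => //; first exact: measurableU.
  - move=> t /=; rewrite in_itv /= => /andP[t0 tT]; rewrite /A1 /A2 /A3 /= !in_itv /= t0 tT ge_max.
    have [tc|ct] := ltP t c; first by left.
    by right; have [tK|Kt] := leP t (K * sn)%R; [left|right; rewrite ltW].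
  - exact: mT.
  - move=> t [|]; rewrite /A1 /A2 /A3 /= !in_itv /=.
      by move=> /andP[t0 _]; exact/Ut_ge0/ltW.
    by case=> /andP[ct _]; apply/Ut_ge0/ltW; apply: lt_le_trans ct; rewrite ?lt_max c0.
apply: (@le_trans _ _ ((k1 * c + k2 * I8)%:E + ((2 * (a * K * sn / c) + k3 * I4)%:E + (2 * D + k3 * I4)%:E))).
  apply: leeD => //; apply: le_trans (leeD h2 h3).
  apply: ge0_le_integral_cover => //; first exact: measurableU.
  - exact: mT.
  - move=> t; rewrite /A2 /A3 /= !in_itv /=.
    by case=> /andP[ct _]; apply/Ut_ge0/ltW; apply: lt_le_trans ct; rewrite ?lt_max c0.
by rewrite -!EFinD lee_fin; lra.
Qed.

End three_ranges.

(** * Polynomials of the expansion and the theorem *)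

Section edgeworth_family.
Context {R : realType}.
Variables (V : R) (M J : nat) (alpha : nat -> nat -> R).
Hypothesis V0 : 0 < V.

Definition edgeworth_coef (e : R) (j : nat) : R := \sum_(l < M) e ^+ l.+1 * alpha l j.

Definition edgeworth_term (l : nat) : {poly R} := - \sum_(j < J) alpha l j *: hermite_gauss V j.

Lemma edgeworth_polyE e :
  edgeworth_poly V J (edgeworth_coef e) = \sum_(l < M) e ^+ l.+1 *: edgeworth_term l.
Proof.
rewrite /edgeworth_poly /edgeworth_term; under [RHS]eq_bigr do rewrite scalerN scaler_sumr.
rewrite sumrN exchange_big; congr (- _); apply: eq_bigr => j _ /=.
by rewrite scaler_suml; apply: eq_bigr => l _; rewrite scalerA.
Qed.

Lemma edgeworth_coef_le e j : 0 <= e -> e <= 1 -> `|edgeworth_coef e j| <= \sum_(l < M) `|alpha l j|.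
Proof.
move=> e0 e1; apply: (le_trans (ler_norm_sum _ _ _)); apply: ler_sum => l _.
by rewrite normrM ler_piMl// ger0_norm ?exprn_ge0// exprn_ile1.
Qed.

(** Uniformity in e, which will be n^(-1/2), lets the cutoff T be a constant times n^(r/2). *)
Lemma edgeworth_lipschitz : exists2 L, 0 < L & forall e x y, 0 <= e -> e <= 1 -> x <= y ->
  gauss_cdf V y + (edgeworth_poly V J (edgeworth_coef e)).[y] * gauss_pdf V y -
  (gauss_cdf V x + (edgeworth_poly V J (edgeworth_coef e)).[x] * gauss_pdf V x) <= L * (y - x).
Proof.
have [Lg Lg0 hLg] := gauss_cdf_lipschitz V0.
have /choice[Lp hLp] l : exists L, 0 < L /\ forall x y : R, x <= y ->
    `|(edgeworth_term l).[y] * gauss_pdf V y - (edgeworth_term l).[x] * gauss_pdf V x| <= L * (y - x).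
  by have [L L0 hL] := horner_gauss_lipschitz V0 (edgeworth_term l); exists L.
exists (Lg + \sum_(l < M) Lp l).
  by rewrite ltr_wpDr// sumr_ge0// => l _; rewrite ltW//; case: (hLp l).
move=> e x y e0 e1 xy.
rewrite opprD addrACA mulrDl; apply: lerD; first exact: hLg.
rewrite edgeworth_polyE !horner_sum !mulr_suml -sumrB; apply: ler_sum => l _.
rewrite !hornerZ -!mulrA -mulrBr; have [L0 hL] := hLp l.
apply: (le_trans (ler_norm _)); rewrite normrM (ger0_norm (exprn_ge0 _ e0)).
by apply: le_trans (hL _ _ xy); rewrite ler_piMl// exprn_ile1.
Qed.

End edgeworth_family.

Section gaussian_tail.
Context {R : realType}.
Variables (V : R) (J : nat).
Hypothesis V0 : 0 < V.

(** Half of the Gaussian absorbs all polynomial factors and m further powers of t. For c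
    proportional to sqrt n, this makes the tail smaller than n^(-m/2) by a factor n^(-1/2). The
    factor t in front is reserved for the weight 1 / t, and [b] bounds the coefficients uniformly in
    n. *)
Lemma edgeworth_tail (m : nat) (b : nat -> R) : exists2 C, 0 < C & forall beta c t,
  (forall j, `|beta j| <= b j) -> 0 < c -> c <= t ->
  `|edgeworth_re V J beta t| + `|edgeworth_im V J beta t| <=
  t * (C / c ^+ m.+1 * expR (- (V / 4) * t ^+ 2)).
Proof.
pose q : {poly R} := (2%:P + 2%:P * \sum_(j < J) b j *: 'X^(j.+1)) * 'X^m.
have [C C0 hC] := horner_le_expR q (divr_gt0 V0 (ltr0n R 4)).
exists C => // beta c t hb c0 ct; have t0 : 0 < t by exact: lt_le_trans ct.
pose E := expR (- (V / 2) * t ^+ 2); have E0 : 0 <= E by exact: expR_ge0.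
pose s := \sum_(j < J) b j * t ^+ j.+1.
have term (g : R -> R) : (forall x, `|g x| <= 1) ->
    `|\sum_(j < J) beta j * t ^+ j.+1 * g (pi / 2 *+ j.+1)| <= s.
  move=> g1; apply: (le_trans (ler_norm_sum _ _ _)); apply: ler_sum => j _.
  rewrite !normrM normrX (gtr0_norm t0); apply: (@le_trans _ _ (`|beta j| * t ^+ j.+1)).
    by rewrite ler_piMr// mulr_ge0// exprn_ge0// ltW.
  by apply: ler_wpM2r => //; apply: exprn_ge0; exact: ltW.
have hre : `|edgeworth_re V J beta t| <= E * (1 + s).
  rewrite /edgeworth_re normrM (ger0_norm E0); apply: ler_wpM2l => //.
  apply: (le_trans (ler_normD _ _)); rewrite normr1 lerD2l; apply: term => x.
  by rewrite ler_norml cos_geN1 cos_le1.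
have him : `|edgeworth_im V J beta t| <= E * (1 + s).
  rewrite /edgeworth_im normrM (ger0_norm E0); apply: ler_wpM2l => //.
  rewrite -[leLHS]add0r; apply: lerD => //; apply: term => x.
  by rewrite ler_norml sin_geN1 sin_le1.
have qE : q.[t] = (2 + 2 * s) * t ^+ m.
  rewrite /q hornerM hornerD hornerM !hornerC hornerXn horner_sum; congr ((_ + _ * _) * _).
  by apply: eq_bigr => j _; rewrite hornerZ hornerXn.
have hq : (2 + 2 * s) * t ^+ m <= C * expR (V / 4 * t ^+ 2).
  by rewrite -qE; apply: le_trans (hC t); exact: ler_norm.
apply: (le_trans (lerD hre him)).
have -> : E * (1 + s) + E * (1 + s) = (2 + 2 * s) * t ^+ m * E / t ^+ m.
  by field; rewrite expf_neq0// gt_eqF.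
have EE : E = expR (- (V / 4) * t ^+ 2) * (expR (V / 4 * t ^+ 2))^-1.
  by rewrite -expRN -expRD /E; congr expR; field.
apply: (@le_trans _ _ (C * expR (V / 4 * t ^+ 2) * E / t ^+ m)).
  apply: ler_wpM2r; first by rewrite invr_ge0 exprn_ge0// ltW.
  by apply: ler_wpM2r.
set w := expR (- (V / 4) * t ^+ 2).
have w0 : 0 <= w by exact: expR_ge0.
have -> : C * expR (V / 4 * t ^+ 2) * E / t ^+ m = t * (C / t ^+ m.+1 * w).
  by rewrite EE -/w (exprS _ m); field; rewrite expf_neq0 ?(gt_eqF (expR_gt0 _)) ?(gt_eqF t0).
apply: ler_wpM2l; first exact: ltW.
apply: ler_wpM2r => //; apply: ler_wpM2l; first exact: ltW.
rewrite lef_pV2 ?posrE ?exprn_gt0//; apply: lerXn2r => //; rewrite nnegrE ltW//.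
Qed.

Lemma gauss_mass (c : R) : 0 < c -> exists2 I, 0 <= I &
  (\int[@lebesgue_measure R]_t (expR (- c * t ^+ 2))%:E <= I%:E)%E.
Proof.
move=> c0; pose I := (\int[@lebesgue_measure R]_t (expR (- c * t ^+ 2))%:E)%E.
have I0 : (0 <= I)%E by apply: integral_ge0 => t _; rewrite lee_fin expR_ge0.
have fI : I \is a fin_num.
  have := integrable_fin_num measurableT (integrable_gauss 0 c0).
  by congr (_ \is a fin_num); apply: eq_integral => t _ /=; rewrite sub0r sqrrN.
by exists (fine I); [exact: fine_ge0|rewrite fineK].
Qed.

Lemma continuous_edgeworth_re (beta : nat -> R) : continuous (edgeworth_re V J beta).
Proof.
have -> : edgeworth_re V J beta = fun t => expR (- (V / 2) * t ^+ 2) *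
    (1 + \sum_(j < J) (beta j * cos (pi / 2 *+ j.+1)) *: 'X^(j.+1)).[t].
  apply/funext => t; rewrite hornerD hornerC horner_sum; congr (_ * (_ + _)).
  by apply: eq_bigr => j _; rewrite hornerZ hornerXn mulrAC.
by continuous_tac.
Qed.

Lemma continuous_edgeworth_im (beta : nat -> R) : continuous (edgeworth_im V J beta).
Proof.
have -> : edgeworth_im V J beta = fun t => expR (- (V / 2) * t ^+ 2) *
    (\sum_(j < J) (beta j * sin (pi / 2 *+ j.+1)) *: 'X^(j.+1)).[t].
  apply/funext => t; rewrite horner_sum; congr (_ * _).
  by apply: eq_bigr => j _; rewrite hornerZ hornerXn mulrAC.
by continuous_tac.
Qed.

End gaussian_tail.

Section characteristic_function.
Context {R : realType} {d : measure_display} {T : measurableType d}.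
Variables (mu : probability T R) (S psi : nat -> T -> R) (n : nat).
Hypotheses (mS : measurable_fun setT (S n)) (mpsi : measurable_fun setT (psi n)).
Hypotheses (psi0 : forall w, 0 <= psi n w) (psi1 : (\int[mu]_w (psi n w)%:E = 1)%E).

Lemma integrable_density : mu.-integrable setT (EFin \o psi n).
Proof.
apply/integrableP; split; first exact/measurable_EFinP.
have -> : (\int[mu]_w `|(EFin \o psi n) w| = \int[mu]_w (psi n w)%:E)%E.
  by apply: eq_integral => w _ /=; rewrite ger0_norm.
by rewrite psi1 ltry.
Qed.

Lemma charf_opp s : charf mu S psi n (- s) = conjc (charf mu S psi n s).
Proof.
rewrite /charf; apply: complex_eqP => /=.
  by apply: eq_Rintegral => w _; rewrite mulNr cosN.
rewrite -mulN1r -RintegralZl//; last first.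
  have := integrable_trig integrable_density mS s 0 (@continuous_sin R) (@sin_max R).
  by apply: eq_integrable => // w _ /=; rewrite addr0.
by apply: eq_Rintegral => w _; rewrite mulNr sinN; ring.
Qed.

Lemma charf_at0 : charf mu S psi n 0 = 1.
Proof.
rewrite /charf; apply: complex_eqP => /=.
  have -> : \int[mu]_w (psi n w * cos (0 * S n w)) = \int[mu]_w (psi n w).
    by apply: eq_Rintegral => w _; rewrite mul0r cos0 mulr1.
  by rewrite /Rintegral psi1.
have -> : \int[mu]_w (psi n w * sin (0 * S n w)) = \int[mu]_w (0 : R).
  by apply: eq_Rintegral => w _; rewrite mul0r sin0 mulr0.
by rewrite /Rintegral integral0.
Qed.

Lemma continuous_charf_re : continuous (fun s : R => Re (charf mu S psi n s) : R).
Proof. exact: (continuous_trig integrable_density mS (@continuous_cos R) (@cos_max R)). Qed.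

Lemma continuous_charf_im : continuous (fun s : R => Im (charf mu S psi n s) : R).
Proof. exact: (continuous_trig integrable_density mS (@continuous_sin R) (@sin_max R)). Qed.

End characteristic_function.

Section rates.
Context {R : realType}.
Implicit Types (n k : nat) (x y r : R).

Lemma powR_half n k : n%:R `^ (k%:R / 2) = Num.sqrt n%:R ^+ k :> R.
Proof. by rewrite mulrC powRrM powR12_sqrt// powR_mulrn// sqrtr_ge0. Qed.

Lemma invr_sqrtXE n k : (Num.sqrt n%:R)^-1 ^+ k = n%:R `^ (- (k%:R / 2)) :> R.
Proof. by rewrite powRN powR_half exprVn. Qed.

Lemma powR_negligible x y eta : x < y -> 0 < eta ->
  \forall n \near \oo, (n%:R `^ (- y) : R) <= eta * n%:R `^ (- x).
Proof.
move=> xy eta0; near=> n.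
have n1 : (1 : R) <= n%:R by rewrite ler1n; near: n; exact: nbhs_infty_ge.
have n0 : (0 : R) < n%:R by rewrite (lt_le_trans _ n1).
have yx : 0 < y - x by rewrite subr_gt0.
have h : (eta^-1 `^ (y - x)^-1 : R) <= n%:R by near: n; exact: nbhs_infty_ger.
have h2 : (eta^-1 : R) <= n%:R `^ (y - x).
  have := @ge0_ler_powR R (y - x) (ltW yx) _ _ (powR_ge0 _ _) (ltW n0) h.
  by rewrite -powRrM mulVf ?gt_eqF// powRr1// invr_ge0 ltW.
rewrite (_ : - x = - y + (y - x)); last by ring.
rewrite powRD; last by apply/implyP => _; rewrite gt_eqF.
rewrite mulrCA ler_peMr ?powR_ge0//.
by rewrite mulrC -ler_pdivrMr// div1r.
Unshelve. all: by end_near. Qed.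

Lemma SP_small_sqrt (a : nat -> R) k eta : SP a -> 0 < eta ->
  \forall n \near \oo, `|a n| <= eta * (Num.sqrt n%:R)^-1 ^+ k.
Proof.
move=> ha eta0; near=> n.
have n1 : (1 : R) <= n%:R by rewrite ler1n; near: n; exact: nbhs_infty_ge.
have s1 : (1 : R) <= Num.sqrt n%:R by rewrite -[leLHS]sqrtr1 ler_sqrt// (le_trans _ n1).
rewrite exprVn ler_pdivlMr ?exprn_gt0 ?(lt_le_trans _ s1)//.
have h : `|a n| * n%:R ^+ k <= eta by near: n; exact: SP_small.
apply: le_trans h; apply: ler_wpM2l => //; apply: lerXn2r; rewrite ?nnegrE ?sqrtr_ge0//.
by rewrite -[leRHS]sqr_sqrtr// expr2 ler_peMl// sqrtr_ge0.
Unshelve. all: by end_near. Qed.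

End rates.

Section edgeworth_error.
Context {R : realType} {d : measure_display} {X : measurableType d}.
Notation leb := (@lebesgue_measure R).
Variables (mu : probability X R) (S psi : nat -> X -> R) (n : nat).
Hypotheses (mS : measurable_fun setT (S n)) (mpsi : measurable_fun setT (psi n)).
Hypotheses (psi0 : forall w, 0 <= psi n w) (psi1 : (\int[mu]_w (psi n w)%:E = 1)%E).
Hypothesis n1 : (1 <= n)%N.
Variables (V T c K k1 k2 k3 I8 I4 a D L : R) (J : nat) (beta : nat -> R).
Let f := charf mu S psi n.
Let sn := Num.sqrt n%:R : R.
Let gr := edgeworth_re V J beta.
Let gi := edgeworth_im V J beta.
Hypotheses (V0 : 0 < V) (T0 : 0 < T) (c0 : 0 < c) (K0 : 0 < K) (L0 : 0 < L).
Hypotheses (k10 : 0 <= k1) (k20 : 0 <= k2) (k30 : 0 <= k3) (a0 : 0 <= a) (D0 : 0 <= D).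
Hypothesis lip : forall x y, x <= y ->
  gauss_cdf V y + (edgeworth_poly V J beta).[y] * gauss_pdf V y -
  (gauss_cdf V x + (edgeworth_poly V J beta).[x] * gauss_pdf V x) <= L * (y - x).
Hypothesis near0 : forall t, 0 < t -> t < c ->
  `|Re (f (t / sn)) - gr t| + `|Im (f (t / sn)) - gi t| <= t * (k1 + k2 * expR (- (V / 8) * t ^+ 2)).
Hypothesis gauss : forall t, c <= t -> `|gr t| + `|gi t| <= t * (k3 * expR (- (V / 4) * t ^+ 2)).
Hypothesis middle : forall s, c / sn <= s -> s <= K -> nc (f s) <= a.
Hypothesis far : (\int[leb]_(s in `[K, (T / sn)%R]) (nc (f s) / s)%:E <= D%:E)%E.
Hypothesis hI8 : (\int[leb]_t (expR (- (V / 8) * t ^+ 2))%:E <= I8%:E)%E.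
Hypothesis hI4 : (\int[leb]_t (expR (- (V / 4) * t ^+ 2))%:E <= I4%:E)%E.

(** The non-asymptotic form of the theorem, for one fixed n: smoothing is applied to S_n / sqrt n
    and the integral is split, so that only the choice of parameters remains. *)
Lemma edgeworth_error x :
  `|Pn_cdf mu S psi n x - gauss_cdf V x - (edgeworth_poly V J beta).[x] * gauss_pdf V x| <=
  16 * (k1 * c + k2 * I8 + 2 * (k3 * I4) + 2 * (a * K * sn / c) + 2 * D) + 400 * (L / T).
Proof.
have sn0 : 0 < sn by rewrite sqrtr_gt0 ltr0n.
have mSn : measurable_fun setT (fun w => S n w / sn) by exact: measurable_funM.
have ip := integrable_density mpsi psi0 psi1.
refine (@edgeworth_smoothing _ _ _ mu _ _ _ _ J beta V0 T0 ip mSn psi0 _ _ L0 lip _ x).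
have := integral_three_ranges sn0 c0 K0 k10 k20 k30 a0 D0
  (continuous_charf_re mS mpsi psi0 psi1) (continuous_charf_im mS mpsi psi0 psi1)
  (@continuous_edgeworth_re R V J beta) (@continuous_edgeworth_im R V J beta)
  near0 gauss middle far hI8 hI4.
have re t : \int[mu]_w (psi n w * cos (t * (S n w / sn))) = Re (f (t / sn)).
  by apply: eq_Rintegral => w _; congr (_ * cos _); rewrite mulrCA mulrC.
have im t : \int[mu]_w (psi n w * sin (t * (S n w / sn))) = Im (f (t / sn)).
  by apply: eq_Rintegral => w _; congr (_ * sin _); rewrite mulrCA mulrC.
apply: le_trans; rewrite le_eqVlt; apply/orP; left; apply/eqP; apply: eq_integral => t _.
by rewrite re im.
Qed.

End edgeworth_error.

Theorem theorem1p6 (R : realType) (d : measure_display) (T : measurableType d)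
  (mu : probability T R) (S psi : nat -> T -> R) (r' : nat) (r : R) (sigma2 : R) :
  (0 < r')%N -> 1 <= r ->
  (forall n, (1 <= n)%N -> measurable_fun setT (S n)) ->
  (forall n, (1 <= n)%N -> measurable_fun setT (psi n)) ->
  (forall n, (1 <= n)%N -> forall w, 0 <= psi n w) ->
  (forall n, (1 <= n)%N -> (\int[mu]_w (psi n w)%:E = 1)%E) ->
  assumption_alpha mu S psi r' sigma2 ->
  assumption_beta mu S psi ->
  assumption_delta mu S psi r ->
  exists P : nat -> {poly R},
    forall eps : R, 0 < eps -> \forall n \near \oo, forall x : R,
      `| Pn_cdf mu S psi n x - gauss_cdf sigma2 x
         - gauss_pdf sigma2 x *
             \sum_(1 <= k < (minn r' (Num.truncn r)).+1)
                 (P k).[x] / (n%:R `^ (k%:R / 2)) |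
      <= eps * (n%:R `^ (- (Num.min r r'%:R / 2))).
Proof.
move=> m0 r1 mS mpsi psi0 psi1 [V0 [delta [delta0 [n0 [n01 [Cf [b [a [lam [B [hb [ha [Clam [lamN0 [lam2 [jetH boundH]]]]]]]]]]]]]]]] hbeta hdelta.
pose f := charf mu S psi.
have f0 n : (1 <= n)%N -> f n 0 = 1 by move=> n1; apply: charf_at0; exact: psi1.
have fconj n s : (1 <= n)%N -> f n (- s) = conjc (f n s).
  by move=> n1; apply: charf_opp; [exact: mS|exact: mpsi|exact: psi0|exact: psi1].
have [A [A0 Al hA]] := charf_expansion V0 delta0 f0 Cf hb ha Clam lamN0 lam2 jetH boundH.
pose M := minn r' (Num.truncn r).
pose rho (n : nat) : R := n%:R `^ (- (Num.min r r'%:R / 2)).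
have rhoP : \forall n \near \oo, n%:R `^ (- (r / 2)) <= rho n /\ (Num.sqrt n%:R)^-1 ^+ r' <= rho n.
  near=> n; have n1 : (1 : R) <= n%:R by rewrite ler1n; near: n; exact: nbhs_infty_ge.
  rewrite invr_sqrtXE /rho; split; apply: ler_powR => //; rewrite lerN2 ler_pM2r ?invr_gt0//.
    by rewrite ge_min lexx.
  by rewrite ge_min lexx orbT.
have rho_m : \forall n \near \oo, (Num.sqrt n%:R)^-1 ^+ r' <= rho n.
  by apply: filterS rhoP => n [].
(* The first omitted order M + 1 exceeds min (r, r'), since the integer part of r plus one is
   greater than r. *)
have rho_M (eta : R) : 0 < eta -> \forall n \near \oo, (Num.sqrt n%:R)^-1 ^+ M.+1 <= eta * rho n.
  move=> eta0; have lt : Num.min r r'%:R / 2 < M.+1%:R / 2 :> R.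
    rewrite ltr_pM2r ?invr_gt0// /M; case: leqP => _.
      by rewrite gt_min ltr_nat ltnSn orbT.
    by rewrite gt_min truncnS_gt.
  by apply: filterS (powR_negligible lt eta0) => n; rewrite invr_sqrtXE.
have [alpha [J [C [C0 hC]]]] := charf_near_zero V0 A0 Al fconj hA rho_m rho_M.
have [L L0 hL] := edgeworth_lipschitz M J alpha V0.
have [C3 C30 hC3] := @edgeworth_tail R sigma2 J V0 r' (fun j => \sum_(l < M) `|alpha l j|).
have [I8 I80 hI8] := gauss_mass (divr_gt0 V0 (ltr0n R 8)).
have [I4 I40 hI4] := gauss_mass (divr_gt0 V0 (ltr0n R 4)).
(* The terms are numbered from 0 and the polynomials from 1, hence the predecessor. *)
exists (fun k => edgeworth_term sigma2 J alpha k.-1) => eps eps0.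
have Q0 : 0 < 4 + C * I8 by rewrite ltr_wpDr// mulr_ge0// ltW.
(* Four of the five error terms cost at most eta rho each and the Gaussian one costs C I8 eta rho.
   Multiplied by 16 they sum to eps rho / 2; the other half is left for 400 L / T'. *)
pose eta := eps / (32 * (4 + C * I8)).
have eta0 : 0 < eta by rewrite divr_gt0// mulr_gt0.
have [q q0 qE] : exists2 q : R, 0 < q & q = 400 * L.
  by exists (400 * L); [apply: mulr_gt0 L0; rewrite ltr0n|exact: erefl].
(* With T' = (Bd / 2) n^(r/2) this makes 400 L / T' equal to (eps / 2) n^(-r/2). Only half of Bd is
   used, so that the closed range up to T' / sqrt n stays inside the strict bound of (delta). *)
pose Bd := 4 * q / eps.
have Bd0 : 0 < Bd by rewrite divr_gt0// mulr_gt0.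
have [K [K0 hK]] := hdelta _ Bd0.
have [dl0 dl00 hdl] := hC _ eta0.
(* With dl <= 1 the part of the error without Gaussian decay integrates to at most eta rho over t <
   dl sqrt n. *)
pose dl := Num.min dl0 1.
have dlp : 0 < dl by rewrite lt_min dl00 ltr01.
(* (delta) speaks of |s| > K strictly, whereas the far range is closed at its lower end; starting it
   at K + 1 settles this, and (beta) covers [dl, K + 1]. *)
have Kp : 0 < K + 1 by rewrite addr_gt0.
have [a' [SPa' ha']] : exists a' : nat -> R, SP a' /\
    forall n, (1 <= n)%N -> forall s, dl <= s -> s <= K + 1 -> nc (f n s) <= a' n.
  have [|a' [SPa' ha']] := hbeta `[dl, K + 1]%classic (@segment_compact R _ _).
    by move=> s /=; rewrite in_itv /= => /andP[ds _] s0; move: ds; rewrite s0 leNgt dlp.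
  exists a'; split=> // n n1 s ds sK; apply: ha' => //=.
  by rewrite in_itv /= ds.
pose G := C3 * I4 / dl ^+ r'.+1 + 1.
have G0 : 0 < G by rewrite ltr_wpDl// divr_ge0 ?mulr_ge0 ?exprn_ge0// ltW.
have etaG : 0 < eta / (2 * G) by rewrite divr_gt0// mulr_gt0.
have etaK : 0 < eta * dl / (2 * (K + 1)) by apply: divr_gt0; apply: mulr_gt0.
have eta2 : 0 < eta / 2 by rewrite divr_gt0.
near=> n => x.
have n1 : (1 <= n)%N by near: n; exact: nbhs_infty_ge.
have [rr re] : n%:R `^ (- (r / 2)) <= rho n /\ (Num.sqrt n%:R)^-1 ^+ r' <= rho n by near: n.
have eG : (Num.sqrt n%:R)^-1 <= eta / (2 * G) by near: n; exact: invr_sqrt_small.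
have e1 : (Num.sqrt n%:R)^-1 <= 1 :> R by near: n; exact: invr_sqrt_small.
have aK : `|a' n| <= eta * dl / (2 * (K + 1)) * (Num.sqrt n%:R)^-1 ^+ r'.
  by near: n; exact: SP_small_sqrt.
have hKn : (\int[@lebesgue_measure R]_(s in [set s : R | (K < `|s| < Bd * (n%:R `^ ((r - 1) / 2)))%R])
    (nc (f n s) / `|s|)%:E <= (eta / 2 * (n%:R `^ (- (r / 2))))%:E)%E by near: n; exact: hK.
have hn : forall t : R, 0 < t -> t < dl0 * Num.sqrt n%:R ->
  `|Re (f n (t / Num.sqrt n%:R)) -
     edgeworth_re sigma2 J (edgeworth_coef M alpha (Num.sqrt n%:R)^-1) t| +
  `|Im (f n (t / Num.sqrt n%:R)) -
     edgeworth_im sigma2 J (edgeworth_coef M alpha (Num.sqrt n%:R)^-1) t| <=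
  t * (eta * rho n * ((Num.sqrt n%:R)^-1 + C * expR (- (sigma2 / 8) * t ^+ 2))) by near: n.
pose sn : R := Num.sqrt n%:R; pose e := sn^-1; rewrite -/sn -/e in re eG e1 aK hn.
have nR : (0 : R) < n%:R by rewrite ltr0n.
have sn0 : 0 < sn by rewrite sqrtr_gt0.
have e0 : 0 < e by rewrite invr_gt0.
have rho0 : 0 <= rho n by exact: powR_ge0.
pose T' := Bd / 2 * n%:R `^ (r / 2).
have T'0 : 0 < T' by apply: mulr_gt0; [exact: divr_gt0|exact: powR_gt0].
have T'sn : T' / sn = Bd / 2 * n%:R `^ ((r - 1) / 2).
  rewrite /T' /sn -mulrA; congr (_ * _).
  rewrite -powR12_sqrt// -powRB; last by apply/implyP => _; rewrite gt_eqF.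
  by congr (_ `^ _); field.
have far : (\int[@lebesgue_measure R]_(s in `[(K + 1)%R, (T' / sn)%R]) (nc (f n s) / s)%:E <=
    (eta / 2 * n%:R `^ (- (r / 2)))%:E)%E.
  have mnorm : measurable [set s : R | K < `|s| < Bd * n%:R `^ ((r - 1) / 2)].
    have -> : [set s : R | K < `|s| < Bd * n%:R `^ ((r - 1) / 2)] =
        setT `&` (Num.norm @^-1` `]K, (Bd * n%:R `^ ((r - 1) / 2))[%classic).
      by rewrite setTI; apply/seteqP; split => s /=; rewrite in_itv.
    exact: (@normr_measurable R setT).
  have mf : measurable_fun setT (fun s : R => nc (f n s) / `|s|).
    apply: measurable_funM.
      apply: continuous_measurable_fun; apply: continuous_nc.
        exact: continuous_charf_re (mS n n1) (mpsi n n1) (psi0 n n1) (psi1 n n1).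
      exact: continuous_charf_im (mS n n1) (mpsi n n1) (psi0 n n1) (psi1 n n1).
    by apply: measurable_funV; exact: normr_measurable.
  apply: le_trans hKn; rewrite T'sn.
  have -> : (\int[@lebesgue_measure R]_(s in `[(K + 1)%R, (Bd / 2 * n%:R `^ ((r - 1) / 2))%R]) (nc (f n s) / s)%:E =
      \int[@lebesgue_measure R]_(s in `[(K + 1)%R, (Bd / 2 * n%:R `^ ((r - 1) / 2))%R]) (nc (f n s) / `|s|)%:E)%E.
    apply: eq_integral => s; rewrite inE /= in_itv /= => /andP[Ks _].
    by rewrite [`|s|]gtr0_norm// (lt_le_trans Kp).
  apply: ge0_subset_integral => //.
  - by apply/measurable_EFinP; exact: measurable_funTS.
  - by move=> s _; rewrite lee_fin divr_ge0// nc_ge0.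
  - move=> s /=; rewrite in_itv /= => /andP[Ks sB].
    rewrite [`|s|]gtr0_norm ?(lt_le_trans Kp)//; apply/andP; split.
      by apply: lt_le_trans Ks; rewrite ltrDl.
    apply: (le_lt_trans sB); rewrite ltr_pM2r ?powR_gt0//.
    by rewrite ltr_pdivrMr// ltr_pMr// ltr1n.
have near0 t : 0 < t -> t < dl * sn ->
    `|Re (f n (t / sn)) - edgeworth_re sigma2 J (edgeworth_coef M alpha e) t| +
    `|Im (f n (t / sn)) - edgeworth_im sigma2 J (edgeworth_coef M alpha e) t| <=
    t * (eta * rho n * e + eta * rho n * C * expR (- (sigma2 / 8) * t ^+ 2)).
  move=> t0 tdl; rewrite -mulrA -mulrA -mulrA -!mulrDr.
  have := hn t t0 (lt_le_trans tdl _); rewrite -!mulrA; apply.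
  by rewrite ler_pM2r// ge_min lexx.
have gauss t : dl * sn <= t ->
    `|edgeworth_re sigma2 J (edgeworth_coef M alpha e) t| +
    `|edgeworth_im sigma2 J (edgeworth_coef M alpha e) t| <=
    t * (C3 / (dl * sn) ^+ r'.+1 * expR (- (sigma2 / 4) * t ^+ 2)).
  by apply: hC3; [move=> j; exact: edgeworth_coef_le (ltW e0) e1|exact: mulr_gt0].
have middle s : dl * sn / sn <= s -> s <= K + 1 -> nc (f n s) <= `|a' n|.
  rewrite mulfK ?gt_eqF// => ds sK; apply: le_trans (ler_norm _); exact: ha'.
have := edgeworth_error (mS n n1) (mpsi n n1) (psi0 n n1) (psi1 n n1) n1 V0 T'0
  (mulr_gt0 dlp sn0) Kp L0 (mulr_ge0 (mulr_ge0 (ltW eta0) rho0) (ltW e0))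
  (mulr_ge0 (mulr_ge0 (ltW eta0) rho0) (ltW C0))
  (divr_ge0 (ltW C30) (exprn_ge0 r'.+1 (ltW (mulr_gt0 dlp sn0)))) (normr_ge0 (a' n))
  (mulr_ge0 (ltW eta2) (powR_ge0 _ _)) (fun u v uv => hL e u v (ltW e0) e1 uv)
  near0 gauss middle far hI8 hI4 x.
have esn : e * sn = 1 by rewrite /e mulVf// gt_eqF.
have P1 : eta * rho n * e * (dl * sn) <= eta * rho n.
  rewrite (_ : _ * _ = eta * rho n * (dl * (e * sn))); last by ring.
  rewrite esn mulr1; apply: ler_piMr; first by apply: mulr_ge0 => //; exact: ltW.
  by rewrite ge_min lexx orbT.
(* The tail bound contains e ^ (r' + 1). One factor e is made smaller than eta / (2 G), which
   neutralizes the constants including the power of dl; the other r' factors are at most rho. *)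
have P3 : 2 * (C3 / (dl * sn) ^+ r'.+1 * I4) <= eta * rho n.
  have -> : 2 * (C3 / (dl * sn) ^+ r'.+1 * I4) = 2 * (C3 * I4 / dl ^+ r'.+1 * e) * e ^+ r'.
    by rewrite exprMn invfM -(exprVn sn) -/e (exprS e); ring.
  apply: ler_pM => //; first 2 last.
  - have -> : eta = 2 * (G * (eta / (2 * G))) by field; rewrite gt_eqF.
    apply: ler_wpM2l => //; apply: ler_pM => //; first 2 last.
    + by rewrite /G lerDl.
    + by apply: divr_ge0; [exact: mulr_ge0 (ltW C30) I40|exact: exprn_ge0 (ltW dlp)].
    + exact: ltW.
  - apply: mulr_ge0 => //; apply: mulr_ge0; last exact: ltW.
    by apply: divr_ge0; [exact: mulr_ge0 (ltW C30) I40|exact: exprn_ge0 (ltW dlp)].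
  - by apply: exprn_ge0; exact: ltW.
have P4 : 2 * (`|a' n| * (K + 1) * sn / (dl * sn)) <= eta * rho n.
  have -> : 2 * (`|a' n| * (K + 1) * sn / (dl * sn)) = `|a' n| * (2 * (K + 1) / dl).
    by field; rewrite !gt_eqF.
  have -> : eta * rho n = eta * dl / (2 * (K + 1)) * rho n * (2 * (K + 1) / dl).
    by field; rewrite !gt_eqF.
  apply: ler_wpM2r; first by apply: divr_ge0; [apply: mulr_ge0 => //; exact: ltW|exact: ltW].
  by apply: (le_trans aK); apply: ler_wpM2l => //; exact: ltW.
have P5 : 2 * (eta / 2 * n%:R `^ (- (r / 2))) <= eta * rho n.
  by rewrite mulrA mulrCA mulfV ?mulr1 ?pnatr_eq0//; apply: ler_wpM2l => //; exact: ltW.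
have P6 : 400 * (L / T') <= eps / 2 * rho n.
  rewrite mulrA -qE; apply: le_trans (ler_wpM2l _ rr); last by rewrite divr_ge0// ltW.
  rewrite powRN /T' /Bd le_eqVlt; apply/orP; left; apply/eqP.
  by field; rewrite !gt_eqF ?powR_gt0.
have etaE : eta * (4 + C * I8) = eps / 32 by rewrite /eta; field; rewrite gt_eqF.
have budget : 16 * (eta * rho n * e * (dl * sn) + eta * rho n * C * I8 +
    2 * (C3 / (dl * sn) ^+ r'.+1 * I4) + 2 * (`|a' n| * (K + 1) * sn / (dl * sn)) +
    2 * (eta / 2 * n%:R `^ (- (r / 2)))) + 400 * (L / T') <= eps * rho n.
  apply: (@le_trans _ _ (16 * (eta * rho n + eta * rho n * C * I8 + eta * rho n + eta * rho n +
     eta * rho n) + eps / 2 * rho n)).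
    by apply: lerD => //; apply: ler_wpM2l => //; do !apply: lerD => //.
  have -> : 16 * (eta * rho n + eta * rho n * C * I8 + eta * rho n + eta * rho n +
     eta * rho n) + eps / 2 * rho n = 16 * (eta * (4 + C * I8)) * rho n + eps / 2 * rho n by ring.
  by rewrite etaE -mulrDl le_eqVlt; apply/orP; left; apply/eqP; field.
move=> /le_trans /(_ budget); congr (`|_ - _| <= _).
rewrite edgeworth_polyE horner_sum mulrC; congr (_ * _).
rewrite big_add1 /= big_mkord; apply: eq_bigr => l _.
by rewrite hornerZ powR_half exprVn mulrC.
Unshelve. all: by end_near. Qed.
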